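(* Let $R$ be a commutative Noetherian ring and let $A$ and $B$ be Noetherian commutative $R$-algebras such that $A\otimes_R B$ is Noetherian. Let $P$ be a prime ideal of $A\otimes_R B$ with $n:=P\cap R$, $p:=P\cap A$ and $q:=P\cap B$. If $R_n\to A_p$ is formally smooth (for the $pA_p$-adic topology on $A_p$), then $$\operatorname{embdim}\big((A\otimes_R B)_P\big)=\operatorname{embdim}(A_p)+\operatorname{embdim}(B_q)-\operatorname{embdim}(R_n)+\dim\Big(\big(k_A(p)\otimes_{k_R(n)}k_B(q)\big)_{P(k_A(p)\otimes_{k_R(n)}k_B(q))}\Big).$$
   Context: All rings are commutative with unit, and ring homomorphisms are unital. $P\cap A$, $P\cap B$, $P\cap R$ denote the inverse images of $P$ under the canonical homomorphisms $A\to A\otimes_R B$, $B\to A\otimes_R B$, $R\to A\otimes_R B$. For a prime $p$ of a ring $A$, $k_A(p)=A_p/pA_p$ is the residue field at $p$. The ring $k_A(p)\otimes_{k_R(n)}k_B(q)$ is a quotient of a localization of $A\otimes_R B$, and $P(k_A(p)\otimes_{k_R(n)}k_B(q))$ is the prime ideal generated in it by the image of $P$; the corresponding subscript denotes localization at this prime. For a Noetherian local ring $S$ with maximal ideal $m$ and residue field $l$, $\operatorname{embdim}(S)=\dim_l(m/m^2)$; $\dim$ of a ring is Krull dimension. A homomorphism $S\to T$ with $T$ local with maximal ideal $m_T$ is formally smooth (for the $m_T$-adic topology) if for every $S$-algebra $C$ and every ideal $N\subset C$ with $N^2=0$, every $S$-algebra homomorphism $T\to C/N$ that vanishes on some power of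 $m_T$ lifts to an $S$-algebra homomorphism $T\to C$. *)

(* Defs.v *)
From HB Require Import structures.
From mathcomp Require Import all_boot all_order all_algebra ring.
From mathcomp Require Import boolp classical_sets constructive_ereal.

Set Implicit Arguments.
Unset Strict Implicit.
Unset Printing Implicit Defensive.

Import GRing.Theory.
Local Open Scope ring_scope.
Local Open Scope quotient_scope.
Local Open Scope classical_set_scope.

Section Ideals.
Variable A : comPzRingType.

Definition ideal_axiom (I : set A) :=
  [/\ I 0, forall x y, I x -> I y -> I (x + y) & forall a x, I x -> I (a * x)].

Record ideal := Ideal { ideal_set :> A -> Prop; idealP : ideal_axiom ideal_set }.

Definition prime_axiom (I : set A) :=
  ~ I 1 /\ forall x y, I (x * y) -> I x \/ I y.

Record primeIdeal :=
  PrimeIdeal { prime_ideal :> ideal; primeP : prime_axiom prime_ideal }.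

Implicit Type I : ideal.

Lemma ideal0 I : I 0. Proof. by case: (idealP I). Qed.

Lemma idealD I x y : I x -> I y -> I (x + y).
Proof. by case: (idealP I) => _ + _; apply. Qed.

Lemma idealMl I a x : I x -> I (a * x).
Proof. by case: (idealP I) => _ _; apply. Qed.

Lemma idealMr I a x : I x -> I (x * a).
Proof. by rewrite mulrC; apply: idealMl. Qed.

Lemma idealN I x : I x -> I (- x).
Proof. by rewrite -mulN1r; apply: idealMl. Qed.

Lemma idealB I x y : I x -> I y -> I (x - y).
Proof. by move=> Ix /idealN; apply: idealD. Qed.

Lemma idealBC I x y : I (x - y) -> I (y - x).
Proof. by move/idealN; rewrite opprB. Qed.

Lemma idealBtrans I y x z : I (x - y) -> I (y - z) -> I (x - z).
Proof. by move=> h /(idealD h); rewrite addrA subrK. Qed.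

Lemma prime1 (P : primeIdeal) : ~ P 1. Proof. by case: (primeP P). Qed.

Lemma primeM (P : primeIdeal) x y : P (x * y) -> P x \/ P y.
Proof. by case: (primeP P) => _; apply. Qed.

Lemma gen_subproof (X : set A) :
  ideal_axiom [set x | forall I, X `<=` I -> I x].
Proof.
split=> [I _|x y hx hy I XI|a x hx I XI]; first exact: ideal0.
  by apply: idealD; [apply: hx | apply: hy].
by apply: idealMl; apply: hx.
Qed.

Definition gen (X : set A) : ideal := Ideal (gen_subproof X).

Lemma sub_gen (X : set A) : X `<=` gen X.
Proof. by move=> x Xx I; apply. Qed.

Lemma gen_min (X : set A) I : X `<=` I -> gen X `<=` I.
Proof. by move=> XI x; apply. Qed.

Definition idealM (I J : ideal) : ideal :=
  gen [set z | exists x y, [/\ I x, J y & z = x * y]].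

Definition idealX (I : ideal) (n : nat) : ideal := iter n (idealM I) (gen setT).

Lemma mem_idealM (I J : ideal) x y : I x -> J y -> idealM I J (x * y).
Proof. by move=> Ix Jy; apply: sub_gen; exists x, y. Qed.

End Ideals.

Definition noetherian (A : comPzRingType) :=
  forall I : ideal A, exists s : seq A, I `<=>` gen [set` s].

(* The supremum of the empty set is -oo, so the zero ring has dimension -oo. *)
Definition krull_dim (A : comPzRingType) : \bar int :=
  supremum -oo%E
    [set d%:Z%:E%E | d in
       [set d : nat | exists c : nat -> primeIdeal A,
          forall i, (i < d)%N -> (c i : set A) `<` c i.+1]].

Section Contraction.
Variables (A B : comPzRingType) (f : {rmorphism A -> B}).

Lemma contract_subproof (P : primeIdeal B) : ideal_axiom (f @^-1` P).
Proof.
split=> [|x y|a x]; rewrite /= ?rmorph0 ?rmorphD ?rmorphM.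
- exact: ideal0.
- exact: idealD.
- exact: idealMl.
Qed.

Lemma contract_prime_subproof (P : primeIdeal B) :
  prime_axiom (Ideal (contract_subproof P)).
Proof.
split=> [|x y] /=; first by rewrite rmorph1; apply: prime1.
by rewrite rmorphM => /primeM.
Qed.

Definition contract (P : primeIdeal B) : primeIdeal A :=
  PrimeIdeal (contract_prime_subproof P).

End Contraction.

Section QuotientRing.
Variables (A : comPzRingType) (I : ideal A).

Definition qring_equiv : rel A := fun x y => `[< I (x - y) >].

Lemma qring_equivP : equiv_class_of qring_equiv.
Proof.
split=> [x|x y|y x z].
- by apply/asboolP; rewrite subrr; apply: ideal0.
- by apply/asboolP/asboolP => /idealBC.
- by move=> /asboolP h /asboolP k; apply/asboolP; apply: idealBtrans k.
Qed.

Canonical qring_equiv_canonical := EquivRelPack qring_equivP.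
Canonical qring_encModRel := defaultEncModRel qring_equiv.

Definition qring := {eq_quot qring_equiv}.
HB.instance Definition _ : EqQuotient A qring_equiv qring :=
  EqQuotient.on qring.
HB.instance Definition _ := Choice.on qring.

Definition qproj (x : A) : qring := \pi x.

Lemma qprojW (T : qring -> Prop) : (forall x, T (qproj x)) -> forall y, T y.
Proof. by move=> h; elim/quotW. Qed.

Lemma qring_eqP (x y : A) : qproj x = qproj y <-> I (x - y).
Proof.
split=> [/eqP|h]; first by rewrite /qproj piE => /asboolP.
by apply/eqP; rewrite /qproj piE; apply/asboolP.
Qed.

Lemma qring_repr (x : A) : I (repr (qproj x) - x).
Proof. by apply/qring_eqP; rewrite /qproj reprK. Qed.

Definition qadd (x y : qring) := qproj (repr x + repr y).
Definition qopp (x : qring) := qproj (- repr x).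
Definition qmul (x y : qring) := qproj (repr x * repr y).

Lemma qaddE x y : qadd (qproj x) (qproj y) = qproj (x + y).
Proof.
apply/qring_eqP; rewrite opprD addrACA.
by apply: idealD; apply: qring_repr.
Qed.

Lemma qoppE x : qopp (qproj x) = qproj (- x).
Proof. by apply/qring_eqP; rewrite -opprD; apply/idealN/qring_repr. Qed.

Lemma qmulE x y : qmul (qproj x) (qproj y) = qproj (x * y).
Proof.
apply/qring_eqP.
apply: (@idealBtrans _ _ (x * repr (qproj y))).
  by rewrite -mulrBl; apply/idealMr/qring_repr.
by rewrite -mulrBr; apply/idealMl/qring_repr.
Qed.

Lemma qaddA : associative qadd.
Proof. by elim/qprojW=> x; elim/qprojW=> y; elim/qprojW=> z; rewrite !qaddE addrA. Qed.
Lemma qaddC : commutative qadd.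
Proof. by elim/qprojW=> x; elim/qprojW=> y; rewrite !qaddE addrC. Qed.
Lemma qadd0 : left_id (qproj 0) qadd.
Proof. by elim/qprojW=> x; rewrite !qaddE add0r. Qed.
Lemma qaddN : left_inverse (qproj 0) qopp qadd.
Proof. by elim/qprojW=> x; rewrite qoppE !qaddE addNr. Qed.
HB.instance Definition _ := GRing.isZmodule.Build qring qaddA qaddC qadd0 qaddN.

Lemma qmulA : associative qmul.
Proof. by elim/qprojW=> x; elim/qprojW=> y; elim/qprojW=> z; rewrite !qmulE mulrA. Qed.
Lemma qmulC : commutative qmul.
Proof. by elim/qprojW=> x; elim/qprojW=> y; rewrite !qmulE mulrC. Qed.
Lemma qmul1 : left_id (qproj 1) qmul.
Proof. by elim/qprojW=> x; rewrite !qmulE mul1r. Qed.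
Lemma qmulDl : left_distributive qmul +%R.
Proof.
move=> x y z; rewrite -[x + y]/(qadd x y) -[RHS]/(qadd _ _).
elim/qprojW: x => x; elim/qprojW: y => y; elim/qprojW: z => z.
by rewrite qaddE !qmulE qaddE mulrDl.
Qed.
HB.instance Definition _ :=
  GRing.Zmodule_isComPzRing.Build qring qmulA qmulC qmul1 qmulDl.

Lemma qproj_zmod : zmod_morphism qproj.
Proof. by move=> x y; rewrite -qaddE -qoppE. Qed.
Lemma qproj_monoid : monoid_morphism qproj.
Proof. by split=> // x y; rewrite -qmulE. Qed.
HB.instance Definition _ := GRing.isZmodMorphism.Build A qring qproj qproj_zmod.
HB.instance Definition _ :=
  GRing.isMonoidMorphism.Build A qring qproj qproj_monoid.

Lemma qproj_eq0 x : qproj x = 0 <-> I x.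
Proof. by rewrite -(rmorph0 qproj) qring_eqP subr0. Qed.

Section Lift.
Variables (C : comPzRingType) (f : {rmorphism A -> C}).
Hypothesis fI : forall x, I x -> f x = 0.

Definition qlift of (forall x, I x -> f x = 0) := fun x : qring => f (repr x).

Lemma qliftE x : qlift fI (qproj x) = f x.
Proof.
by apply/eqP; rewrite -subr_eq0 -rmorphB; apply/eqP/fI/qring_repr.
Qed.

Lemma qlift_zmod : zmod_morphism (qlift fI).
Proof.
by elim/qprojW=> x; elim/qprojW=> y; rewrite -rmorphB !qliftE rmorphB.
Qed.
Lemma qlift_monoid : monoid_morphism (qlift fI).
Proof.
split=> [|x y]; first by rewrite -(rmorph1 qproj) qliftE rmorph1.
by elim/qprojW: x => x; elim/qprojW: y => y; rewrite -rmorphM !qliftE rmorphM.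
Qed.
HB.instance Definition _ :=
  GRing.isZmodMorphism.Build qring C (qlift fI) qlift_zmod.
HB.instance Definition _ :=
  GRing.isMonoidMorphism.Build qring C (qlift fI) qlift_monoid.
End Lift.

End QuotientRing.

Section Localization.
Variable A : comPzRingType.

Definition mult_axiom (S : set A) :=
  S 1 /\ forall x y, S x -> S y -> S (x * y).

Record multSet := MultSet { mult_set :> A -> Prop; multP : mult_axiom mult_set }.

Variable S : multSet.

Definition den := {s : A | `[< S s >]}.

Definition dval (s : den) : A := val s.

Lemma denP (s : den) : S (dval s). Proof. exact/asboolP/(valP s). Qed.

Definition mkden (s : A) (Ss : S s) : den := exist _ s (introT (asboolP _) Ss).

Definition den1 : den := mkden (proj1 (multP S)).
Definition denM (s t : den) : den := mkden (proj2 (multP S) _ _ (denP s) (denP t)).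

Lemma dval1 : dval den1 = 1. Proof. by []. Qed.
Lemma dvalM s t : dval (denM s t) = dval s * dval t. Proof. by []. Qed.
Lemma dval_mk s (Ss : S s) : dval (mkden Ss) = s. Proof. by []. Qed.
Definition dvalE := (dval1, dvalM, dval_mk).

Definition loc_equiv : rel (A * den) := fun x y =>
  `[< exists u : den, dval u * (x.1 * dval y.2) = dval u * (y.1 * dval x.2) >].

Lemma loc_equivP : equiv_class_of loc_equiv.
Proof.
split=> [x|x y|[y t] [x s] [z r]].
- by apply/asboolP; exists den1.
- by apply/asboolP/asboolP => -[u e]; exists u.
- move=> /asboolP [/= u e] /asboolP [/= v f]; apply/asboolP.
  exists (denM (denM u v) t); rewrite /= !dvalE.
  transitivity (dval v * dval r * (dval u * (x * dval t))); first ring.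
  rewrite e; transitivity (dval u * dval s * (dval v * (y * dval r))); first ring.
  rewrite f; ring.
Qed.

Canonical loc_equiv_canonical := EquivRelPack loc_equivP.
Canonical loc_encModRel := defaultEncModRel loc_equiv.

Definition loc := {eq_quot loc_equiv}.
HB.instance Definition _ : EqQuotient (A * den)%type loc_equiv loc :=
  EqQuotient.on loc.
HB.instance Definition _ := Choice.on loc.

Definition lfrac (a : A) (s : den) : loc := \pi_loc (a, s).

Lemma lfracW (T : loc -> Prop) : (forall a s, T (lfrac a s)) -> forall x, T x.
Proof. by move=> h; elim/quotW=> -[a s]; apply: h. Qed.

Lemma lfrac_eqP a s b t : lfrac a s = lfrac b t <->
  exists u : den, dval u * (a * dval t) = dval u * (b * dval s).
Proof.
rewrite /lfrac; split=> [/eqP|h]; first by rewrite piE => /asboolP.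
by apply/eqP; rewrite piE; apply/asboolP.
Qed.

Lemma lfrac_eq a s b t : a * dval t = b * dval s -> lfrac a s = lfrac b t.
Proof. by move=> e; apply/lfrac_eqP; exists den1; rewrite e. Qed.

Lemma lfrac_repr a s : exists u : den,
  dval u * ((repr (lfrac a s)).1 * dval s) = dval u * (a * dval (repr (lfrac a s)).2).
Proof.
by apply/lfrac_eqP; rewrite /lfrac -surjective_pairing reprK.
Qed.

Definition ladd (x y : loc) : loc :=
  lfrac ((repr x).1 * dval (repr y).2 + (repr y).1 * dval (repr x).2)
        (denM (repr x).2 (repr y).2).
Definition lopp (x : loc) : loc := lfrac (- (repr x).1) (repr x).2.
Definition lmul (x y : loc) : loc :=
  lfrac ((repr x).1 * (repr y).1) (denM (repr x).2 (repr y).2).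

Lemma laddE a s b t :
  ladd (lfrac a s) (lfrac b t) = lfrac (a * dval t + b * dval s) (denM s t).
Proof.
rewrite /ladd; have [u] := lfrac_repr a s; have [v] := lfrac_repr b t.
case: (repr (lfrac a s)) => a' s'; case: (repr (lfrac b t)) => b' t' /= f e.
apply/lfrac_eqP; exists (denM u v); rewrite !dvalE.
transitivity (dval v * dval t' * dval t * (dval u * (a' * dval s))
  + dval u * dval s' * dval s * (dval v * (b' * dval t))); first ring.
rewrite e f; ring.
Qed.

Lemma loppE a s : lopp (lfrac a s) = lfrac (- a) s.
Proof.
rewrite /lopp; have [u] := lfrac_repr a s.
case: (repr (lfrac a s)) => a' s' /= e.
by apply/lfrac_eqP; exists u; rewrite !mulNr !mulrN e.
Qed.

Lemma lmulE a s b t : lmul (lfrac a s) (lfrac b t) = lfrac (a * b) (denM s t).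
Proof.
rewrite /lmul; have [u] := lfrac_repr a s; have [v] := lfrac_repr b t.
case: (repr (lfrac a s)) => a' s'; case: (repr (lfrac b t)) => b' t' /= f e.
apply/lfrac_eqP; exists (denM u v); rewrite !dvalE.
transitivity ((dval u * (a' * dval s)) * (dval v * (b' * dval t))); first ring.
rewrite e f; ring.
Qed.

Lemma laddA : associative ladd.
Proof.
elim/lfracW=> a s; elim/lfracW=> b t; elim/lfracW=> c u.
rewrite !laddE; apply: lfrac_eq => /=; rewrite ?dvalE; ring.
Qed.
Lemma laddC : commutative ladd.
Proof.
elim/lfracW=> a s; elim/lfracW=> b t.
rewrite !laddE; apply: lfrac_eq => /=; rewrite ?dvalE; ring.
Qed.
Lemma ladd0 : left_id (lfrac 0 den1) ladd.
Proof. elim/lfracW=> a s; rewrite !laddE; apply: lfrac_eq => /=; rewrite ?dvalE; ring. Qed.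
Lemma laddN : left_inverse (lfrac 0 den1) lopp ladd.
Proof. elim/lfracW=> a s; rewrite loppE laddE; apply: lfrac_eq => /=; rewrite ?dvalE; ring. Qed.
HB.instance Definition _ := GRing.isZmodule.Build loc laddA laddC ladd0 laddN.

Lemma lmulA : associative lmul.
Proof.
elim/lfracW=> a s; elim/lfracW=> b t; elim/lfracW=> c u.
rewrite !lmulE; apply: lfrac_eq => /=; rewrite ?dvalE; ring.
Qed.
Lemma lmulC : commutative lmul.
Proof.
elim/lfracW=> a s; elim/lfracW=> b t.
rewrite !lmulE; apply: lfrac_eq => /=; rewrite ?dvalE; ring.
Qed.
Lemma lmul1 : left_id (lfrac 1 den1) lmul.
Proof. elim/lfracW=> a s; rewrite !lmulE; apply: lfrac_eq => /=; rewrite ?dvalE; ring. Qed.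
Lemma lmulDl : left_distributive lmul +%R.
Proof.
move=> x y z; rewrite -[x + y]/(ladd x y) -[RHS]/(ladd _ _).
elim/lfracW: x => a s; elim/lfracW: y => b t; elim/lfracW: z => c u.
rewrite laddE !lmulE laddE; apply: lfrac_eq => /=; rewrite ?dvalE; ring.
Qed.
HB.instance Definition _ :=
  GRing.Zmodule_isComPzRing.Build loc lmulA lmulC lmul1 lmulDl.

Lemma lfracD a s b t :
  lfrac a s + lfrac b t = lfrac (a * dval t + b * dval s) (denM s t).
Proof. exact: laddE. Qed.
Lemma lfracN a s : - lfrac a s = lfrac (- a) s.
Proof. exact: loppE. Qed.
Lemma lfracM a s b t : lfrac a s * lfrac b t = lfrac (a * b) (denM s t).
Proof. exact: lmulE. Qed.

Definition linj (a : A) : loc := lfrac a den1.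

Lemma linj_zmod : zmod_morphism linj.
Proof.
move=> a b; rewrite /linj lfracN lfracD; apply: lfrac_eq => /=; rewrite ?dvalE; ring.
Qed.
Lemma linj_monoid : monoid_morphism linj.
Proof. by split=> // a b; rewrite /linj lfracM; apply: lfrac_eq => /=; rewrite ?dvalE; ring. Qed.
HB.instance Definition _ := GRing.isZmodMorphism.Build A loc linj linj_zmod.
HB.instance Definition _ := GRing.isMonoidMorphism.Build A loc linj linj_monoid.

Lemma lfracK a s : lfrac a s * linj (dval s) = linj a.
Proof. rewrite /linj lfracM; apply: lfrac_eq => /=; rewrite ?dvalE; ring. Qed.

Lemma linj_unit (s : den) : lfrac 1 s * linj (dval s) = 1.
Proof. by rewrite lfracK rmorph1. Qed.

Section Lift.
Variables (C : comPzRingType) (f : {rmorphism A -> C}).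
Hypothesis fS : forall s, S s -> exists c, c * f s = 1.

Definition finv (s : den) : C := projT1 (cid (fS (denP s))).
Lemma finvP s : finv s * f (dval s) = 1.
Proof. exact: projT2 (cid (fS (denP s))). Qed.

Definition llift (x : loc) : C := f (repr x).1 * finv (repr x).2.

Lemma finvI s (x y : C) : x * f (dval s) = y * f (dval s) -> x = y.
Proof.
move=> e; rewrite -[x]mulr1 -[y]mulr1 -(finvP s) !mulrA ![_ * finv s]mulrC.
by rewrite -!mulrA e.
Qed.

Lemma lliftP a s : llift (lfrac a s) * f (dval s) = f a.
Proof.
rewrite /llift; have [u] := lfrac_repr a s.
case: (repr (lfrac a s)) => a' s' /= /(congr1 f); rewrite !rmorphM => e.
apply: (finvI (s := u)); apply: (finvI (s := s')).
transitivity ((finv s' * f (dval s')) * (f (dval u) * (f a' * f (dval s)))); first ring.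
rewrite finvP e; ring.
Qed.

Lemma llift_linj a : llift (linj a) = f a.
Proof. by rewrite -(lliftP a den1) dval1 rmorph1 mulr1. Qed.

Lemma llift_zmod : zmod_morphism llift.
Proof.
elim/lfracW=> a s; elim/lfracW=> b t; apply: (finvI (s := denM s t)).
rewrite lfracN lfracD lliftP dvalM !rmorphD !rmorphM rmorphN -(lliftP a s) -(lliftP b t).
ring.
Qed.
Lemma llift_monoid : monoid_morphism llift.
Proof.
split=> [|x y]; first by rewrite -(rmorph1 linj) llift_linj rmorph1.
elim/lfracW: x => a s; elim/lfracW: y => b t; apply: (finvI (s := denM s t)).
rewrite lfracM lliftP dvalM !rmorphM -(lliftP a s) -(lliftP b t).
ring.
Qed.
HB.instance Definition _ := GRing.isZmodMorphism.Build loc C llift llift_zmod.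
HB.instance Definition _ := GRing.isMonoidMorphism.Build loc C llift llift_monoid.
End Lift.

End Localization.

Arguments linj {A S}.

(* A local ring is a ring in which the non-units form an ideal, which is then
   its unique maximal ideal. *)
HB.mixin Record isLocalRing S of GRing.ComPzRing S := {
  maxideal : ideal S;
  maxidealP : forall x : S, maxideal x <-> ~ exists y, y * x = 1
}.

#[short(type="localRingType")]
HB.structure Definition LocalRing := {S of isLocalRing S & GRing.ComPzRing S}.

Section LocalizationAtPrime.
Variables (A : comPzRingType) (P : primeIdeal A).

Lemma compl_subproof : mult_axiom (~` (P : A -> Prop)).
Proof. by split=> [|x y Px Py /primeM []] //; apply: prime1. Qed.

Definition locAt := loc (MultSet compl_subproof).
HB.instance Definition _ := GRing.ComPzRing.on locAt.

Lemma locAt_max_subproof : ideal_axiom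
  [set x : locAt | exists a s, P a /\ x = lfrac a s].
Proof.
split.
- by exists 0, (den1 _); split=> //; apply: ideal0.
- move=> _ _ [a [s [Pa ->]]] [b [t [Pb ->]]].
  exists (a * dval t + b * dval s), (denM s t); rewrite lfracD; split=> //.
  by apply: idealD; apply: idealMr.
- move=> x _ [a [s [Pa ->]]]; elim/lfracW: x => b t.
  by exists (b * a), (denM t s); rewrite lfracM; split=> //; apply: idealMl.
Qed.

Lemma mem_locAt_max a s : Ideal locAt_max_subproof (lfrac a s) <-> P a.
Proof.
split=> [[b [t [Pb /lfrac_eqP [u e]]]]|Pa]; last by exists a, s.
have /primeM[/(denP u)//|/primeM[//|/(denP t)//]] : P (dval u * (a * dval t)).
by rewrite e; apply/idealMl/idealMr.
Qed.

Lemma locAt_maxP (x : locAt) :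
  Ideal locAt_max_subproof x <-> ~ exists y, y * x = 1.
Proof.
elim/lfracW: x => a s; rewrite mem_locAt_max; split=> [Pa [y]|nu].
  elim/lfracW: y => b t; rewrite lfracM => /lfrac_eqP [u].
  rewrite dvalM dval1 mulr1 mul1r => e.
  have /primeM[/(denP u)//|/primeM[/(denP t)//|/(denP s)//]] :
    P (dval u * (dval t * dval s)).
  by rewrite -e; apply/idealMl/idealMl.
apply: contrapT => nPa; apply: nu.
exists (lfrac (dval s) (mkden (S := MultSet compl_subproof) nPa)).
by rewrite lfracM; apply: lfrac_eq => /=; rewrite ?dvalE; ring.
Qed.

HB.instance Definition _ := isLocalRing.Build locAt locAt_maxP.

End LocalizationAtPrime.

Definition residue (S : localRingType) := qring (@maxideal S).
HB.instance Definition _ (S : localRingType) := GRing.ComPzRing.on (residue S).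

Lemma residue_field (S : localRingType) (x : residue S) :
  x <> 0 -> exists y, y * x = 1.
Proof.
elim/qprojW: x => x nx; apply: contrapT => nu; apply: nx.
apply/qproj_eq0/maxidealP => -[y e]; apply: nu.
by exists (qproj _ y); rewrite -rmorphM e rmorph1.
Qed.

Section Conormal.
Variables (A : comPzRingType) (I : ideal A).

Definition idealType := {x : A | `[< I x >]}.
Definition ival (x : idealType) : A := val x.

Lemma ivalP x : I (ival x). Proof. exact/asboolP/(valP x). Qed.

Definition imk (x : A) (Ix : I x) : idealType :=
  exist _ x (introT (asboolP _) Ix).

Lemma ival_mk x (Ix : I x) : ival (imk Ix) = x. Proof. by []. Qed.

Definition conormal_equiv : rel idealType :=
  fun x y => `[< idealM I I (ival x - ival y) >].

Lemma conormal_equivP : equiv_class_of conormal_equiv.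
Proof.
split=> [x|x y|y x z].
- by apply/asboolP; rewrite subrr; apply: ideal0.
- by apply/asboolP/asboolP => /idealBC.
- by move=> /asboolP h /asboolP k; apply/asboolP; apply: idealBtrans k.
Qed.

Canonical conormal_equiv_canonical := EquivRelPack conormal_equivP.
Canonical conormal_encModRel := defaultEncModRel conormal_equiv.

Definition conormal := {eq_quot conormal_equiv}.
HB.instance Definition _ : EqQuotient idealType conormal_equiv conormal :=
  EqQuotient.on conormal.
HB.instance Definition _ := Choice.on conormal.

Definition cclass (x : A) (Ix : I x) : conormal := \pi_conormal (imk Ix).

Lemma cclassW (T : conormal -> Prop) :
  (forall x (Ix : I x), T (cclass Ix)) -> forall v, T v.
Proof.
move=> h; elim/quotW=> x; move: (h _ (ivalP x)); congr (T (\pi_conormal _)).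
exact: val_inj.
Qed.

Lemma cclass_eqP x y (Ix : I x) (Iy : I y) :
  cclass Ix = cclass Iy <-> idealM I I (x - y).
Proof.
rewrite /cclass; split=> [/eqP|h]; first by rewrite piE => /asboolP.
by apply/eqP; rewrite piE; apply/asboolP.
Qed.

Lemma cclass_eq x y (Ix : I x) (Iy : I y) : x = y -> cclass Ix = cclass Iy.
Proof. by move=> e; apply/cclass_eqP; rewrite e subrr; apply: ideal0. Qed.

Lemma cclass_repr x (Ix : I x) : idealM I I (ival (repr (cclass Ix)) - x).
Proof.
apply/(cclass_eqP (ivalP _) Ix); rewrite -[RHS]reprK.
by congr (\pi_conormal _); apply: val_inj.
Qed.

Definition cadd (u v : conormal) : conormal :=
  cclass (idealD (ivalP (repr u)) (ivalP (repr v))).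
Definition copp (u : conormal) : conormal := cclass (idealN (ivalP (repr u))).
Definition cscale (a : qring I) (u : conormal) : conormal :=
  cclass (idealMl (repr a) (ivalP (repr u))).

Lemma caddE x y (Ix : I x) (Iy : I y) :
  cadd (cclass Ix) (cclass Iy) = cclass (idealD Ix Iy).
Proof.
apply/cclass_eqP; rewrite opprD addrACA.
by apply: idealD; apply: cclass_repr.
Qed.

Lemma coppE x (Ix : I x) : copp (cclass Ix) = cclass (idealN Ix).
Proof. by apply/cclass_eqP; rewrite -opprD; apply/idealN/cclass_repr. Qed.

Lemma cscaleE a x (Ix : I x) :
  cscale (qproj I a) (cclass Ix) = cclass (idealMl a Ix).
Proof.
apply/cclass_eqP.
apply: (@idealBtrans _ _ (a * ival (repr (cclass Ix)))).
  by rewrite -mulrBl; apply: mem_idealM; [apply: qring_repr | apply: ivalP].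
by rewrite -mulrBr; apply/idealMl/cclass_repr.
Qed.

Lemma caddA : associative cadd.
Proof.
elim/cclassW=> x Ix; elim/cclassW=> y Iy; elim/cclassW=> z Iz.
by rewrite !caddE; apply: cclass_eq; rewrite addrA.
Qed.
Lemma caddC : commutative cadd.
Proof.
elim/cclassW=> x Ix; elim/cclassW=> y Iy.
by rewrite !caddE; apply: cclass_eq; rewrite addrC.
Qed.
Lemma cadd0 : left_id (cclass (ideal0 I)) cadd.
Proof. by elim/cclassW=> x Ix; rewrite caddE; apply: cclass_eq; rewrite add0r. Qed.
Lemma caddN : left_inverse (cclass (ideal0 I)) copp cadd.
Proof.
by elim/cclassW=> x Ix; rewrite coppE caddE; apply: cclass_eq; rewrite addNr.
Qed.
HB.instance Definition _ := GRing.isZmodule.Build conormal caddA caddC cadd0 caddN.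

Lemma cscaleA a b u : cscale a (cscale b u) = cscale (a * b) u.
Proof.
elim/qprojW: a => a; elim/qprojW: b => b; elim/cclassW: u => x Ix.
by rewrite -rmorphM !cscaleE; apply: cclass_eq; rewrite mulrA.
Qed.
Lemma cscale1 : left_id 1 cscale.
Proof.
elim/cclassW=> x Ix; rewrite -(rmorph1 (qproj I)) cscaleE.
by apply: cclass_eq; rewrite mul1r.
Qed.
Lemma cscaleDr : right_distributive cscale +%R.
Proof.
move=> a u v; rewrite -[u + v]/(cadd u v) -[RHS]/(cadd _ _).
elim/qprojW: a => a; elim/cclassW: u => x Ix; elim/cclassW: v => y Iy.
by rewrite caddE !cscaleE caddE; apply: cclass_eq; rewrite mulrDr.
Qed.
Lemma cscaleDl u : {morph cscale^~ u : a b / a + b}.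
Proof.
move=> a b; rewrite -[RHS]/(cadd _ _).
elim/qprojW: a => a; elim/qprojW: b => b; elim/cclassW: u => x Ix.
by rewrite -rmorphD !cscaleE caddE; apply: cclass_eq; rewrite mulrDl.
Qed.
HB.instance Definition _ := GRing.Zmodule_isLmodule.Build (qring I) conormal
  cscaleA cscale1 cscaleDr cscaleDl.

End Conormal.

(* The dimension of a vector space over a field, +oo if there is no finite
   basis. *)
Definition vspace_dim (K : comPzRingType) (V : lmodType K) : \bar int :=
  xget +oo%E [set n%:Z%:E%E | n in
    [set n : nat | exists f : {linear 'rV[K]_n -> V}, bijective f]].

Definition cotangent (S : localRingType) : lmodType (residue S) :=
  conormal (@maxideal S).

Definition embdim (S : localRingType) : \bar int := vspace_dim (cotangent S).

Definition formally_smooth (S : comPzRingType) (T : localRingType)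
    (f : {rmorphism S -> T}) :=
  forall (C : comPzRingType) (g : {rmorphism S -> C}) (N : ideal C),
  (forall x, idealX N 2 x -> x = 0) ->
  forall u : {rmorphism T -> qring N},
  (forall s, u (f s) = qproj N (g s)) ->
  (exists k, forall t, idealX (@maxideal T) k t -> u t = 0) ->
  exists v : {rmorphism T -> C},
    (forall s, v (f s) = g s) /\ (forall t, qproj N (v t) = u t).

Section Tensor.
Variables (R A B : comPzRingType).
Variables (phi : {rmorphism R -> A}) (psi : {rmorphism R -> B}).

(* A list of pairs (a, b) stands for the sum of the tensors a (x) b; the tensor
   product is the quotient of the free commutative monoid on A * B by the usual
   relations. Opposites come for free: (- a) (x) b + a (x) b = 0 (x) b = 0. *)
Inductive tens_rel : seq (A * B) -> seq (A * B) -> Prop :=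
| TensRefl s : tens_rel s s
| TensSym s t : tens_rel s t -> tens_rel t s
| TensTrans t s u : tens_rel s t -> tens_rel t u -> tens_rel s u
| TensCat s t u : tens_rel s t -> tens_rel (s ++ u) (t ++ u)
| TensC s t : tens_rel (s ++ t) (t ++ s)
| TensDl a a' b : tens_rel [:: (a + a', b)] [:: (a, b); (a', b)]
| TensDr a b b' : tens_rel [:: (a, b + b')] [:: (a, b); (a, b')]
| TensZ r a b : tens_rel [:: (phi r * a, b)] [:: (a, psi r * b)]
| Tens0 b : tens_rel [:: (0, b)] [::].

Definition tens_equiv : rel (seq (A * B)) := fun s t => `[< tens_rel s t >].

Lemma tens_equivP : equiv_class_of tens_equiv.
Proof.
split=> [s|s t|t s u].
- by apply/asboolP; constructor.
- by apply/asboolP/asboolP; apply: TensSym.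
- by move=> /asboolP h /asboolP k; apply/asboolP; apply: TensTrans k.
Qed.

Canonical tens_equiv_canonical := EquivRelPack tens_equivP.
Canonical tens_encModRel := defaultEncModRel tens_equiv.

Definition tensor := {eq_quot tens_equiv}.
HB.instance Definition _ : EqQuotient (seq (A * B)) tens_equiv tensor :=
  EqQuotient.on tensor.
HB.instance Definition _ := Choice.on tensor.

Definition tsum (s : seq (A * B)) : tensor := \pi_tensor s.

Lemma tsumW (T : tensor -> Prop) : (forall s, T (tsum s)) -> forall x, T x.
Proof. by move=> h; elim/quotW=> s; apply: h. Qed.

Lemma tsum_eqP s t : tsum s = tsum t <-> tens_rel s t.
Proof.
rewrite /tsum; split=> [/eqP|h]; first by rewrite piE => /asboolP.
by apply/eqP; rewrite piE; apply/asboolP.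
Qed.

Lemma tsum_repr s : tens_rel (repr (tsum s)) s.
Proof. by apply/tsum_eqP; rewrite /tsum reprK. Qed.

Lemma tens_rel_perm s t : perm_eq s t -> tens_rel s t.
Proof.
move=> st; move: (TensRefl s).
apply: (catCA_perm_ind (P := tens_rel s)) st => s1 s2 s3 h.
apply: TensTrans h _; rewrite !catA; apply: TensCat; exact: TensC.
Qed.

Lemma tens_rel_cat s s' t t' :
  tens_rel s s' -> tens_rel t t' -> tens_rel (s ++ t) (s' ++ t').
Proof.
move=> h k; apply: (TensTrans (t := s' ++ t)); first exact: TensCat.
apply: TensTrans (TensC _ _) _; apply: TensTrans _ (TensC _ _).
exact: TensCat.
Qed.

Definition tmul_seq (s t : seq (A * B)) : seq (A * B) :=
  [seq (x.1 * y.1, x.2 * y.2) | x <- s, y <- t].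

Definition topp_seq (s : seq (A * B)) : seq (A * B) :=
  [seq (- x.1, x.2) | x <- s].

Lemma tmul_seq_consl x s t :
  tmul_seq (x :: s) t = tmul_seq [:: x] t ++ tmul_seq s t.
Proof. by rewrite /tmul_seq /= cats0. Qed.

Lemma tmul_seq_catl s t u : tmul_seq (s ++ t) u = tmul_seq s u ++ tmul_seq t u.
Proof. exact: allpairs_cat. Qed.

Lemma tmul_seqC s t : tens_rel (tmul_seq s t) (tmul_seq t s).
Proof.
elim: s => [|x s IH].
  by rewrite /tmul_seq /=; elim: t => [|y t IH] //; exact: TensRefl.
rewrite tmul_seq_consl; apply: TensTrans (tens_rel_cat (TensRefl _) IH) _.
elim: t {IH} => [|y t IH]; first exact: TensRefl.
rewrite (tmul_seq_consl y t s) (tmul_seq_consl y t (x :: s)).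
apply: TensTrans (tens_rel_cat (TensRefl _) IH).
rewrite /tmul_seq /= !cats0 ![y.1 * x.1]mulrC ![y.2 * x.2]mulrC.
by apply: tens_rel_perm; rewrite perm_cons perm_catCA.
Qed.

Lemma tmul_seq_rel1 s s' y :
  tens_rel s s' -> tens_rel (tmul_seq s [:: y]) (tmul_seq s' [:: y]).
Proof.
elim=> {s s'}.
- by move=> s; apply: TensRefl.
- by move=> s t _; apply: TensSym.
- by move=> t s u _ h _; apply: TensTrans h.
- by move=> s t u _ h; rewrite !tmul_seq_catl; apply: TensCat.
- by move=> s t; rewrite !tmul_seq_catl; apply: TensC.
- by move=> a a' b; rewrite /tmul_seq /= mulrDl; apply: TensDl.
- by move=> a b b'; rewrite /tmul_seq /= mulrDl; apply: TensDr.
- by move=> r a b; rewrite /tmul_seq /= -!mulrA; apply: TensZ.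
- by move=> b; rewrite /tmul_seq /= mul0r; apply: Tens0.
Qed.

Lemma tmul_seq_rell s s' t :
  tens_rel s s' -> tens_rel (tmul_seq s t) (tmul_seq s' t).
Proof.
move=> h; apply: TensTrans (tmul_seqC _ _) _.
apply: TensTrans (tmul_seqC _ _).
elim: t => [|y t IH]; first exact: TensRefl.
rewrite (tmul_seq_consl y t s) (tmul_seq_consl y t s'); apply: tens_rel_cat IH.
apply: TensTrans (tmul_seqC _ _) _; apply: TensTrans (tmul_seqC _ _).
exact: tmul_seq_rel1.
Qed.

Lemma tmul_seq_rel s s' t t' :
  tens_rel s s' -> tens_rel t t' -> tens_rel (tmul_seq s t) (tmul_seq s' t').
Proof.
move=> h k; apply: TensTrans (tmul_seq_rell _ h) _.
apply: TensTrans (tmul_seqC _ _) _; apply: TensTrans (tmul_seqC _ _).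
exact: tmul_seq_rell.
Qed.

Lemma topp_seqE s : topp_seq s = tmul_seq [:: (-1, 1)] s.
Proof.
rewrite /topp_seq /tmul_seq /= cats0.
by apply: eq_map => x; rewrite mulN1r mul1r.
Qed.

Lemma topp_seqN s : tens_rel (topp_seq s ++ s) [::].
Proof.
elim: s => [|[a b] s IH]; first exact: TensRefl.
apply: (TensTrans (t := [:: (- a, b); (a, b)] ++ (topp_seq s ++ s))).
  by apply: tens_rel_perm; rewrite /= perm_cons perm_sym -cat1s perm_catCA.
rewrite -[[::]]cats0; apply: tens_rel_cat IH.
apply: TensTrans (TensSym (TensDl _ _ _)) _; rewrite addNr.
exact: Tens0.
Qed.

Definition tadd (x y : tensor) := tsum (repr x ++ repr y).
Definition topp (x : tensor) := tsum (topp_seq (repr x)).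
Definition tmul (x y : tensor) := tsum (tmul_seq (repr x) (repr y)).

Lemma taddE s t : tadd (tsum s) (tsum t) = tsum (s ++ t).
Proof. by apply/tsum_eqP; apply: tens_rel_cat; apply: tsum_repr. Qed.

Lemma toppE s : topp (tsum s) = tsum (topp_seq s).
Proof.
apply/tsum_eqP; rewrite !topp_seqE.
by apply: tmul_seq_rel; [apply: TensRefl | apply: tsum_repr].
Qed.

Lemma tmulE s t : tmul (tsum s) (tsum t) = tsum (tmul_seq s t).
Proof. by apply/tsum_eqP; apply: tmul_seq_rel; apply: tsum_repr. Qed.

Lemma taddA : associative tadd.
Proof. by elim/tsumW=> s; elim/tsumW=> t; elim/tsumW=> u; rewrite !taddE catA. Qed.
Lemma taddC : commutative tadd.
Proof.
by elim/tsumW=> s; elim/tsumW=> t; rewrite !taddE; apply/tsum_eqP/TensC.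
Qed.
Lemma tadd0 : left_id (tsum [::]) tadd.
Proof. by elim/tsumW=> s; rewrite taddE. Qed.
Lemma taddN : left_inverse (tsum [::]) topp tadd.
Proof. by elim/tsumW=> s; rewrite toppE taddE; apply/tsum_eqP/topp_seqN. Qed.
HB.instance Definition _ := GRing.isZmodule.Build tensor taddA taddC tadd0 taddN.

Lemma tmulA : associative tmul.
Proof.
elim/tsumW=> s; elim/tsumW=> t; elim/tsumW=> u; rewrite !tmulE; congr tsum.
elim: s => // x s IH; rewrite tmul_seq_consl [in RHS]tmul_seq_consl tmul_seq_catl.
congr (_ ++ _); last exact: IH.
elim: t {IH} => // y t IH; rewrite (tmul_seq_consl y t) /tmul_seq /= !cats0.
rewrite map_cat; congr (_ ++ _).
  by rewrite -map_comp; apply: eq_map => z /=; rewrite !mulrA.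
by move: IH; rewrite /tmul_seq /= !cats0.
Qed.
Lemma tmulC : commutative tmul.
Proof.
by elim/tsumW=> s; elim/tsumW=> t; rewrite !tmulE; apply/tsum_eqP/tmul_seqC.
Qed.
Lemma tmul1 : left_id (tsum [:: (1, 1)]) tmul.
Proof.
elim/tsumW=> s; rewrite tmulE /tmul_seq /= cats0; congr tsum.
by rewrite -[RHS]map_id; apply: eq_map => -[a b] /=; rewrite !mul1r.
Qed.
Lemma tmulDl : left_distributive tmul +%R.
Proof.
move=> x y z; rewrite -[x + y]/(tadd x y) -[RHS]/(tadd _ _).
elim/tsumW: x => s; elim/tsumW: y => t; elim/tsumW: z => u.
by rewrite taddE !tmulE taddE tmul_seq_catl.
Qed.
HB.instance Definition _ :=
  GRing.Zmodule_isComPzRing.Build tensor tmulA tmulC tmul1 tmulDl.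

Definition tpure (a : A) (b : B) : tensor := tsum [:: (a, b)].

Lemma tpureDl a a' b : tpure (a + a') b = tpure a b + tpure a' b.
Proof. by rewrite -[RHS]/(tadd _ _) taddE; apply/tsum_eqP/TensDl. Qed.
Lemma tpureDr a b b' : tpure a (b + b') = tpure a b + tpure a b'.
Proof. by rewrite -[RHS]/(tadd _ _) taddE; apply/tsum_eqP/TensDr. Qed.
Lemma tpureZ r a b : tpure (phi r * a) b = tpure a (psi r * b).
Proof. exact/tsum_eqP/TensZ. Qed.
Lemma tpureM a b a' b' : tpure (a * a') (b * b') = tpure a b * tpure a' b'.
Proof. by rewrite -[RHS]/(tmul _ _) tmulE. Qed.
Lemma tpure11 : tpure 1 1 = 1. Proof. by []. Qed.

Lemma tensor_ind (T : tensor -> Prop) : T 0 ->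
  (forall a b x, T x -> T (tpure a b + x)) -> forall x, T x.
Proof.
move=> T0 TD; elim/tsumW; elim=> // -[a b] s IH.
by have := TD a b _ IH; rewrite -[_ + _]/(tadd _ _) taddE.
Qed.

Definition tinl (a : A) : tensor := tpure a 1.
Definition tinr (b : B) : tensor := tpure 1 b.

Lemma tinl_zmod : zmod_morphism tinl.
Proof.
move=> a b; apply/eqP; rewrite eq_sym subr_eq; apply/eqP.
by rewrite /tinl -tpureDl subrK.
Qed.
Lemma tinl_monoid : monoid_morphism tinl.
Proof. by split=> // a b; rewrite /tinl -tpureM mulr1. Qed.
HB.instance Definition _ := GRing.isZmodMorphism.Build A tensor tinl tinl_zmod.
HB.instance Definition _ := GRing.isMonoidMorphism.Build A tensor tinl tinl_monoid.

Lemma tinr_zmod : zmod_morphism tinr.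
Proof.
move=> a b; apply/eqP; rewrite eq_sym subr_eq; apply/eqP.
by rewrite /tinr -tpureDr subrK.
Qed.
Lemma tinr_monoid : monoid_morphism tinr.
Proof. by split=> // a b; rewrite /tinr -tpureM mulr1. Qed.
HB.instance Definition _ := GRing.isZmodMorphism.Build B tensor tinr tinr_zmod.
HB.instance Definition _ := GRing.isMonoidMorphism.Build B tensor tinr tinr_monoid.

Lemma tpureE a b : tpure a b = tinl a * tinr b.
Proof. by rewrite -tpureM mulr1 mul1r. Qed.

Lemma tensorC r : tinl (phi r) = tinr (psi r).
Proof. by rewrite /tinl -[phi r]mulr1 tpureZ mulr1. Qed.

Section Lift.
Variables (C : comPzRingType) (f : {rmorphism A -> C}) (g : {rmorphism B -> C}).
Hypothesis fg : forall r, f (phi r) = g (psi r).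

Definition tlift_seq (s : seq (A * B)) : C := \sum_(x <- s) f x.1 * g x.2.

Definition tlift of (forall r, f (phi r) = g (psi r)) :=
  fun x : tensor => tlift_seq (repr x).

Lemma tlift_rel s t : tens_rel s t -> tlift_seq s = tlift_seq t.
Proof.
rewrite /tlift_seq; elim=> {s t} //=.
- by move=> t s u _ -> _ ->.
- by move=> s t u _ h; rewrite !big_cat h.
- by move=> s t; rewrite !big_cat /= addrC.
- by move=> a a' b; rewrite !big_cons !big_nil rmorphD mulrDl !addr0.
- by move=> a b b'; rewrite !big_cons !big_nil rmorphD mulrDr !addr0.
- by move=> r a b; rewrite !big_cons !rmorphM fg mulrA [_ * f a]mulrC.
- by move=> b; rewrite big_cons big_nil rmorph0 mul0r addr0.
Qed.

Lemma tlift_tsum s : tlift fg (tsum s) = tlift_seq s.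
Proof. exact/tlift_rel/tsum_repr. Qed.

Lemma tlift_pure a b : tlift fg (tpure a b) = f a * g b.
Proof. by rewrite tlift_tsum /tlift_seq big_seq1. Qed.

Lemma tliftD x y : tlift fg (x + y) = tlift fg x + tlift fg y.
Proof.
elim/tsumW: x => s; elim/tsumW: y => t.
by rewrite -[X in tlift fg X]/(tadd _ _) taddE !tlift_tsum /tlift_seq big_cat.
Qed.

Lemma tlift_zmod : zmod_morphism (tlift fg).
Proof.
move=> x y; apply/eqP; rewrite eq_sym subr_eq; apply/eqP.
by rewrite -tliftD subrK.
Qed.
HB.instance Definition _ :=
  GRing.isZmodMorphism.Build tensor C (tlift fg) tlift_zmod.

Lemma tlift_monoid : monoid_morphism (tlift fg).
Proof.
split=> [|x y]; first by rewrite -tpure11 tlift_pure !rmorph1 mulr1.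
elim/tensor_ind: x => [|a b x IHx]; first by rewrite mul0r raddf0 mul0r.
rewrite mulrDl !raddfD /= IHx [RHS]mulrDl; congr (_ + _) => {x IHx}.
elim/tensor_ind: y => [|a' b' y IHy]; first by rewrite mulr0 raddf0 mulr0.
rewrite mulrDr !raddfD /= IHy [RHS]mulrDr -tpureM !tlift_pure !rmorphM.
by rewrite mulrACA.
Qed.
HB.instance Definition _ :=
  GRing.isMonoidMorphism.Build tensor C (tlift fg) tlift_monoid.

Lemma tlift_inl a : tlift fg (tinl a) = f a.
Proof. by rewrite tlift_pure rmorph1 mulr1. Qed.
Lemma tlift_inr b : tlift fg (tinr b) = g b.
Proof. by rewrite tlift_pure rmorph1 mul1r. Qed.

Lemma tlift_uniq (h : {rmorphism tensor -> C}) :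
  (forall a, h (tinl a) = f a) -> (forall b, h (tinr b) = g b) ->
  forall x, h x = tlift fg x.
Proof.
move=> hf hg; elim/tensor_ind=> [|a b x IH]; first by rewrite !rmorph0.
by rewrite !rmorphD /= IH tlift_pure tpureE rmorphM hf hg.
Qed.
End Lift.

End Tensor.

Section ResidueAtPrime.
Variables (A : comPzRingType) (P : primeIdeal A).

Definition rinj : {rmorphism A -> residue (locAt P)} :=
  qproj (@maxideal (locAt P)) \o linj.

Lemma rinj_eq0 a : rinj a = 0 <-> P a.
Proof. by rewrite qproj_eq0; apply: mem_locAt_max. Qed.

Lemma residue_neq0 : (1 : residue (locAt P)) <> 0.
Proof. by rewrite -(rmorph1 rinj) => /rinj_eq0; apply: prime1. Qed.

Lemma residue_frac (x : residue (locAt P)) : exists a s, ~ P s /\ x * rinj s = rinj a.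
Proof.
elim/qprojW: x; elim/lfracW=> a s; exists a, (dval s); split; first exact: (denP s).
by rewrite /= -rmorphM lfracK.
Qed.

Lemma rinj_unit s : ~ P s -> exists c, c * rinj s = 1.
Proof. by move=> nPs; apply: residue_field => /rinj_eq0. Qed.

Lemma residue_eq0M (x y : residue (locAt P)) : x * y = 0 -> x = 0 \/ y = 0.
Proof.
move=> xy; have [->|/residue_field [c cx]] := pselect (x = 0); first by left.
by right; rewrite -[y]mul1r -cx -mulrA xy mulr0.
Qed.

Lemma residue_hom_ext (C : comPzRingType)
  (g h : {rmorphism residue (locAt P) -> C}) :
  (forall a, g (rinj a) = h (rinj a)) -> forall x, g x = h x.
Proof.
move=> gh x; have [a [s [/rinj_unit [c cs] xs]]] := residue_frac x.
rewrite -[x]mulr1 -cs mulrCA xs !rmorphM gh; congr (_ * _).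
rewrite -[LHS]mulr1 -(rmorph1 h) -cs !rmorphM mulrCA -gh -rmorphM cs.
by rewrite rmorph1 mulr1.
Qed.

End ResidueAtPrime.

Section InducedMaps.
Variables (A B : comPzRingType) (f : {rmorphism A -> B}).
Variables (P : primeIdeal A) (Q : primeIdeal B).
Hypothesis PQ : forall a, P a <-> Q (f a).

Lemma loc_map_subproof s : (~` (P : A -> Prop)) s ->
  exists c : locAt Q, c * linj (f s) = 1.
Proof.
move=> nPs; have nQ : ~ Q (f s) by move/PQ.
exists (lfrac 1 (mkden (S := MultSet (compl_subproof Q)) nQ)).
exact: linj_unit.
Qed.

Definition loc_map : {rmorphism locAt P -> locAt Q} :=
  llift (S := MultSet (compl_subproof P)) (f := linj \o f) loc_map_subproof.

Lemma loc_map_linj a : loc_map (linj a) = linj (f a).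
Proof. exact: llift_linj. Qed.

Lemma residue_map_subproof x :
  maxideal x -> (qproj (@maxideal (locAt Q)) \o loc_map) x = 0.
Proof.
elim/lfracW: x => a s /mem_locAt_max Pa; apply/qproj_eq0.
rewrite -[lfrac a s]mulr1 -(linj_unit s) mulrCA lfracK rmorphM.
by apply: idealMl; rewrite loc_map_linj; apply/mem_locAt_max/PQ.
Qed.

Definition residue_map : {rmorphism residue (locAt P) -> residue (locAt Q)} :=
  qlift residue_map_subproof.

Lemma residue_map_rinj a : residue_map (rinj P a) = rinj Q (f a).
Proof.
rewrite /rinj [LHS](qliftE residue_map_subproof (linj a)) /=.
by rewrite loc_map_linj.
Qed.

End InducedMaps.

Section Fibre.
Variables (R A B : comPzRingType).
Variables (phi : {rmorphism R -> A}) (psi : {rmorphism R -> B}).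
Variable P : primeIdeal (tensor phi psi).

Definition primeA : primeIdeal A := contract (tinl phi psi) P.
Definition primeB : primeIdeal B := contract (tinr phi psi) P.
Definition primeR : primeIdeal R := contract (tinl phi psi \o phi) P.

Lemma primeRA r : primeR r <-> primeA (phi r). Proof. by []. Qed.
Lemma primeRB r : primeR r <-> primeB (psi r).
Proof. by rewrite /= tensorC. Qed.

Definition fibre : comPzRingType :=
  tensor (residue_map primeRA) (residue_map primeRB).

Definition fibre_inl : {rmorphism A -> fibre} :=
  tinl (residue_map primeRA) (residue_map primeRB) \o rinj primeA.
Definition fibre_inr : {rmorphism B -> fibre} :=
  tinr (residue_map primeRA) (residue_map primeRB) \o rinj primeB.

Lemma fibre_in_subproof r : fibre_inl (phi r) = fibre_inr (psi r).
Proof.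
have := tensorC (residue_map primeRA) (residue_map primeRB) (rinj primeR r).
by rewrite !residue_map_rinj.
Qed.

(* The canonical map from A (x) B to k(p) (x) k(q). *)
Definition fibre_map : {rmorphism tensor phi psi -> fibre} :=
  tlift fibre_in_subproof.

Lemma fibre_map_inl a : fibre_map (tinl phi psi a) = fibre_inl a.
Proof. exact: tlift_inl. Qed.
Lemma fibre_map_inr b : fibre_map (tinr phi psi b) = fibre_inr b.
Proof. exact: tlift_inr. Qed.

Lemma primeA_tinl a : primeA a <-> P (tinl phi psi a). Proof. by []. Qed.
Lemma primeB_tinr b : primeB b <-> P (tinr phi psi b). Proof. by []. Qed.

Lemma fibre_to_residue_subproof x :
  residue_map primeA_tinl (residue_map primeRA x) =
  residue_map primeB_tinr (residue_map primeRB x).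
Proof.
apply: (@residue_hom_ext _ _ _
  (residue_map primeA_tinl \o residue_map primeRA)
  (residue_map primeB_tinr \o residue_map primeRB)) => r.
change (residue_map primeA_tinl (residue_map primeRA (rinj primeR r)) =
  residue_map primeB_tinr (residue_map primeRB (rinj primeR r))).
rewrite !residue_map_rinj; congr (rinj P _); exact: tensorC.
Qed.

Definition fibre_to_residue : {rmorphism fibre -> residue (locAt P)} :=
  tlift fibre_to_residue_subproof.

Lemma fibre_to_residueE x : fibre_to_residue (fibre_map x) = rinj P x.
Proof.
elim/tensor_ind: x => [|a b x IH]; first by rewrite !rmorph0.
rewrite !rmorphD IH; congr (_ + _).
rewrite tpureE !rmorphM fibre_map_inl fibre_map_inr.
by congr (_ * _); [apply: etrans (tlift_inl _ _) _ | apply: etrans (tlift_inr _ _) _];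
  exact: residue_map_rinj.
Qed.

Lemma fibre_frac (e : fibre) : exists x y c,
  c * fibre_map y = 1 /\ e * fibre_map y = fibre_map x.
Proof.
elim/tensor_ind: e => [|u v e [x [y [c [cy ey]]]]].
  by exists 0, 1, 1; rewrite !rmorph1 rmorph0 mulr1 mul0r.
have [a [s [/rinj_unit [c1 cs] us]]] := residue_frac u.
have [b [t [/rinj_unit [c2 ct] vt]]] := residue_frac v.
have st : fibre_map (tpure phi psi s t) =
    tpure (residue_map primeRA) (residue_map primeRB) (rinj _ s) (rinj _ t).
  by rewrite tpureE rmorphM fibre_map_inl fibre_map_inr [RHS]tpureE.
have ab : fibre_map (tpure phi psi a b) =
    tpure (residue_map primeRA) (residue_map primeRB) (rinj _ a) (rinj _ b).
  by rewrite tpureE rmorphM fibre_map_inl fibre_map_inr [RHS]tpureE.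
exists (tpure phi psi a b * y + x * tpure phi psi s t), (tpure phi psi s t * y).
exists (tpure (residue_map primeRA) (residue_map primeRB) c1 c2 * c).
rewrite !rmorphD !rmorphM -ey st ab -us -vt; split.
  by rewrite mulrACA -tpureM cs ct cy mulr1.
rewrite tpureM; ring.
Qed.

Definition fibre_ideal : ideal fibre := gen (fibre_map @` (P : set _)).

Lemma fibre_idealP e : fibre_ideal e <-> fibre_to_residue e = 0.
Proof.
split=> [|e0].
  pose K : ideal fibre := Ideal (ideal_set := [set e | fibre_to_residue e = 0])
    (And3 (rmorph0 _)
      (fun x y (hx : fibre_to_residue x = 0) (hy : fibre_to_residue y = 0) =>
         etrans (rmorphD _ x y) (etrans (f_equal2 +%R hx hy) (addr0 0)))
      (fun a x (hx : fibre_to_residue x = 0) =>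
         etrans (rmorphM _ a x) (etrans (f_equal _ hx) (mulr0 _)))).
  apply: (@gen_min _ _ K) => _ [x Px <-] /=.
  by rewrite fibre_to_residueE; apply/rinj_eq0.
have [x [y [c [cy ey]]]] := fibre_frac e.
have Px : P x.
  by apply/rinj_eq0; rewrite -fibre_to_residueE -ey rmorphM e0 mul0r.
rewrite -[e]mulr1 -cy mulrCA ey; apply: idealMl; apply: sub_gen.
by exists x.
Qed.

Lemma fibre_ideal_prime : prime_axiom fibre_ideal.
Proof.
split=> [/fibre_idealP|x y /fibre_idealP].
  by rewrite rmorph1; apply: residue_neq0.
by rewrite rmorphM => /residue_eq0M [] h; [left|right]; apply/fibre_idealP.
Qed.

Definition fibre_prime : primeIdeal fibre := PrimeIdeal fibre_ideal_prime.

End Fibre.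

(* Main.v *)
From HB Require Import structures.
From mathcomp Require Import all_boot all_order all_algebra ring zify.
From mathcomp Require Import boolp classical_sets constructive_ereal.
Require Import Defs.

(* Write K, L, k for the residue fields at p, q, n and S for the localization
   of A (x) B at P.  Formal smoothness passes from R_n -> A_p to B_q -> S.

   If f : R -> A is a local formally smooth map, the cotangent space of R
   embeds, after extension of scalars, in that of A, so that
   embdim A = embdim R + embdim (A / mR A): each coordinate function on
   mR / mR^2 is detected by a map from R to the dual numbers over K or, when
   the residue characteristic does not vanish on it, to the Witt vectors
   W_2(K), and such a map extends to A.  Moreover A0 = A / mR A is regular:
   fields are formally smooth over their prime field, hence so is A0, hence
   Hasse-Schmidt derivations show that an element x of mA outside mA^2 is a
   nonzerodivisor and that A0 / (x) is again formally smooth over the prime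
   field; by induction A0 has a chain of primes of length embdim A0.

   It remains to see that embdim (S / mB S) = embdim (A_p / n A_p) + dim F, F
   being the fibre.  Krull's principal ideal theorem gives one inequality, going
   down along A_p / n A_p -> S / mB S, which is flat as a base change of k -> L,
   gives the other. *)

Set Implicit Arguments.
Unset Strict Implicit.
Unset Printing Implicit Defensive.

Import GRing.Theory.
Local Open Scope ring_scope.
Local Open Scope classical_set_scope.

(** * Ideals of noetherian rings *)

(** Residue fields may be imperfect and R may have mixed characteristic, so the residue field need
    not lift to the quotient of R that sees one coordinate of mR / mR^2. The obstruction is a
    residue characteristic p that is nonzero there; p then spans the coordinate, and a map of this
    length-two ring to W_2(K) replaces a derivation. For this reason [lift_charp] treats rings in
    which p generates the kernel to the residue field, not only fields. K acts on the kernel of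
    W_2(K) -> K through Frobenius, which is injective and so still detects the vanishing of
    coefficients.

    Regularity is used only through the existence of a chain of primes of length the embedding
    dimension; the opposite bound is the principal ideal theorem. Localization at p is mostly
    replaced by ideals saturated at p, and chains of primes are measured between two sets, so that
    they pass easily from ring to ring. Flatness enters only as torsion-freeness of A/c (x) B/q over
    A/c, up to denominators from R, which linear algebra over the residue field at n supplies. *)

Lemma Zorn_above (T : Type) (Q : set (set T)) (X0 : set T) : Q X0 ->
  (forall F : set (set T), F !=set0 -> F `<=` Q -> total_on F subset ->
     Q (\bigcup_(X in F) X)) ->
  exists M, [/\ Q M, X0 `<=` M & forall N, Q N -> M `<=` N -> N `<=` M].
Proof.
move=> Q0 QU.
(* [Zorn_bigcup] also asks about the empty chain, whose union is [set0]; testing Q on X [|] X0 turns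
   that case into Q X0. *)
have [|M [QM maxM]] := @Zorn_bigcup T [set X | Q (X `|` X0)].
  move=> F FQ totF.
  rewrite /=; have [->|/set0P/[dup] F0 [Y0 FY0]] := eqVneq F set0.
    by rewrite bigcup_set0 set0U.
  have -> : \bigcup_(X in F) X `|` X0 =
      \bigcup_(X in [set Y `|` X0 | Y in F]) X.
    apply/seteqP; split=> [x [[Y FY Yx]|X0x]|x [_ [Y FY <-]] [Yx|X0x]].
    - by exists (Y `|` X0); [exists Y|left].
    - by exists (Y0 `|` X0); [exists Y0|right].
    - by left; exists Y.
    - by right.
  apply: QU; first by exists (Y0 `|` X0), Y0.
    by move=> _ [Y FY <-]; apply: FQ.
  move=> _ _ [Y FY <-] [Z FZ <-].
  by have [h|h] := totF _ _ FY FZ; [left|right]; apply: setSU.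
exists (M `|` X0); split=> // N QN MN.
apply: contrapT => NM; apply: (maxM N); last first.
  by rewrite /= (_ : N `|` X0 = N) //; apply/setUidPl => x X0x; apply: MN; right.
split=> [x Mx|NM']; first by apply: MN; left.
by apply: NM => x /NM' Mx; left.
Qed.

Lemma rmorph_ex (A B : comPzRingType) (f : A -> B) : f 1 = 1 ->
  {morph f : x y / x + y} -> {morph f : x y / x * y} ->
  exists g : {rmorphism A -> B}, forall x, g x = f x.
Proof.
move=> f1 fD fM.
have fB : zmod_morphism f.
  by move=> x y; apply/eqP; rewrite eq_sym subr_eq -fD subrK.
pose m1 := GRing.isZmodMorphism.Build A B f fB.
pose m2 := GRing.isMonoidMorphism.Build A B f (conj f1 fM).
pose g : {rmorphism A -> B} := HB.pack f m1 m2.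
by exists g.
Qed.

Section NoetherianTools.
Variable A : comPzRingType.
Implicit Types (I J K : ideal A) (S : multSet A) (p : primeIdeal A).

Lemma iadd_subproof I a : ideal_axiom [set x | exists i c, I i /\ x = i + c * a].
Proof.
split=> [|_ _ [i [c [Ii ->]]] [j [d [Ij ->]]]|b _ [i [c [Ii ->]]]].
- by exists 0, 0; split; [apply: ideal0|rewrite mul0r addr0].
- by exists (i + j), (c + d); split; [apply: idealD|ring].
- by exists (b * i), (b * c); split; [apply: idealMl|ring].
Qed.

Definition iadd I a : ideal A := Ideal (iadd_subproof I a).

Lemma iadd_sub I a : I `<=` iadd I a.
Proof. by move=> x Ix; exists x, 0; rewrite mul0r addr0. Qed.

Lemma iadd_mem I a : iadd I a a.
Proof. by exists 0, 1; split; [apply: ideal0|rewrite add0r mul1r]. Qed.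

Lemma isum_subproof I J : ideal_axiom [set x | exists i j, [/\ I i, J j & x = i + j]].
Proof.
split=> [|_ _ [i [j [Ii Jj ->]]] [i' [j' [Ii' Jj' ->]]]|b _ [i [j [Ii Jj ->]]]].
- by exists 0, 0; split; rewrite ?addr0 //; apply: ideal0.
- by exists (i + i'), (j + j'); split; [apply: idealD|apply: idealD|ring].
- by exists (b * i), (b * j); split; [apply: idealMl|apply: idealMl|ring].
Qed.

Definition isum I J : ideal A := Ideal (isum_subproof I J).

Lemma isum_subl I J : I `<=` isum I J.
Proof. by move=> x Ix; exists x, 0; split; rewrite ?addr0 //; apply: ideal0. Qed.

Lemma isum_subr I J : J `<=` isum I J.
Proof. by move=> x Ix; exists 0, x; split; rewrite ?add0r //; apply: ideal0. Qed.

Lemma isum_min I J K : I `<=` K -> J `<=` K -> isum I J `<=` K.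
Proof. by move=> IK JK _ [i [j [/IK Ki /JK Kj ->]]]; apply: idealD. Qed.

Lemma icol_subproof I a : ideal_axiom [set x | I (x * a)].
Proof.
split=> [|x y hx hy|b x hx] /=; first by rewrite mul0r; apply: ideal0.
  by rewrite mulrDl; apply: idealD.
by rewrite -mulrA; apply: idealMl.
Qed.

(** The colon ideal (I : a), that is, the annihilator of a modulo I. *)
Definition icol I a : ideal A := Ideal (icol_subproof I a).

Lemma ideal_sum I (n : nat) (P : pred 'I_n) (f : 'I_n -> A) :
  (forall i, P i -> I (f i)) -> I (\sum_(i | P i) f i).
Proof.
move=> h; apply: (big_ind (fun x => I x)) => //; first exact: ideal0.
by move=> x y; apply: idealD.
Qed.

Lemma idealM_min I J K : (forall x y, I x -> J y -> K (x * y)) -> idealM I J `<=` K.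
Proof. by move=> h; apply: gen_min => _ [x [y [Ix Jy ->]]]; apply: h. Qed.

Lemma idealMSr I J : idealM I J `<=` J.
Proof. by apply: idealM_min => x y _; apply: idealMl. Qed.

Lemma idealM_mono I J I' J' : I `<=` I' -> J `<=` J' -> idealM I J `<=` idealM I' J'.
Proof.
by move=> II JJ; apply: idealM_min => x y /II Ix /JJ Jy; apply: mem_idealM.
Qed.

Lemma idealXT I x : idealX I 0 x.
Proof. exact: sub_gen. Qed.

Lemma idealX_le I m n : (m <= n)%N -> idealX I n `<=` idealX I m.
Proof.
elim: n m => [|n IH] m; first by rewrite leqn0 => /eqP->.
case: m => [_ x _|m mn]; first exact: idealXT.
by apply: idealM_mono => //; apply: IH.
Qed.

Lemma idealX_exp I x n : I x -> idealX I n (x ^+ n).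
Proof.
move=> Ix; elim: n => [|n IH]; first exact: idealXT.
by rewrite exprS; apply: mem_idealM.
Qed.

Lemma idealX_1 I x : idealX I 1 x <-> I x.
Proof.
split; last by move=> Ix; rewrite -[x]mulr1; apply: mem_idealM => //; apply: idealXT.
by move: x; apply: idealM_min => x y Ix _; apply: idealMr.
Qed.

Lemma gen_seqP (s : seq A) x : gen [set` s] x ->
  exists c : nat -> A, x = \sum_(i < size s) c i * s`_i.
Proof.
pose K : set A := [set x | exists c : nat -> A, x = \sum_(i < size s) c i * s`_i].
have Kid : ideal_axiom K.
  split=> [|_ _ [c ->] [d ->]|a _ [c ->]].
  - by exists (fun=> 0); rewrite big1 // => i _; rewrite mul0r.
  - exists (fun i => c i + d i); rewrite -big_split /=; apply: eq_bigr => i _.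
    by rewrite mulrDl.
  - exists (fun i => a * c i); rewrite mulr_sumr; apply: eq_bigr => i _.
    by rewrite mulrA.
apply: (@gen_min _ _ (Ideal Kid)) => y /= /(nthP 0) [i si <-].
exists (fun j => (j == i)%:R); rewrite (bigD1 (Ordinal si)) //= eqxx mul1r.
by rewrite big1 ?addr0 // => j ji; rewrite (_ : (_ == i) = false) ?mul0r //; apply/negbTE.
Qed.

Hypothesis noethA : noetherian A.

(** The union of a chain of ideals is finitely generated, hence equal to one of its members; so
    Zorn's lemma applies to an arbitrary P. *)
Lemma noeth_max (P : ideal A -> Prop) I0 : P I0 ->
  exists I, [/\ P I, I0 `<=` I & forall J, P J -> I `<=` J -> J `<=` I].
Proof.
move=> PI0.
have [||M [[I [PI IM]] I0M maxM]] := @Zorn_above A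
    [set X | exists I, P I /\ (I : set A) = X] I0.
- by exists I0.
- move=> F F0 FQ totF.
  have [Y0 FY0] := F0.
  have Uid : ideal_axiom (\bigcup_(X in F) X).
    split.
    - by exists Y0 => //; have [I [_ <-]] := FQ _ FY0; apply: ideal0.
    - move=> x y [X FX Xx] [Y FY Yy].
      have [XY|YX] := totF _ _ FX FY.
        exists Y => //; have [I [_ e]] := FQ _ FY; move: Yy (XY _ Xx).
        by rewrite -e => ? ?; apply: idealD.
      exists X => //; have [I [_ e]] := FQ _ FX; move: Xx (YX _ Yy).
      by rewrite -e => ? ?; apply: idealD.
    - move=> a x [X FX Xx]; exists X => //.
      by have [I [_ e]] := FQ _ FX; move: Xx; rewrite -e; apply: idealMl.
  have [s [Us sU]] := noethA (Ideal Uid).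
  have [X FX sX] : exists2 X, F X & [set` s] `<=` X.
    have : [set` s] `<=` \bigcup_(X in F) X by move=> x sx; apply: sU; apply: sub_gen.
    elim: s {Us sU} => [_|x s IH xsU]; first by exists Y0.
    have [X FX Xx] : (\bigcup_(X in F) X) x by apply: xsU; rewrite /= mem_head.
    have [|Y FY sY] := IH; first by move=> y sy; apply: xsU; rewrite /= inE sy orbT.
    have [XY|YX] := totF _ _ FX FY.
      by exists Y => // z; rewrite /= inE => /orP[/eqP->|/sY//]; apply: XY.
    by exists X => // z; rewrite /= inE => /orP[/eqP->//|/sY/YX].
  have [I [PI IX]] := FQ _ FX; exists I; split=> //; rewrite IX.
  apply/seteqP; split; first by move=> x Xx; exists X.
  move=> x /Us; move: x; rewrite -IX; apply: gen_min; by rewrite IX.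
- exists I; rewrite IM; split=> // J PJ; exact: (maxM J (ex_intro _ J (conj PJ erefl))).
Qed.

Lemma prime_avoid I S : (forall x, I x -> ~ S x) ->
  exists Q : primeIdeal A, I `<=` Q /\ forall x, Q x -> ~ S x.
Proof.
move=> IS; have [Q [QS IQ maxQ]] := @noeth_max (fun J => forall x, J x -> ~ S x) I IS.
have [S1 SM] := multP S.
have Qp : prime_axiom Q.
  split=> [Q1|x y Qxy]; first exact: QS Q1 S1.
  apply: contrapT => /not_orP[nx ny].
  have hit z : ~ Q z -> exists2 w, iadd Q z w & S w.
    move=> nz; apply: contrapT => h; apply: nz.
    apply: (maxQ (iadd Q z)); [|exact: iadd_sub|exact: iadd_mem].
    by move=> w Jw Sw; apply: h; exists w.
  have [_ [i [c [Qi ->]]] Si] := hit _ nx; have [_ [j [d [Qj ->]]] Sj] := hit _ ny.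
  apply: (QS _ _ (SM _ _ Si Sj)).
  rewrite (_ : _ * _ = i * (j + d * y) + c * x * j + c * d * (x * y)); last by ring.
  by apply: idealD; [apply: idealD; [apply: idealMr|apply: idealMl]|apply: idealMl].
by exists (PrimeIdeal Qp).
Qed.

(** A maximal element among the colon ideals (I : a) with a outside I is prime: an associated prime
    of A/I. *)
Lemma noeth_ass I : ~ I 1 -> exists a, ~ I a /\ prime_axiom (icol I a).
Proof.
move=> nI1.
have [J [[a [nIa ->]] _ maxJ]] :=
  @noeth_max (fun J => exists a, ~ I a /\ J = icol I a) (icol I 1)
    (ex_intro _ 1 (conj nI1 erefl)).
exists a; split=> //; split=> [|x y] /=; first by rewrite mul1r.
move=> xya; apply: contrapT => /not_orP[nx ny].
apply: nx; apply: (maxJ (icol I (y * a))).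
- by exists (y * a).
- by move=> z /= za; rewrite mulrCA; apply: idealMl.
- by rewrite /= mulrA.
Qed.

(** J is determined by its extension to the localization at p; such ideals stand in for the ideals
    of that localization. *)
Definition saturated p (J : set A) := forall s a, ~ p s -> J (s * a) -> J a.

Lemma isat_subproof (p : primeIdeal A) J :
  ideal_axiom [set a | exists s, ~ p s /\ J (s * a)].
Proof.
split.
- by exists 1; split; [apply: prime1|rewrite mulr0; apply: ideal0].
- move=> x y [s [ns Jx]] [t [nt Jy]]; exists (s * t); split; first by move/primeM => [].
  rewrite mulrDr mulrAC; apply: idealD; first exact: idealMr.
  by rewrite -mulrA; apply: idealMl.
- move=> a x [s [ns Jx]]; exists s; split=> //; rewrite mulrCA; exact: idealMl.
Qed.

Definition isat p J : ideal A := Ideal (isat_subproof p J).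

Lemma isat_sub p J : J `<=` isat p J.
Proof. by move=> x Jx; exists 1; split; [apply: prime1|rewrite mul1r]. Qed.

Lemma isat_sat p J : saturated p (isat p J).
Proof.
move=> s a ns [t [nt Jts]]; exists (t * s); split; first by move/primeM => [].
by rewrite -mulrA.
Qed.

Lemma isat_min p J K : saturated p K -> J `<=` K -> isat p J `<=` K.
Proof. by move=> sK JK a [s [ns /JK]]; apply: sK. Qed.

Lemma prime_saturated (p c : primeIdeal A) : c `<=` p -> saturated p c.
Proof. by move=> cp s a ns /primeM[/cp|]. Qed.

(* Nakayama's lemma, for the localization at p. *)
Lemma nakayama (p : primeIdeal A) I J : saturated p I -> saturated p J ->
  I `<=` J -> J `<=` isat p (isum I (idealM p J)) -> J `<=` I.
Proof.
move=> sI sJ IJ JI; apply: contrapT => nJI.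
(* By maximality of J', the quotient J / J' is simple after localization, hence killed by p; the
   last hypothesis then puts J inside J'. *)
have [J' [[sJ' J'J nJJ'] IJ' maxJ']] := @noeth_max
  (fun K => [/\ saturated p K, K `<=` J & ~ J `<=` K]) I (And3 sI IJ nJI).
have [a [Ja nJ'a]] : exists a, J a /\ ~ J' a.
  by apply: contrapT => h; apply: nJJ' => a Ja; apply: contrapT => n; apply: h; exists a.
have spanJ z : J z -> ~ J' z -> J `<=` isat p (iadd J' z).
  move=> Jz nz; apply: contrapT => n; apply: nz.
  apply: (maxJ' (isat p (iadd J' z))).
  - split=> //; first exact: isat_sat.
    apply: isat_min => // _ [i [c [/J'J Ji ->]]]; apply: idealD => //; exact: idealMl.
  - by move=> x J'x; apply: isat_sub; apply: iadd_sub.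
  - by apply: isat_sub; apply: iadd_mem.
have pa z : p z -> J' (z * a).
  move=> pz; apply: contrapT => n.
  have [s [ns [i [c [J'i e]]]]] := spanJ _ (idealMl z Ja) n a Ja.
  apply: nJ'a; apply: (sJ' (s - c * z)); last first.
    by rewrite mulrBl e -mulrA addrK.
  by move=> h; apply: ns; rewrite -(subrK (c * z) s); apply: idealD => //; apply: idealMl.
apply: nJJ' => x /JI; move: x; apply: isat_min => //; apply: isum_min => //.
apply: idealM_min => z b pz /(spanJ _ Ja nJ'a) [s [ns [i [c [J'i e]]]]].
apply: (sJ' s) => //; rewrite mulrCA e mulrDr; apply: idealD; first exact: idealMl.
by rewrite mulrCA; apply: idealMl; apply: pa.
Qed.

End NoetherianTools.

(** * Krull's intersection and principal ideal theorems *)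

Section LocalRings.
Variable A : comPzRingType.
Implicit Types (I J K m : ideal A).

Definition islocal m := forall x, m x <-> ~ exists y, y * x = 1.

Lemma islocal_unit m x : islocal m -> ~ m x -> exists y, y * x = 1.
Proof. by move=> lm nx; apply: contrapT => h; apply/nx/lm. Qed.

Lemma islocal1 m : islocal m -> ~ m 1.
Proof. by move=> lm /lm; apply; exists 1; rewrite mulr1. Qed.

Lemma islocal_prime m : islocal m -> prime_axiom m.
Proof.
move=> lm; split; first exact: islocal1.
move=> x y mxy; apply: contrapT => /not_orP[nx ny].
have [u ux] := islocal_unit lm nx; have [v vy] := islocal_unit lm ny.
apply: (islocal1 lm); have := idealMl (u * v) mxy.
by rewrite mulrACA ux vy mulr1.
Qed.

Lemma islocal_saturated m J : islocal m -> forall s a, ~ m s -> J (s * a) -> J a.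
Proof.
move=> lm s a /(islocal_unit lm)[u us] /(idealMl u).
by rewrite mulrA us mul1r.
Qed.

Definition izero : ideal A := gen set0.

Lemma izeroP x : izero x -> x = 0.
Proof.
pose K : ideal A := Ideal (ideal_set := [set x | x = 0])
  (And3 erefl (fun x y hx hy => etrans (congr2 +%R hx hy) (addr0 0))
    (fun a x hx => etrans (congr1 _ hx) (mulr0 a))).
by apply: (@gen_min _ _ K).
Qed.

Hypothesis noethA : noetherian A.

(** Instead of Artin-Rees: let J be the intersection of the powers of m. An ideal I maximal with I
    [&] J inside mJ contains a power of m, hence J, so that J = mJ and Nakayama's lemma applies. *)
Lemma krull_intersection m s : islocal m -> (forall n, idealX m n s) -> s = 0.
Proof.
move=> lm hs.
have Jid : ideal_axiom [set s | forall n, idealX m n s].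
  split=> [n|x y hx hy n|a x hx n]; first exact: ideal0.
    exact: idealD.
  exact: idealMl.
pose J := Ideal Jid.
have [I [IJ mJI maxI]] := noeth_max noethA
  (P := fun I => forall x, I x -> J x -> idealM m J x) (I0 := idealM m J)
  (fun x h _ => h).
(* Once the ideals (I : x^n) are stationary, adding x^n to I keeps the intersection with J inside
   mJ, so x^n already lies in I. *)
have powI x : m x -> exists n, I (x ^+ n).
  move=> mx; have [K [[n ->] _ maxK]] := noeth_max noethA
    (P := fun K => exists n, K = icol I (x ^+ n)) (I0 := icol I (x ^+ 0))
    (ex_intro _ 0%N erefl).
  exists n; apply: (maxI (iadd I (x ^+ n))); [|exact: iadd_sub|exact: iadd_mem].
  move=> _ [i [c [Ii ->]]] Jy.
  have h : I (c * x ^+ n.+1).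
    have : I (x * (i + c * x ^+ n) - x * i).
      apply: idealB; last exact: idealMl.
      by apply/mJI/mem_idealM.
    by rewrite mulrDr addrAC subrr add0r exprS mulrCA.
  apply: IJ => //; apply: idealD => //.
  by apply: (maxK (icol I (x ^+ n.+1))) => //; [exists n.+1|
    move=> z /=; rewrite exprS mulrCA; apply: idealMl].
(* Let K be a maximal ideal over I that contains no power of m. An associated prime (K : a) contains
   a power of each element of m, hence m; since K + (a) contains some m^N, K contains m^(N+1). *)
have [N mN] : exists N, idealX m N `<=` I.
  apply: contrapT => bad.
  have [K [[IK nK] _ maxK]] := noeth_max noethA
    (P := fun K => I `<=` K /\ ~ exists N, idealX m N `<=` K)
    (conj (fun x => id) bad).
  have nK1 : ~ K 1 by move=> K1; apply: nK; exists 0%N => x _; rewrite -[x]mulr1; apply: idealMl.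
  have [a [nKa Ka]] := noeth_ass noethA nK1.
  have ma x : m x -> K (x * a).
    move=> /powI[n /IK Kn]; have : icol K a (x ^+ n) by apply: idealMr.
    elim: n {Kn} => [|n IH]; first by case: Ka => + _ h => /(_ h).
    by rewrite exprS => /(proj2 Ka) [].
  apply: (contra_notP _ nKa) => _.
  apply: (maxK (iadd K a)); [|exact: iadd_sub|exact: iadd_mem].
  split; first by move=> x /IK; apply: iadd_sub.
  move=> [N mN]; apply: nK; exists N.+1; apply: idealM_min => x y mx /mN.
  move=> [i [c [Ki ->]]]; rewrite mulrDr; apply: idealD; first exact: idealMl.
  by rewrite mulrCA; apply: idealMl; apply: ma.
pose pm := PrimeIdeal (islocal_prime lm).
apply: izeroP; apply: (@nakayama A noethA pm izero J) => //.
- by move=> ? ?; apply: islocal_saturated.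
- by move=> ? ?; apply: islocal_saturated.
- by move=> x /izeroP->; apply: ideal0.
- by move=> x Jx; apply/isat_sub/isum_subr/IJ => //; apply: mN; apply: Jx.
Qed.

(** If p is minimal over J, the localization of A/J at p is artinian. Let I be a maximal
    counterexample: an associated prime (I : a) equals p by minimality, so (I + (a)) / I is simple
    at p, and a chain is stationary once its sum with (a) is stationary and a has stopped leaving
    it. *)
Lemma descending_stab (p : primeIdeal A) J (K : nat -> ideal A) :
  saturated p J -> ~ J 1 ->
  (forall q : primeIdeal A, J `<=` q -> q `<=` p -> p `<=` q) ->
  (forall n, saturated p (K n)) -> (forall n, J `<=` K n) ->
  (forall n, K n.+1 `<=` K n) -> exists N, K N `<=` K N.+1.
Proof.
(* Stationary for all n >= N, since in the induction a may leave the chain later than the index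
   where the sums with (a) become stationary. *)
pose D J := forall K : nat -> ideal A, (forall n, saturated p (K n)) ->
  (forall n, J `<=` K n) -> (forall n, K n.+1 `<=` K n) ->
  exists N, forall n, (N <= n)%N -> K N `<=` K n.
have decr (K' : nat -> ideal A) (m n : nat) : (forall n, K' n.+1 `<=` K' n) ->
    (m <= n)%N -> K' n `<=` K' m.
  move=> dK; elim: n => [|n IH]; first by rewrite leqn0 => /eqP->.
  by rewrite leq_eqVlt => /orP[/eqP->//|/IH h x /dK/h].
move=> sJ _ minp; suff /(_ K) DJ : D J.
  by move=> sK JK dK; have [N hN] := DJ sK JK dK; exists N; apply: hN.
apply: contrapT => nD.
have [I [[sI JI nDI] _ maxI]] := noeth_max noethA
  (P := fun I => [/\ saturated p I, J `<=` I & ~ D I]) (And3 sJ (fun x => id) nD).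
have nI1 : ~ I 1.
  move=> I1; apply: nDI => K' _ IK _; exists 0%N => n _ x _.
  by rewrite -[x]mulr1; apply: idealMl; apply: IK.
have [a [nIa Ia]] := noeth_ass noethA nI1.
have pa c : p c -> I (c * a).
  apply: (minp (PrimeIdeal Ia)) => [x /JI Ix|x /= Ixa]; first exact: idealMr.
  by apply: contrapT => nx; apply: nIa; apply: sI nx Ixa.
have Da : D (isat p (iadd I a)).
  apply: contrapT => nDa; apply: nIa.
  apply: (maxI (isat p (iadd I a))).
  - split=> //; first exact: isat_sat.
    by move=> x /JI Ix; apply/isat_sub/iadd_sub.
  - by move=> x Ix; apply/isat_sub/iadd_sub.
  - exact/isat_sub/iadd_mem.
apply: nDI => K' sK' IK' dK'.
have grow n x : isat p (iadd I a) x -> K' n x -> I x \/ K' n a.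
  move=> [s [ns [i [c [Ii e]]]]] Kx.
  have [pc|npc] := pselect (p c); [left|right].
    by apply: (sI s) => //; rewrite e; apply: idealD => //; apply: pa.
  apply: (sK' n c) => //; rewrite -[_ * a](addKr i) -e.
  by apply: idealD; [apply/idealN/IK'|apply: idealMl].
pose S n := isat p (isum (K' n) (iadd I a)).
have [N hN] : exists N, forall n, (N <= n)%N -> S N `<=` S n.
  apply: Da => [n|n|n]; first exact: isat_sat.
    apply: isat_min; first exact: isat_sat.
    by move=> x Ix; apply/isat_sub/isum_subr.
  apply: isat_min; first exact: isat_sat.
  apply: isum_min => x; first by move=> /dK' Kx; apply/isat_sub/isum_subl.
  by move=> Ix; apply/isat_sub/isum_subr.
have [[M nKa]|Kall] := pselect (exists M, ~ K' M a); last first.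
  exists N => n Nn x Kx; have [] := hN n Nn x; first exact/isat_sub/isum_subl.
  move=> s [ns [k [y [Kk [i [c [Ii ->]]] e]]]]; apply: (sK' n s) => //.
  rewrite e; apply: idealD => //; apply: idealD; first exact: IK'.
  by apply: idealMl; apply: contrapT => nKa; apply: Kall; exists n.
exists (maxn N M) => n; rewrite geq_max => /andP[Nn Mn] x Kx.
have [] := hN n Nn x; first by apply/isat_sub/isum_subl; apply: decr Kx => //; exact: leq_maxl.
move=> s [ns [k [y [Kk Iy e]]]]; apply: (sK' n s) => //.
rewrite e; apply: idealD => //; apply: IK'.
have K'y : K' (maxn N M) y.
  rewrite -[y](addKr k) -e; apply: idealD; last exact: idealMl.
  apply: idealN; apply: decr Kk => //; by rewrite geq_max Nn.
have [//|Ka] := grow _ _ (isat_sub p Iy) K'y.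
by case: nKa; apply: decr Ka => //; exact: leq_maxr.
Qed.

(* If p2 were minimal over p0 + (x), the chain of the symbolic powers of p1
   modulo p0 would be stationary modulo x, hence stationary, so that p1 = p0. *)
Lemma krull_pit (p0 p1 p2 : primeIdeal A) x :
  p0 `<=` p1 -> ~ p1 `<=` p0 -> p1 `<=` p2 -> ~ p2 `<=` p1 -> p2 x ->
  exists q : primeIdeal A, [/\ p0 `<=` q, q x, q `<=` p2 & ~ p2 `<=` q].
Proof.
move=> p01 np10 p12 np21 p2x.
have [p1x|np1x] := pselect (p1 x); first by exists p1.
apply: contrapT => noq.
pose Y n := isat p1 (isum (idealX p1 n) p0).
have dY n : Y n.+1 `<=` Y n.
  apply: isat_min; first exact: isat_sat.
  move=> y; apply: isum_min => {}y; last by move=> p0y; apply/isat_sub/isum_subr.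
  by move=> /idealMSr h; apply/isat_sub/isum_subl.
have sY2 n : saturated p2 (Y n) by move=> s a ns; apply: isat_sat => /p12.
have p0Y n : p0 `<=` Y n by move=> y p0y; apply/isat_sub/isum_subr.
pose J := isat p2 (iadd p0 x).
have [||||||N hN] := @descending_stab p2 J (fun n => isat p2 (iadd (Y n) x)).
- exact: isat_sat.
- move=> [s [ns [i [c [p0i e]]]]]; apply: ns; rewrite -[s]mulr1 e.
  by apply: idealD; [apply/p12/p01|apply: idealMl].
- move=> q Jq qp; apply: contrapT => npq; apply: noq; exists q; split=> //.
    by move=> y p0y; apply/Jq/isat_sub/iadd_sub.
  exact/Jq/isat_sub/iadd_mem.
- by move=> n; exact: isat_sat.
- move=> n; apply: isat_min; first exact: isat_sat.
  move=> _ [i [c [/p0Y h ->]]]; apply: isat_sub; exists i, c; split=> //.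
- move=> n; apply: isat_min; first exact: isat_sat.
  by move=> _ [i [c [/dY h ->]]]; apply: isat_sub; exists i, c.
(* Up to a factor outside p2, an element of Y N is i + c x with i in Y N.+1. Then c x lies in Y N,
   and x is outside p1, so c lies in Y N by saturation at p1. Hence Y N = Y N.+1 + p2 Y N at p2. *)
have stat : Y N `<=` Y N.+1.
  apply: (@nakayama _ noethA p2) => // y Yy.
  have [s [ns [i [c [Yi e]]]]] := hN _ (isat_sub p2 (iadd_sub x Yy)).
  exists s; split=> //; rewrite e; exists i, (c * x); split=> //.
  rewrite mulrC; apply: mem_idealM => //.
  apply: (isat_sat np1x); rewrite mulrC -[c * x](addKr i) -e.
  by apply: idealD; [apply/idealN/dY|apply: idealMl].
have : Y N `<=` p0.
  apply: (@nakayama _ noethA p1) => //.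
  - exact: prime_saturated.
  - exact: isat_sat.
  - move=> y /stat; move: y; apply: isat_min; first exact: isat_sat.
    apply: isum_min; last by move=> y p0y; apply/isat_sub/isum_subl.
    apply: idealM_min => a b p1a hb; apply/isat_sub/isum_subr/mem_idealM => //.
    exact/isat_sub/isum_subl.
move=> Yp0; apply: np10 => y p1y.
have : p0 (y ^+ N) by apply/Yp0/isat_sub/isum_subl/idealX_exp.
elim: (N) => [/prime1//|n IH]; by rewrite exprS => /primeM[].
Qed.

End LocalRings.

(** The bounds are bare sets, so that images of ideals and unions of such can serve without forming
    the ideals they generate. *)
Definition pchain (A : comPzRingType) (I J : set A) (d : nat) :=
  exists c : nat -> primeIdeal A, [/\ I `<=` c 0%N, c d `<=` J &
    forall i, (i < d)%N -> c i `<=` c i.+1 /\ ~ c i.+1 `<=` c i].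

Lemma chain_mono (A : comPzRingType) (c : nat -> primeIdeal A) d :
  (forall i, (i < d)%N -> c i `<=` c i.+1 /\ ~ c i.+1 `<=` c i) ->
  forall i j, (i <= j)%N -> (j <= d)%N -> c i `<=` c j.
Proof.
move=> inc i j ij jd; elim: j ij jd => [|j IH].
  by rewrite leqn0 => /eqP-> _ x.
rewrite leq_eqVlt => /orP[/eqP-> _ x //|ij] jd x.
by move=> /(IH ij (ltnW jd)); apply: (inc j jd).1.
Qed.

Section Chains.
Variable A : comPzRingType.
Implicit Types (I J : set A).

Lemma pchain0 I J (P : primeIdeal A) : I `<=` P -> P `<=` J -> pchain I J 0.
Proof. by move=> IP PJ; exists (fun=> P). Qed.

Lemma pchain_rcons I (P Q : primeIdeal A) d :
  pchain I P d -> P `<=` Q -> ~ Q `<=` P -> pchain I Q d.+1.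
Proof.
move=> [c [Ic cP inc]] PQ nQP.
exists (fun i => if (i <= d)%N then c i else Q); split; rewrite ?ltnn //=.
move=> i; rewrite ltnS leq_eqVlt => /orP[/eqP->|id].
  rewrite eqxx ltnn /=; split=> [x /cP/PQ//|Qc]; apply: nQP => x /Qc; exact: cP.
by rewrite id orbT; apply: inc.
Qed.

Lemma pchain_cons I J (P : primeIdeal A) d : I `<=` P ->
  (exists c : nat -> primeIdeal A, [/\ P `<=` c 0%N, ~ c 0%N `<=` P, c d `<=` J &
    forall i, (i < d)%N -> c i `<=` c i.+1 /\ ~ c i.+1 `<=` c i]) ->
  pchain I J d.+1.
Proof.
move=> IP [c [Pc nPc cJ inc]].
by exists (fun i => if i is i'.+1 then c i' else P); split=> // -[|i] //; apply: inc.
Qed.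

Lemma pchain_weak I J I' J' d : I' `<=` I -> J `<=` J' -> pchain I J d -> pchain I' J' d.
Proof.
move=> II JJ [c [Ic cJ inc]]; exists c; split=> //.
  by move=> x /II/Ic.
by move=> x /cJ/JJ.
Qed.

Lemma pchain_last I J d : pchain I J d ->
  exists P : primeIdeal A, [/\ P `<=` J, I `<=` P & pchain I P d].
Proof.
move=> [c [Ic cJ inc]]; exists (c d); split=> //; last by exists c; split.
by move=> x /Ic; apply: (chain_mono inc).
Qed.

Lemma pchain_split I J d : pchain I J d.+1 ->
  exists P Q : primeIdeal A, [/\ Q `<=` J, P `<=` Q, ~ Q `<=` P & pchain I P d].
Proof.
move=> [c [Ic cJ inc]]; exists (c d), (c d.+1); split=> //; try exact: (inc d _).1.
  exact: (inc d _).2.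
by exists c; split=> // i id; apply: inc; apply: leqW.
Qed.

Hypothesis noethA : noetherian A.

(** [krull_pit] exchanges the primes below P, from the top down, for primes containing x, until one
    containing x is met; the lowest prime of the chain is lost. *)
Lemma pchain_pit I (P : primeIdeal A) x d : P x ->
  pchain I P d.+1 -> pchain (I `|` [set x]) P d.
Proof.
move=> Px /pchain_split [P1 [Q [QP P1Q nQP1 ch]]].
have {QP P1Q nQP1} [P1P nPP1] : P1 `<=` P /\ ~ P `<=` P1.
  by split=> [y /P1Q/QP//|PP1]; apply: nQP1 => y /QP/PP1.
elim: d P1 P x Px P1P nPP1 ch => [|d IH] P1 P x Px P1P nPP1 ch.
  apply: (@pchain0 _ _ P) => // y [Iy|->//].
  by have [P' [P'1 IP' _]] := pchain_last ch; apply/P1P/P'1/IP'.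
have [P0 [P1' [P1'1 P01 nP10 {}ch]]] := pchain_split ch.
have [P1'x|nP1'x] := pselect (P1' x).
  apply: (pchain_rcons (P := P1')) => [|y /P1'1/P1P//|h]; first exact: (IH P0).
  by apply: nPP1 => y /h/P1'1.
have [|||q [P0q qx qP nPq]] := @krull_pit A noethA P0 P1' P x P01 nP10.
- by move=> y /P1'1/P1P.
- by move=> h; apply: nPP1 => y /h/P1'1.
- exact: Px.
apply: (pchain_rcons _ qP nPq); apply: (IH P0) => // h.
exact/nP1'x/P01/h.
Qed.

End Chains.

(** * Fields and subrings *)

Section FieldOfPz.
Variable k : comPzRingType.

Definition isfield := (1 : k) <> 0 /\ forall x : k, x <> 0 -> exists y, y * x = 1.

Lemma field_pack : isfield ->
  exists (F : fieldType) (i : {rmorphism k -> F}) (j : {rmorphism F -> k}),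
    cancel i j /\ cancel j i.
Proof.
move=> [k1 kinv].
pose nzm := GRing.PzSemiRing_isNonZero.Build k (introN eqP k1).
pose knz : comNzRingType := HB.pack k nzm.
pose inv (x : k) := if pselect (exists y, y * x = 1) is left h then sval (cid h) else x.
have invP (x : k) : x != 0 -> inv x * x = 1.
  move=> /eqP/kinv h; rewrite /inv; case: pselect => // h'; by case: cid.
have inv0 : inv 0 = 0.
  rewrite /inv; case: pselect => // h; exfalso; case: h => y.
  by rewrite mulr0 => /esym/k1.
pose fm := GRing.ComNzRing_isField.Build knz invP inv0.
pose F : fieldType := HB.pack knz fm.
have [i ie] := @rmorph_ex k F (fun x => x) erefl (fun _ _ => erefl) (fun _ _ => erefl).
have [j je] := @rmorph_ex F k (fun x => x) erefl (fun _ _ => erefl) (fun _ _ => erefl).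
by exists F, i, j; split=> x; rewrite ie je.
Qed.

End FieldOfPz.

Definition subring_axiom (T : pzRingType) (G : set T) :=
  [/\ G 1, forall x y, G x -> G y -> G (x - y) & forall x y, G x -> G y -> G (x * y)].

Section Subring.
Variables (T : pzRingType) (G : set T).
Hypothesis sG : subring_axiom G.

Lemma subring1 : G 1. Proof. by case: sG. Qed.
Lemma subringB x y : G x -> G y -> G (x - y). Proof. by case: sG => _ h _; apply: h. Qed.
Lemma subringM x y : G x -> G y -> G (x * y). Proof. by case: sG => _ _; apply. Qed.
Lemma subring0 : G 0. Proof. by rewrite -(subrr 1); apply: subringB; apply: subring1. Qed.
Lemma subringN x : G x -> G (- x).
Proof. by move=> Gx; rewrite -sub0r; apply: subringB => //; apply: subring0. Qed.
Lemma subringD x y : G x -> G y -> G (x + y).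
Proof. by move=> Gx Gy; rewrite -[y]opprK; apply: subringB => //; apply: subringN. Qed.
Lemma subringX x n : G x -> G (x ^+ n).
Proof.
move=> Gx; elim: n => [|n IH]; first exact: subring1.
by rewrite exprS; apply: subringM.
Qed.
Lemma subring_nat n : G n%:R.
Proof.
elim: n => [|n IH]; first exact: subring0.
by rewrite -addn1 natrD; apply: subringD => //; apply: subring1.
Qed.
Lemma subring_sum I r (P : pred I) (f : I -> T) :
  (forall i, P i -> G (f i)) -> G (\sum_(i <- r | P i) f i).
Proof.
move=> h; apply: (big_ind G) => //; [exact: subring0|exact: subringD].
Qed.
End Subring.

Section SubringPoly.
Variables (F : comNzRingType) (G : set F).
Hypothesis sG : subring_axiom G.
Definition polyG : set {poly F} := [set g | forall i, G g`_i].

Lemma polyG_subring : subring_axiom polyG.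
Proof.
split=> [i|f g hf hg i|f g hf hg i].
- by rewrite coef1; case: eqP => _; [apply: subring1|apply: subring0].
- by rewrite coefB; apply: subringB.
- by rewrite coefM; apply: subring_sum => // j _; apply: subringM.
Qed.

Lemma polyGC c : G c -> polyG c%:P.
Proof. by move=> Gc i; rewrite coefC; case: eqP => // _; apply: subring0. Qed.

Lemma polyGX : polyG 'X.
Proof. by move=> i; rewrite coefX; case: eqP => _; [apply: subring1|apply: subring0]. Qed.

Lemma polyG_div (g h : {poly F}) : polyG g -> g \is monic -> polyG h ->
  exists q r, [/\ polyG q, polyG r, h = q * g + r & (size r < size g)%N].
Proof.
move=> Gg mg; have [n] := ubnP (size h); elim: n h => // n IH h hn Gh.
have [hg|gh] := ltnP (size h) (size g).
  exists 0, h; split=> //; last by rewrite mul0r add0r.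
  exact: (subring0 polyG_subring).
have h0 : h != 0.
  by rewrite -size_poly_gt0; apply: leq_trans gh; rewrite size_poly_gt0 monic_neq0.
pose t := (lead_coef h)%:P * 'X^(size h - size g).
have Gt : polyG t.
  apply: (subringM polyG_subring); first exact/polyGC/Gh.
  by apply: (subringX polyG_subring); apply: polyGX.
have tg : (size (h - t * g)%R < size h)%N.
  have sg : (0 < size g)%N by rewrite size_poly_gt0 monic_neq0.
  have sh : (0 < size h)%N := leq_trans sg gh.
  rewrite -(prednK sh) ltnS; apply/leq_sizeP => j hj.
  rewrite coefB -mulrA coefCM coefXnM.
  have hg : (size h - size g <= j)%N by move: hj sg sh; clear; lia.
  rewrite ltnNge hg /=.
  move: hj; rewrite leq_eqVlt => /orP[/eqP<-|hj].
    have -> : ((size h).-1 - (size h - size g))%N = (size g).-1 by move: gh sg sh; clear; lia.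
    by rewrite -[g`_ _]lead_coefE (monicP mg) mulr1 subrr.
  rewrite [h`_j]nth_default ?[g`_ _]nth_default ?mulr0 ?subr0 //;
    move: (size g) (size h) gh sg sh hj hg => a b; clear; lia.
have [|q [r [Gq Gr e rg]]] := IH _ _ (subringB polyG_subring Gh (subringM polyG_subring Gt Gg)).
  by apply: leq_trans tg _; rewrite -ltnS.
exists (q + t), r; split=> //; first exact: (subringD polyG_subring).
by rewrite mulrDl addrAC -e subrK.
Qed.

End SubringPoly.

Section MinPoly.
Variables (F : fieldType) (G : set F) (x : F).
Hypothesis sG : subring_axiom G.
Hypothesis iG : forall y, G y -> G y^-1.

Lemma polyG_min (h : {poly F}) : polyG G h -> h != 0 -> root h x ->
  exists g, [/\ polyG G g, g \is monic, root g x, (size g <= size h)%N &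
    forall f, polyG G f -> root f x -> g %| f].
Proof.
move=> Gh h0 rh.
pose P n := `[< exists g, [/\ polyG G g, g != 0, root g x & size g = n] >].
have exP : exists n, P n by exists (size h); apply/asboolP; exists h.
case: (ex_minnP exP) => n /asboolP[g [Gg g0 rg sg]] minn.
have l0 : lead_coef g != 0 by rewrite lead_coef_eq0.
exists ((lead_coef g)^-1 *: g); split.
- by move=> i; rewrite coefZ; apply: subringM => //; apply/iG/Gg.
- by rewrite monicE lead_coefZ mulVf.
- by rewrite rootZ // invr_eq0.
- by rewrite size_scale ?invr_eq0 // sg; apply: minn; apply/asboolP; exists h.
- move=> f Gf rf.
  set g' := _ *: g.
  have Gg' : polyG G g' by move=> i; rewrite coefZ; apply: subringM => //; apply/iG/Gg.
  have mg' : g' \is monic by rewrite monicE lead_coefZ mulVf.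
  have rg' : root g' x by rewrite rootZ // invr_eq0.
  have [q [r [Gq Gr e sr]]] := polyG_div sG Gg' mg' Gf.
  have rr : root r x.
    by move: rf; rewrite e !rootE hornerD hornerM (eqP rg') mulr0 add0r.
  have [r0|r0] := eqVneq r 0; first by rewrite e r0 addr0 dvdp_mull.
  have : (n <= size r)%N by apply: minn; apply/asboolP; exists r.
  by move: sr; rewrite size_scale ?invr_eq0 // sg ltnNge => /negP.
Qed.

End MinPoly.

(** The minimal polynomial of x over the field G divides X^p - x^p = (X - x)^p. If its degree j were
    below p, its coefficient - j x in degree j - 1 would put x in G. *)
Lemma pbasis_free (F : fieldType) (G : set F) (x : F) p (f : nat -> F) :
  p \in [pchar F] -> subring_axiom G -> (forall y, G (y ^+ p)) -> ~ G x ->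
  (forall i, G (f i)) -> \sum_(i < p) f i * x ^+ i = 0 ->
  forall i, (i < p)%N -> f i = 0.
Proof.
move=> cp sG Gp nGx Gf s0.
have p_gt0 : (0 < p)%N by apply: prime_gt0; apply: pcharf_prime cp.
have iG y : G y -> G y^-1.
  move=> Gy; have [->|y0] := eqVneq y 0; first by rewrite invr0; apply: subring0.
  have -> : y^-1 = y ^+ p.-1 * (y^-1) ^+ p.
    by rewrite -[in X in _ * X](prednK p_gt0) exprSr mulrA -exprMn divff // expr1n mul1r.
  by apply: subringM => //; apply: subringX.
pose h := \poly_(i < p) f i.
have Gh : polyG G h.
  by move=> i; rewrite coef_poly; case: ifP => // _; apply: subring0.
have rh : root h x.
  by rewrite rootE horner_poly; apply/eqP.
have [h0|h0] := eqVneq h 0.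
  by move=> i ip; have := coef_poly p f i; rewrite -/h h0 coef0 ip.
have [g [Gg mg rg sg dg]] := polyG_min sG iG Gh h0 rh.
have cpX : p \in [pchar {poly F}] by rewrite pchar_poly.
have eX : ('X - x%:P) ^+ p = 'X^p - (x ^+ p)%:P.
  have := pFrobenius_autB_comm cpX (mulrC 'X x%:P).
  by rewrite !pFrobenius_autE polyC_exp.
have : g %| ('X - x%:P) ^+ p.
  apply: dg; last by rewrite rootE horner_exp hornerXsubC subrr expr0n; case: (p) p_gt0.
  rewrite eX; apply: (subringB (polyG_subring sG)); last exact: (polyGC sG (Gp x)).
  by apply: (subringX (polyG_subring sG)); apply: polyGX.
move=> /dvdp_exp_XsubCP[j jp].
have mX : ('X - x%:P) ^+ j \is monic by apply: monic_exp; apply: monicXsubC.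
rewrite eqp_monic // => /eqP eg.
have jp' : (j < p)%N.
  by have := leq_trans sg (size_poly p f); rewrite eg size_exp_XsubC.
have j0 : (0 < j)%N.
  by rewrite lt0n; apply: contraTneq rg => j0; rewrite eg j0 expr0 root1.
have : G (- (x *+ j)).
  have := coefPn_prod_XsubC (ps := nseq j x); rewrite size_nseq -lt0n => /(_ j0).
  have -> : \prod_(z <- nseq j x) ('X - z%:P) = g.
    by rewrite eg; elim: (j) => [|n IH]; rewrite /= ?big_nil // big_cons IH exprS.
  have -> : \sum_(z <- nseq j x) z = x *+ j.
    by elim: (j) => [|n IH]; rewrite /= ?big_nil // big_cons IH mulrS.
  by move=> <-; apply: Gg.
move=> /(subringN sG); rewrite opprK => Gxj; case: nGx.
have j1 : (j%:R : F) != 0.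
  by rewrite -(dvdn_pcharf cp) gtnNdvd.
rewrite -[x](mulfK j1) mulr_natr; apply: subringM => //; apply: iG; exact: subring_nat.
Qed.

(** * Lifting fields through square-zero extensions *)

Definition sqz_surj (C D : comPzRingType) (pi : {rmorphism C -> D}) :=
  (forall d, exists c, pi c = d) /\
  (forall x y, pi x = 0 -> pi y = 0 -> x * y = 0).

Lemma qproj_sqz (A : comPzRingType) (I J : ideal A) :
  I `<=` J -> (forall x y, J x -> J y -> I (x * y)) ->
  exists pi : {rmorphism qring I -> qring J},
    (forall x, pi (qproj I x) = qproj J x) /\ sqz_surj pi.
Proof.
move=> IJ J2.
have h x : I x -> qproj J x = 0 by move=> /IJ hx; apply/qproj_eq0.
have qE x : qlift h (qproj I x) = qproj J x by exact: qliftE.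
exists (qlift h); split=> //; split=> [|x y].
  by elim/qprojW=> x; exists (qproj I x); apply: qE.
elim/qprojW: x => x; elim/qprojW: y => y.
rewrite [X in X = _ -> _]qE [X in _ -> X = _ -> _]qE => /qproj_eq0 Jx /qproj_eq0 Jy.
by rewrite -rmorphM; apply/qproj_eq0/J2.
Qed.

Lemma exprD_sqz (T : comPzRingType) (a n : T) k : n * n = 0 ->
  (a + n) ^+ k = a ^+ k + k%:R * a ^+ k.-1 * n.
Proof.
move=> nn; elim: k => [|k IH]; first by rewrite !mul0r addr0.
rewrite exprS IH /=; case: k {IH} => [|k]; first by rewrite /= !expr0; ring.
rewrite /= !exprS -[in RHS]natr1.
transitivity (a * (a * a ^+ k) + (k.+1%:R + 1) * (a * a ^+ k) * n +
  k.+1%:R * a ^+ k * (n * n)); last by rewrite nn; ring.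
ring.
Qed.

Lemma expr_pD (T : comPzRingType) (G : set T) p (x y : T) : prime p ->
  subring_axiom G -> G x -> G y ->
  exists2 w, G w & (x + y) ^+ p = x ^+ p + y ^+ p + p%:R * w.
Proof.
move=> pr sG Gx Gy; have p_gt0 := prime_gt0 pr.
exists (\sum_(1 <= i < p) x ^+ (p - i) * y ^+ i *+ ('C(p, i) %/ p)).
  rewrite big_seq; apply: subring_sum => // i _.
  by rewrite -mulr_natr; apply: subringM => //; [apply: subringM => //; apply: subringX|
    apply: subring_nat].
rewrite exprDn -(big_mkord xpredT (fun i => x ^+ (p - i) * y ^+ i *+ 'C(p, i))).
rewrite big_ltn // big_nat_recr //= subn0 expr0 mulr1 bin0 subnn expr0 mul1r binn !mulr1n.
rewrite -addrA [_ + y ^+ p]addrC; congr (_ + (_ + _)).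
rewrite mulr_sumr; apply: eq_big_nat => i /andP[i0 ip].
by rewrite mulr_natl -mulrnA divnK // prime_dvd_bin // i0.
Qed.

Lemma pair_nat (C E : comPzRingType) k : (k%:R : C * E) = (k%:R, k%:R).
Proof. by elim: k => // k IH; rewrite -!natr1 IH. Qed.

Lemma pair_exp (C E : comPzRingType) (x : C * E) k : x ^+ k = (x.1 ^+ k, x.2 ^+ k).
Proof. by elim: k => // k IH; rewrite !exprS IH. Qed.

Section Graph.
Variables (C D E : comPzRingType) (pi : {rmorphism C -> D}) (u : {rmorphism E -> D}).
Hypothesis pis : sqz_surj pi.

Definition fprod : set (C * E) := [set z | pi z.1 = u z.2].

Lemma fprod_subring : subring_axiom fprod.
Proof.
split=> [|x y hx hy|x y hx hy]; rewrite /fprod /=; first by rewrite !rmorph1.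
  by rewrite !rmorphB hx hy.
by rewrite !rmorphM hx hy.
Qed.

(** The graph of a lift of u defined on a subring of E; the last clause says that it is
    single-valued. *)
Definition graph (G : set (C * E)) := [/\ subring_axiom G, G `<=` fprod &
  forall z, G z -> z.2 = 0 -> z.1 = 0].

Lemma graph_max G0 : graph G0 ->
  exists M, [/\ graph M, G0 `<=` M & forall N, graph N -> M `<=` N -> N `<=` M].
Proof.
move=> g0; apply: Zorn_above => // F [Y0 FY0] FQ totF.
have join X Y x y : F X -> F Y -> X x -> Y y -> exists Z, [/\ F Z, Z x & Z y].
  move=> FX FY Xx Yy; have [h|h] := totF _ _ FX FY.
    by exists Y; split=> //; apply: h.
  by exists X; split=> //; apply: h.
split=> [|z [X FX Xz]|z [X FX Xz]]; last 2 first.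
- by have [_ h _] := FQ _ FX; apply: h.
- by have [_ _ h] := FQ _ FX; apply: h.
split=> [|x y [X FX Xx] [Y FY Yy]|x y [X FX Xx] [Y FY Yy]].
- by exists Y0 => //; have [h _ _] := FQ _ FY0; apply: subring1.
- have [Z [FZ Zx Zy]] := join _ _ _ _ FX FY Xx Yy.
  by exists Z => //; have [h _ _] := FQ _ FZ; apply: subringB.
- have [Z [FZ Zx Zy]] := join _ _ _ _ FX FY Xx Yy.
  by exists Z => //; have [h _ _] := FQ _ FZ; apply: subringM.
Qed.

Lemma graph_lift M : graph M -> (forall e, exists c, M (c, e)) ->
  exists v : {rmorphism E -> C}, forall e, pi (v e) = u e.
Proof.
move=> [sM Mfp M0] tot; have [v Mv] := choice tot.
have uniq c c' e : M (c, e) -> M (c', e) -> c = c'.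
  move=> h h'; apply/eqP; rewrite -subr_eq0; apply/eqP.
  by apply: (M0 _ (subringB sM h h')); rewrite /= subrr.
have [|||w we] := @rmorph_ex E C v.
- apply: (uniq _ _ 1) => //; exact: (subring1 sM).
- by move=> x y; apply: (uniq _ _ (x + y)) => //; apply: (subringD sM (Mv x) (Mv y)).
- by move=> x y; apply: (uniq _ _ (x * y)) => //; apply: (subringM sM (Mv x) (Mv y)).
by exists w => e; rewrite we; apply: (Mfp _ (Mv e)).
Qed.

Lemma fprod_ex e : exists c, fprod (c, e).
Proof. by have [c] := pis.1 (u e); exists c. Qed.

(* E may have characteristic p or p^2: the p-th powers together with the
   multiples of p have a canonical lift, and a p-basis of the residue field
   is lifted arbitrarily. *)
Lemma lift_charp (F : fieldType) (kappa : {rmorphism E -> F}) p :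
  p \in [pchar F] -> (forall f, exists e, kappa e = f) ->
  (forall e, kappa e = 0 -> exists y, e = p%:R * y) ->
  (forall e c, fprod (c, e) -> p%:R * e = 0 -> p%:R * c = 0) ->
  exists v : {rmorphism E -> C}, forall e, pi (v e) = u e.
Proof.
move=> cp kS kker kill; have pr := pcharf_prime cp.
have sF := fprod_subring.
pose G0 : set (C * E) := [set z | exists x y, [/\ fprod x, fprod y & z = x ^+ p + p%:R * y]].
have pn n : pi n = 0 -> p%:R * n = 0.
  by move=> n0; apply: (kill 0); rewrite ?mulr0 // /fprod /= n0 rmorph0.
have gG0 : graph G0.
  split.
  - split.
    + exists 1, 0; split; [exact: subring1|exact: subring0|].
      by rewrite expr1n mulr0 addr0.
    + move=> _ _ [x [y [hx hy ->]]] [x' [y' [hx' hy' ->]]].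
      have [w hw e] := expr_pD pr sF (subringB sF hx hx') hx'.
      exists (x - x'), (y - y' + w); split; [exact: subringB| |].
        by apply: (subringD sF) => //; apply: subringB.
      by rewrite subrK in e; rewrite e; ring.
    + move=> _ _ [x [y [hx hy ->]]] [x' [y' [hx' hy' ->]]].
      exists (x * x'), (x ^+ p * y' + x' ^+ p * y + p%:R * y * y'); split.
      * exact: subringM.
      * apply: (subringD sF); [apply: (subringD sF)|]; do ?apply: (subringM sF) => //;
          try exact: subringX; exact: subring_nat.
      * by rewrite exprMn; ring.
  - move=> _ [x [y [hx hy ->]]]; apply: (subringD sF); first exact: subringX.
    by apply: (subringM sF) => //; apply: subring_nat.
  (* From e^p + p e' = 0 it follows that e vanishes in F, so e = p e1, and c = p c1 + n with n in
     the kernel of pi and p n = 0. Thus c^p + p c' is p times an element lying over p^(p-1) e1^p +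
     e', and [kill] applies. *)
  - move=> _ [[c e] [[c' e'] [hx hy ->]]] /=.
    rewrite pair_exp pair_nat /= => e0.
    have [e1 ee] : exists y, e = p%:R * y.
      apply: kker; apply/eqP.
      suff : kappa e ^+ p == 0 by rewrite expf_eq0 => /andP[].
      have := congr1 kappa e0; rewrite rmorphD rmorphXn rmorphM rmorph_nat.
      by rewrite (pcharf0 cp) mul0r addr0 rmorph0 => ->.
    have [c1 hc1] := fprod_ex e1.
    pose n := c - p%:R * c1.
    have pin : pi n = 0 by rewrite rmorphB rmorphM rmorph_nat hc1 hx /= ee rmorphM rmorph_nat subrr.
    have -> : c ^+ p = p%:R * (p%:R ^+ p.-1 * c1 ^+ p).
      have -> : c = p%:R * c1 + n by rewrite addrC subrK.
      rewrite exprD_sqz; last exact: pis.2.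
      rewrite mulrAC (pn n) // mul0r addr0 exprMn mulrA -exprS prednK //.
      exact: prime_gt0.
    rewrite -mulrDr; apply: (kill (p%:R ^+ p.-1 * e1 ^+ p + e')).
      rewrite /fprod /= !rmorphD !rmorphM !rmorphXn !rmorph_nat hc1; congr (_ + _); exact: hy.
    rewrite mulrDr mulrA -exprS prednK ?prime_gt0 // -exprMn -ee; exact: e0.
have [M [[sM Mfp M0] G0M maxM]] := graph_max gG0.
have Mp x : fprod x -> M (p%:R * x).
  move=> hx; apply: G0M; exists 0, x; split=> //; first exact: subring0.
  by rewrite expr0n gtn_eqF ?prime_gt0 // add0r.
apply: (graph_lift (M := M)) => // e.
pose k' : set F := [set kappa z.2 | z in M].
have sk' : subring_axiom k'.
  split=> [|_ _ [x Mx <-] [y My <-]|_ _ [x Mx <-] [y My <-]].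
  - by exists 1; [apply: subring1|rewrite rmorph1].
  - by exists (x - y); [apply: subringB|rewrite rmorphB].
  - by exists (x * y); [apply: subringM|rewrite rmorphM].
have [[[c1 e1] Mz /= ke]|nk] := pselect (k' (kappa e)).
  have [y ey] : exists y, e - e1 = p%:R * y by apply: kker; rewrite rmorphB ke subrr.
  have [c hc] := fprod_ex y.
  have := subringD sM Mz (Mp _ hc).
  rewrite pair_nat => h; exists (c1 + p%:R * c).
  by rewrite -(subrK e1 e) ey [_ + e1]addrC.
exfalso; apply: (nk).
have [c hx] := fprod_ex e; pose x := (c, e).
have Mxp : M (x ^+ p).
  apply: G0M; exists x, 0; split=> //; first exact: subring0.
  by rewrite mulr0 addr0.
(* This is M[x]: degrees below p suffice because x^p lies in M. *)
pose Sp : set (C * E) := [set z | exists f : nat -> C * E,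
  (forall i, M (f i)) /\ z = \sum_(i < p) f i * x ^+ i].
have SpB y z : Sp y -> Sp z -> Sp (y - z).
  move=> [f [Mf ->]] [g [Mg ->]]; exists (fun i => f i - g i); split.
    by move=> i; apply: subringB.
  by rewrite -sumrB; apply: eq_bigr => i _; rewrite mulrBl.
have p_gt0 := prime_gt0 pr.
have MSp : M `<=` Sp.
  move=> z Mz; exists (fun i => if i == 0%N then z else 0); split.
    by move=> i; case: eqP => // _; apply: subring0.
  rewrite -(prednK p_gt0) big_ord_recl /= mulr1 big1 ?addr0 // => i _.
  by rewrite /= mul0r.
have Sp0 : Sp 0 by exact: MSp _ (subring0 sM).
have SpD y z : Sp y -> Sp z -> Sp (y + z).
  by move=> hy hz; rewrite -[z]opprK -[- z]sub0r; apply: (SpB _ _ hy); apply: (SpB _ _ Sp0 hz).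
have Spx y : Sp y -> Sp (x * y).
  move=> [f [Mf ->]].
  exists (fun i => if i is i'.+1 then f i' else x ^+ p * f p.-1); split.
    by case=> // *; apply: subringM.
  rewrite -(prednK p_gt0) big_ord_recr big_ord_recl /= mulrDr addrC; congr (_ + _).
    rewrite prednK // mulr1 mulrCA -exprS prednK // mulrC //.
  by rewrite mulr_sumr; apply: eq_bigr => i _; rewrite exprS mulrCA.
have SpM y z : Sp y -> Sp z -> Sp (y * z).
  move=> [f [Mf ->]] hz; rewrite mulr_suml; apply: (big_ind Sp) => // i _.
  have : Sp (x ^+ i * z).
    by elim: (nat_of_ord i) => [|j IH]; rewrite ?mul1r // exprS -mulrA; apply: Spx.
  move=> [g [Mg eg]]; rewrite -mulrA eg mulr_sumr; exists (fun j => f i * g j); split.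
    by move=> j; apply: subringM.
  by apply: eq_bigr => j _; rewrite mulrA.
have gSp : graph Sp.
  split; first by split=> //; exact: MSp _ (subring1 sM).
    move=> _ [f [Mf ->]]; apply: (subring_sum sF) => i _; apply: (subringM sF); first exact/Mfp.
    exact: subringX.
  move=> _ [f [Mf ->]] z0.
  have s0 : \sum_(i < p) kappa (f i).2 * kappa e ^+ i = 0.
    rewrite -[RHS](rmorph0 kappa) -[in RHS]z0 (raddf_sum snd) rmorph_sum; apply: eq_bigr => i _.
    by rewrite /= pair_exp -rmorphXn -rmorphM.
  (* The image k' of M in F contains all p-th powers but not kappa e. Hence every coefficient is
     divisible by p, the sum is p times an element of the fibre product, and [kill] concludes. *)
  have fr : forall i, (i < p)%N -> kappa (f i).2 = 0.
    apply: (@pbasis_free F k' (kappa e) p (fun i => kappa (f i).2) cp sk' _ nk _ s0).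
    - move=> y; have [a <-] := kS y; have [ca ha] := fprod_ex a.
      exists ((ca, a) ^+ p); last by rewrite pair_exp rmorphXn.
      apply: G0M; exists (ca, a), 0; split=> //; first exact: subring0.
      by rewrite mulr0 addr0.
    - by move=> i; exists (f i).
  have /choice[w hw] i : exists w, (i < p)%N -> fprod w /\ f i = p%:R * w.
    case: (ltnP i p) => ip; last by exists 0.
    have [y ey] := kker _ (fr i ip); have [cy hy] := fprod_ex y.
    exists (cy, y) => _; split=> //.
    have := M0 _ (subringB sM (Mf i) (Mp _ hy)); rewrite pair_nat /= ey subrr => /(_ erefl).
    by move/eqP; rewrite subr_eq0 => /eqP; case: (f i) ey => a b /= -> ->.
  move: z0.
  have -> : \sum_(i < p) f i * x ^+ i = p%:R * \sum_(i < p) w i * x ^+ i.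
    rewrite mulr_sumr; apply: eq_bigr => i _.
    by have [_ ->] := hw i (ltn_ord i); rewrite mulrA.
  set s := \sum_(i < p) w i * _.
  have hs : fprod s.
    apply: (subring_sum sF) => i _; apply: (subringM sF); last exact: subringX.
    by have [] := hw i (ltn_ord i).
  by rewrite pair_nat /=; apply: (kill s.2 s.1); case: (s) hs.
have Spx1 : Sp x by rewrite -[x]mulr1; exact: Spx _ (MSp _ (subring1 sM)).
exists x => //; exact: (maxM Sp gSp MSp).
Qed.

Lemma sqz_unit c d : d * pi c = 1 -> exists c', c' * c = 1.
Proof.
move=> dc; have [e ed] := pis.1 d; pose n := 1 - e * c.
have n0 : pi n = 0 by rewrite rmorphB rmorph1 rmorphM ed dc subrr.
exists ((1 + n) * e).
rewrite -mulrA (_ : e * c = 1 - n); last by rewrite opprB addrC subrK.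
rewrite (_ : (1 + n) * (1 - n) = 1 - n * n); last by ring.
by rewrite pis.2 // subr0.
Qed.

End Graph.

Lemma taylor_sqz (T : comNzRingType) (x n : T) (g : {poly T}) : n * n = 0 ->
  g.[x + n] = g.[x] + g^`().[x] * n.
Proof.
move=> nn; elim/poly_ind: g => [|g c IH]; first by rewrite deriv0 !horner0 mul0r addr0.
rewrite derivMXaddC !hornerE /= IH.
transitivity (g.[x] * x + c + (g.[x] + g^`().[x] * x) * n + g^`().[x] * (n * n)).
  by ring.
by rewrite nn; ring.
Qed.

Lemma nzring_pack (A : comPzRingType) : (1 : A) <> 0 ->
  exists (T : comNzRingType) (i : {rmorphism A -> T}) (j : {rmorphism T -> A}),
    cancel i j /\ cancel j i.
Proof.
move=> nz; pose nzm := GRing.PzSemiRing_isNonZero.Build A (introN eqP nz).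
pose T : comNzRingType := HB.pack A nzm.
have [i ie] := @rmorph_ex A T (fun x => x) erefl (fun _ _ => erefl) (fun _ _ => erefl).
have [j je] := @rmorph_ex T A (fun x => x) erefl (fun _ _ => erefl) (fun _ _ => erefl).
by exists T, i, j; split=> x; rewrite ie je.
Qed.

Section LiftChar0.
Variables (C D : comPzRingType) (F : fieldType).
Variables (pi : {rmorphism C -> D}) (u : {rmorphism F -> D}).
Hypothesis pis : sqz_surj pi.
Hypothesis char0 : forall n, (n.+1%:R : F) <> 0.

(* A maximal partial lift is defined on a subfield; an element x outside it is
   adjoined after a Newton step, which moves the chosen lift of x to a root of
   the minimal polynomial. *)
Lemma lift_char0 : exists v : {rmorphism F -> C}, forall e, pi (v e) = u e.
Proof.
have sF := fprod_subring pi u.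
pose G0 : set (C * F) := [set z | exists a b : nat, z = a%:R - b%:R].
have injF (a b : nat) : (a%:R : F) = b%:R -> (a <= b)%N.
  move=> ab; rewrite leqNgt; apply/negP => ba; apply: (@char0 (a - b).-1).
  by rewrite prednK ?subn_gt0 // natrB ?ab ?subrr // ltnW.
have gG0 : graph pi u G0.
  split.
  - split; first by exists 1%N, 0%N; rewrite subr0.
      move=> _ _ [a [b ->]] [a' [b' ->]]; exists (a + b')%N, (b + a')%N.
      by rewrite !natrD; ring.
    move=> _ _ [a [b ->]] [a' [b' ->]].
    exists (a * a' + b * b')%N, (a * b' + b * a')%N.
    by rewrite !natrD !natrM; ring.
  - by move=> _ [a [b ->]]; apply: (subringB sF); apply: (subring_nat sF).
  - move=> _ [a [b ->]]; rewrite !pair_nat /= => /eqP; rewrite subr_eq0 => /eqP ab.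
    suff -> : a = b by rewrite subrr.
    by apply/eqP; rewrite eqn_leq !injF.
have [M [[sM Mfp M0] _ maxM]] := graph_max gG0.
apply: (graph_lift (M := M)) => //.
have funit z : fprod pi u z -> z.2 <> 0 -> exists w : C * F, [/\ fprod pi u w & w * z = 1].
  move=> hz /eqP z2; have [c' e] : exists c', c' * z.1 = 1.
    apply: (sqz_unit pis (d := u z.2^-1)).
    by rewrite hz -rmorphM mulVf // rmorph1.
  exists (c', z.2^-1); split; last by case: (z) e z2 => a b /= e b0; congr pair; rewrite ?mulVf.
  rewrite /fprod /=; transitivity (pi c' * (u z.2^-1 * u z.2)).
    by rewrite -rmorphM mulVf // rmorph1 mulr1.
  by rewrite mulrCA -hz -rmorphM e rmorph1 mulr1.
have Minv z w : M z -> z.2 <> 0 -> w * z = 1 -> M w.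
  move=> Mz z2 wz.
  have zw k : w ^+ k * z ^+ k = 1 by rewrite -exprMn wz expr1n.
  have hw : fprod pi u w.
    have [w' [hw' e]] := funit _ (Mfp _ Mz) z2.
    suff -> : w = w' by [].
    by rewrite -[w]mulr1 -e mulrCA wz mulr1.
  (* M localized at the powers of z, inside the fibre product. It is again a graph, and it contains
     w. *)
  pose Sp : set (C * F) := [set x | exists k, M (x * z ^+ k) /\ fprod pi u x].
  apply: (maxM Sp); last by exists 1%N; rewrite expr1 wz; split=> //; apply: (subring1 sM).
    split.
    - split.
      + by exists 0%N; rewrite mulr1; split; [apply: (subring1 sM)|apply: (subring1 sF)].
      + move=> x y [k [Mx hx]] [l [My hy]]; exists (k + l)%N; split; last exact: subringB.
        rewrite (_ : _ * _ = x * z ^+ k * z ^+ l - y * z ^+ l * z ^+ k).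
          by apply: (subringB sM); apply: (subringM sM) => //; apply: subringX.
        by rewrite exprD; ring.
      + move=> x y [k [Mx hx]] [l [My hy]]; exists (k + l)%N; split; last exact: subringM.
        rewrite (_ : x * y * z ^+ (k + l) = x * z ^+ k * (y * z ^+ l)); last by rewrite exprD; ring.
        exact: subringM.
    - by move=> x [k []].
    - move=> x [k [Mx hx]] x0; have := M0 _ Mx; rewrite /= x0 mul0r => /(_ erefl) e.
      have : x * z ^+ k = 0.
        by rewrite [LHS]surjective_pairing /= e x0 mul0r.
      move=> /(congr1 (fun t => t * w ^+ k)).
      by rewrite -mulrA [z ^+ k * _]mulrC zw mulr1 mul0r => ->.
  by move=> x Mx; exists 0%N; rewrite mulr1; split=> //; apply: Mfp.
move=> e; have [c hx] := fprod_ex u pis e.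
apply: contrapT => ne.
have noSp (x : C * F) : x.2 = e -> ~ exists2 Sp, graph pi u Sp & M `<=` Sp /\ Sp x.
  move=> x2 [Sp gSp [MSp Spx]]; apply: ne; exists x.1.
  by rewrite -x2; have := maxM _ gSp MSp _ Spx; case: (x).
have [|T [tau [rho [tauK rhoK]]]] := @nzring_pack (C * F)%type.
  by move=> /(congr1 snd) /= /eqP; rewrite oner_eq0.
pose x : T := tau (c, e).
pose MT : set T := [set t | M (rho t)].
have sT : subring_axiom MT.
  split=> [|y z hy hz|y z hy hz]; rewrite /MT /= ?rmorph1 ?rmorphB ?rmorphM.
  - exact: (subring1 sM).
  - exact: (subringB sM).
  - exact: (subringM sM).
pose P (H : {poly T}) := polyG MT H.
have sP : subring_axiom P := polyG_subring sT.
pose ev (y : T) : set (C * F) := [set z | exists2 H, P H & z = rho H.[y]].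
have evM y : M `<=` ev y.
  move=> z Mz; exists (tau z)%:P; last by rewrite hornerC tauK.
  by apply: polyGC => //; rewrite /MT /= tauK.
have evx y : ev y (rho y) by exists 'X; [apply: (polyGX sT)|rewrite hornerX].
have hP y H : fprod pi u (rho y) -> P H -> fprod pi u (rho H.[y]).
  move=> hy hH; rewrite horner_coef rmorph_sum; apply: (subring_sum sF) => i _.
  rewrite rmorphM rmorphXn; apply: (subringM sF); first exact/Mfp/hH.
  exact: (subringX sF).
have ev_ring y : subring_axiom (ev y).
  split=> [|_ _ [H hH ->] [K hK ->]|_ _ [H hH ->] [K hK ->]].
  - by exists 1; [apply: (subring1 sP)|rewrite hornerC rmorph1].
  - by exists (H - K); [apply: (subringB sP)|rewrite hornerD hornerN rmorphB].
  - by exists (H * K); [apply: (subringM sP)|rewrite hornerM rmorphM].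
have hx1 : fprod pi u (rho x) by rewrite tauK.
(* If e is a root of no nonzero polynomial over M, any lift of e may be adjoined. *)
have [[G [PG G0x Gx]]|nG] :=
    pselect (exists G, [/\ P G, G != 0 & (rho G.[x]).2 = 0]); last first.
  apply: (noSp (rho x)); first by rewrite tauK.
  exists (ev x); last by split; [apply: evM|apply: evx].
  split; first exact: ev_ring.
    by move=> _ [H hH ->]; apply: hP.
  move=> _ [H hH ->] h0; have [->|H0] := eqVneq H 0; first by rewrite horner0 rmorph0.
  by case: nG; exists H.
pose Q n := `[< exists G, [/\ P G, G != 0, (rho G.[x]).2 = 0 & size G = n] >].
have exQ : exists n, Q n by exists (size G); apply/asboolP; exists G.
case: (ex_minnP exQ) => n /asboolP[{PG G0x Gx}G1 [PG1 G10 G1x sG1]] minn.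
have minP H : P H -> (rho H.[x]).2 = 0 -> (size H < n)%N -> H = 0.
  move=> hH H2 sH; apply/eqP; apply: contraTT sH => H0; rewrite -leqNgt.
  by apply: minn; apply/asboolP; exists H.
pose l := rho (lead_coef G1).
have Ml : M l by apply: PG1.
have l2 : l.2 <> 0.
  move=> l0; have l00 : l = 0 by rewrite [LHS]surjective_pairing l0 (M0 l).
  by move: G10; rewrite -lead_coef_eq0 -[lead_coef _]rhoK -/l l00 rmorph0 eqxx.
have [l' [_ l'l]] := funit _ (Mfp _ Ml) l2.
have Ml' : M l' by apply: Minv l'l.
pose G2 : {poly T} := tau l' *: G1.
have PG2 : P G2.
  by move=> i; rewrite coefZ; apply: (subringM sT); [rewrite /MT /= tauK|apply: PG1].
have lead2 : G2`_(size G1).-1 = 1.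
  by rewrite coefZ -[_`__]rhoK -rmorphM -/(lead_coef G1) -/l l'l rmorph1.
have sG2 : size G2 = n.
  apply/eqP; rewrite eqn_leq -{1}sG1 size_scale_leq /=; apply: minn; apply/asboolP.
  exists G2; split=> //; last by rewrite hornerZ rmorphM /= G1x mulr0.
  apply: contra_eq_neq lead2 => ->; rewrite coef0 eq_sym; exact: oner_neq0.
have mG2 : G2 \is monic by rewrite monicE lead_coefE sG2 -sG1 lead2.
have G2x : (rho G2.[x]).2 = 0 by rewrite hornerZ rmorphM /= G1x mulr0.
have n1 : (1 < n)%N.
  rewrite ltnNge; apply/negP => n1; have : (size G2 <= 1)%N by rewrite sG2.
  move=> /size1_polyC eG; move: mG2 G2x; rewrite eG hornerC monicE lead_coefC => /eqP->.
  by rewrite rmorph1 /= => /eqP; rewrite oner_eq0.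
have PG' : P G2^`().
  by move=> i; rewrite coef_deriv -mulr_natr; apply: (subringM sT) => //; apply: (subring_nat sT).
(* Separability: the derivative has smaller degree than the minimal G2, and it is nonzero because
   its leading coefficient is a positive integer. *)
have d2 : (rho G2^`().[x]).2 <> 0.
  have sG' : (size G2^`() < n)%N by rewrite -sG2 lt_size_deriv // monic_neq0.
  move=> /(minP _ PG') => /(_ sG') /(congr1 (fun H : {poly T} => rho H`_n.-2)).
  rewrite coef_deriv coef0 prednK; last by rewrite -ltnS prednK // ltnW.
  rewrite -sG1 lead2 sG1 rmorph0 rmorph_nat pair_nat => /(congr1 snd) /=.
  by move: n1; case: (n) => [|[|m]] // _ /char0.
have [d' [hd' d'd]] := funit _ (hP _ _ hx1 PG') d2.
pose t := - (d' * rho G2.[x]).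
have t2 : t.2 = 0 by rewrite /= G2x mulr0 oppr0.
have ht : fprod pi u t by apply: (subringN sF); apply: (subringM sF) => //; apply: hP.
have tt : tau t * tau t = 0.
  rewrite -rmorphM (_ : t * t = 0) ?rmorph0 //.
  move: ht t2; case: (t) => a b; rewrite /fprod /= => + b0; rewrite b0 rmorph0 => pa.
  by change ((a * a, 0 * 0) = (0, 0) :> C * F); rewrite mulr0 pis.2.
pose x' := x + tau t.
have x'E : rho x' = (c, e) + t by rewrite rmorphD !tauK.
have hx' : fprod pi u (rho x') by rewrite x'E; apply: (subringD sF).
have Gx' : G2.[x'] = 0.
  rewrite taylor_sqz // rmorphN rmorphM rhoK mulrN mulrA -[X in X * _]rhoK.
  by rewrite rmorphM tauK [_ * d']mulrC d'd rmorph1 mul1r subrr.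
apply: (noSp (rho x')); first by rewrite x'E -[(_ + _).2]/(e + t.2) t2 addr0.
exists (ev x'); last by split; [apply: evM|apply: evx].
split; first exact: ev_ring.
  by move=> _ [H hH ->]; apply: hP.
move=> _ [H hH ->] h0.
have [q [r [Pq Pr eH sr]]] := polyG_div sT PG2 mG2 hH.
have r0 : r = 0.
  apply: minP => //; last by rewrite -sG2.
  have : (rho H.[x]).2 = 0.
    move: h0; rewrite taylor_sqz // rmorphD rmorphM tauK.
    by rewrite -[(_ + _).2]/((rho H.[x]).2 + _ * t.2) t2 mulr0 addr0.
  by rewrite eH hornerD hornerM rmorphD rmorphM /= G2x mulr0 add0r.
by rewrite eH r0 addr0 hornerM Gx' mulr0 rmorph0.
Qed.

End LiftChar0.

(** * Dual numbers and Witt vectors of length two *)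

(** C is an algebra over the prime field of characteristic q. For q = 0 the positive integers must
    be invertible, not merely nonzero. *)
Definition has_char (q : nat) (C : comPzRingType) :=
  if q == 0%N then forall n, exists c : C, c * n.+1%:R = 1
  else prime q /\ (q%:R : C) = 0.

Lemma has_char_rmorph q (A B : comPzRingType) (f : {rmorphism A -> B}) :
  has_char q A -> has_char q B.
Proof.
rewrite /has_char; case: eqP => _ => [h n|[pr q0]].
  by have [c e] := h n; exists (f c); rewrite -(rmorph_nat f) -rmorphM e rmorph1.
by split=> //; rewrite -(rmorph_nat f) q0 rmorph0.
Qed.

(** Invertibility of integers lifts along square-zero extensions, whereas q = 0 for a prime q does
    not; hence Witt vectors occur only for prime q. *)
Lemma has_char_sqz q (C D : comPzRingType) (pi : {rmorphism C -> D}) :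
  sqz_surj pi -> q = 0%N -> has_char q D -> has_char q C.
Proof.
move=> pis ->; rewrite /has_char /= => h n; have [d e] := h n.
by apply: (sqz_unit pis (d := d)); rewrite rmorph_nat.
Qed.

Lemma field_char (k : comPzRingType) : isfield k -> exists q, has_char q k.
Proof.
move=> fk; have [F [i [j [ij ji]]]] := field_pack fk.
have [[p cp]|np] := pselect (exists p, p \in [pchar F]).
  exists p; rewrite /has_char gtn_eqF ?prime_gt0 ?(pcharf_prime cp) //; split=> //.
  by rewrite -(rmorph_nat j) (pcharf0 cp) rmorph0.
exists 0%N => n; apply: fk.2 => n0.
have : (n.+1%:R : F) == 0 by rewrite -(rmorph_nat i) n0 rmorph0.
elim/ltn_ind: n {n0} => n IH n0; apply: np.
have [|p cp] := natf0_pchar _ n0; first by [].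
by exists p.
Qed.

Lemma lift_field (k C D : comPzRingType) (pi : {rmorphism C -> D})
    (u : {rmorphism k -> D}) q :
  isfield k -> has_char q k -> has_char q C -> sqz_surj pi ->
  exists v : {rmorphism k -> C}, forall e, pi (v e) = u e.
Proof.
move=> fk qk qC pis; have [F [i [j [ij ji]]]] := field_pack fk.
suff [v ve] : exists v : {rmorphism F -> C}, forall e, pi (v e) = (u \o j) e.
  by exists (v \o i) => e; rewrite [LHS]ve /= ij.
have qF := has_char_rmorph i qk.
move: qC qF; rewrite /has_char; case: eqP => [q0 _ qF|_ [pr qC] [_ qF]].
  apply: lift_char0 => // n n0; have [c] := qF n.
  by rewrite n0 mulr0 => /eqP; rewrite eq_sym oner_eq0.
apply: (@lift_charp _ _ _ pi (u \o j) pis F idfun q).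
- by rewrite inE pr qF eqxx.
- by move=> f; exists f.
- by move=> e /= ->; exists 0; rewrite mulr0.
- by move=> e c _ _; rewrite qC mul0r.
Qed.

(** [tw_q] is a symmetric 2-cocycle that deforms the addition of K * K, and [tw_th] is the action of
    K on the kernel; [tw_qM] gives distributivity. *)
Record twist (K : comPzRingType) := Twist {
  tw_th : {rmorphism K -> K};
  tw_q : K -> K -> K;
  tw_qC : forall a b, tw_q a b = tw_q b a;
  tw_qA : forall a b c, tw_q b c + tw_q a (b + c) = tw_q a b + tw_q (a + b) c;
  tw_q0 : forall a, tw_q 0 a = 0;
  tw_qM : forall a b c, tw_q (a * c) (b * c) = tw_th c * tw_q a b }.

(* An extension of the ring K by the K-module K, on which K acts through th;
   with th = id and q = 0 these are the dual numbers, and with th = Frobenius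
   and q the Witt cocycle the Witt vectors of length 2. *)
Definition twring (K : comPzRingType) (w : twist K) : Type := (K * K)%type.

Section TwistRing.
Variables (K : comPzRingType) (w : twist K).

Local Notation tw := (twring w).
HB.instance Definition _ := Choice.on tw.
Implicit Types x y z : tw.

Definition twadd x y : tw := (x.1 + y.1, x.2 + y.2 + tw_q w x.1 y.1).
Definition twopp x : tw := (- x.1, - x.2 - tw_q w (- x.1) x.1).
Definition twmul x y : tw :=
  (x.1 * y.1, tw_th w x.1 * y.2 + tw_th w y.1 * x.2).

Lemma twaddA : associative twadd.
Proof.
move=> [a a'] [b b'] [c c']; congr pair => /=; first by rewrite addrA.
transitivity (a' + b' + c' + (tw_q w b c + tw_q w a (b + c))); first ring.
by rewrite tw_qA; ring.
Qed.
Lemma twaddC : commutative twadd.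
Proof.
move=> [a a'] [b b']; congr pair => /=; first by rewrite addrC.
by rewrite tw_qC [a' + b']addrC.
Qed.
Lemma twadd0 : left_id (0, 0) twadd.
Proof. by move=> [a a']; rewrite /twadd /= tw_q0 !add0r addr0. Qed.
Lemma twaddN : left_inverse (0, 0) twopp twadd.
Proof.
by move=> [a a']; congr pair => /=; [rewrite addNr|rewrite addrAC subrK addNr].
Qed.
HB.instance Definition _ := GRing.isZmodule.Build tw twaddA twaddC twadd0 twaddN.

Lemma twmulA : associative twmul.
Proof.
move=> [a a'] [b b'] [c c']; congr pair => /=; first by rewrite mulrA.
by rewrite !rmorphM; ring.
Qed.
Lemma twmulC : commutative twmul.
Proof. by move=> [a a'] [b b']; congr pair => /=; rewrite ?[a * _]mulrC // addrC. Qed.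
Lemma twmul1 : left_id (1, 0) twmul.
Proof. by move=> [a a']; rewrite /twmul /= rmorph1 !mul1r mulr0 addr0. Qed.
Lemma twmulDl : left_distributive twmul +%R.
Proof.
move=> [a a'] [b b'] [c c']; congr pair => /=; first by rewrite mulrDl.
by rewrite tw_qM rmorphD; ring.
Qed.
HB.instance Definition _ :=
  GRing.Zmodule_isComPzRing.Build tw twmulA twmulC twmul1 twmulDl.

Lemma twaddE x y : x + y = (x.1 + y.1, x.2 + y.2 + tw_q w x.1 y.1) :> tw.
Proof. by []. Qed.
Lemma twmulE x y : x * y = (x.1 * y.1, tw_th w x.1 * y.2 + tw_th w y.1 * x.2) :> tw.
Proof. by []. Qed.

Lemma twring_fst : exists pi : {rmorphism tw -> K},
  (forall x, pi x = x.1) /\ sqz_surj pi.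
Proof.
have [|||pi pie] := @rmorph_ex tw K (fun x => x.1) => //.
exists pi; split=> //; split=> [d|x y]; first by exists (d, 0); rewrite pie.
by rewrite !pie => x0 y0; rewrite twmulE x0 y0 mulr0 rmorph0 !mul0r addr0.
Qed.

End TwistRing.

Lemma dual_twist (K : comPzRingType) : exists w : twist K,
  (forall a, tw_th w a = a) /\ (forall a b, tw_q w a b = 0).
Proof.
pose Q (a b : K) : K := 0.
have QA a b c : Q b c + Q a (b + c) = Q a b + Q (a + b) c by [].
have QM a b c : Q (a * c) (b * c) = idfun c * Q a b by rewrite mulr0.
by exists (@Twist K idfun Q (fun _ _ => erefl) QA (fun _ => erefl) QM).
Qed.

Section Witt.
Variable p : nat.
Hypothesis pr : prime p.

(** This is ((a + b)^p - a^p - b^p) / p, with the division carried out in the binomial coefficients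
    so that it makes sense in characteristic p. *)
Definition wittq (T : pzSemiRingType) (a b : T) : T :=
  \sum_(1 <= i < p) a ^+ (p - i) * b ^+ i *+ ('C(p, i) %/ p).

Lemma wittqE (T : comPzRingType) (a b : T) :
  p%:R * wittq a b = (a + b) ^+ p - a ^+ p - b ^+ p.
Proof.
have p_gt0 := prime_gt0 pr.
rewrite exprDn -(big_mkord xpredT (fun i => a ^+ (p - i) * b ^+ i *+ 'C(p, i))).
rewrite big_ltn // big_nat_recr //= subn0 expr0 mulr1 bin0 subnn expr0 mul1r binn !mulr1n.
rewrite [a ^+ p + _]addrC !addrK mulr_sumr; apply: eq_big_nat => i /andP[i0 ip].
by rewrite mulr_natl -mulrnA divnK // prime_dvd_bin // i0.
Qed.

Lemma rmorph_wittq (S T : comPzRingType) (f : {rmorphism S -> T}) a b :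
  f (wittq a b) = wittq (f a) (f b).
Proof.
rewrite rmorph_sum; apply: eq_bigr => i _.
by rewrite rmorphMn rmorphM !rmorphXn.
Qed.

Lemma wittqA_p (T : comPzRingType) (a b c : T) :
  p%:R * (wittq b c + wittq a (b + c)) = p%:R * (wittq a b + wittq (a + b) c).
Proof. by rewrite !mulrDr !wittqE [a + (b + c)]addrA; ring. Qed.

Lemma poly_eval (S : comNzRingType) (T : comNzRingType) (f : {rmorphism S -> T}) (a : T) :
  exists g : {rmorphism {poly S} -> T}, g 'X = a /\ forall c, g c%:P = f c.
Proof.
have cfa : commr_rmorph f a by move=> x; apply: mulrC.
by exists (horner_morph cfa); split=> [|c]; [exact: horner_morphX|exact: horner_morphC].
Qed.

(** The identity holds after multiplication by p; it is cancelled in Z[X, Y, Z], where p is not a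
    zero divisor, and then specialized. *)
Lemma wittqA (T : comNzRingType) (a b c : T) :
  wittq b c + wittq a (b + c) = wittq a b + wittq (a + b) c.
Proof.
have [f [fX _]] := poly_eval (intmul (1 : T) : {rmorphism int -> T}) a.
have [g [gX gC]] := poly_eval f b; have [h [hX hC]] := poly_eval g c.
pose X : {poly {poly {poly int}}} := 'X%:P%:P.
pose Y : {poly {poly {poly int}}} := 'X%:P.
pose Z : {poly {poly {poly int}}} := 'X.
have [hXX hYY] : h X = a /\ h Y = b by rewrite !hC gC.
suff : wittq Y Z + wittq X (Y + Z) = wittq X Y + wittq (X + Y) Z.
  by move=> /(congr1 h); rewrite !rmorphD /= !rmorph_wittq !rmorphD /= hX hXX hYY.
have p0 : (p%:R : {poly {poly {poly int}}}) != 0.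
  rewrite -(rmorph_nat polyC) polyC_eq0 -(rmorph_nat polyC) polyC_eq0.
  by rewrite -(rmorph_nat polyC) polyC_eq0 Num.Theory.pnatr_eq0 -lt0n prime_gt0.
by apply: (mulfI p0); apply: wittqA_p.
Qed.

Lemma witt_twist (K : fieldType) : p \in [pchar K] -> exists w : twist K,
  (forall a, tw_th w a = a ^+ p) /\ (p%:R : twring w) = (0, 1).
Proof.
move=> cp.
have [|||th the] := @rmorph_ex K K (fun x => x ^+ p).
- exact: expr1n.
- by move=> x y; rewrite -!(pFrobenius_autE cp) rmorphD.
- by move=> x y; rewrite exprMn.
pose Q (a b : K) := - wittq a b.
have QC a b : Q a b = Q b a.
  rewrite /Q /wittq; congr (- _); rewrite big_nat_rev /=; apply: eq_big_nat => i /andP[i0 ip].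
  rewrite add1n subSS.
  have ip' := ltnW ip; rewrite (subKn ip') (bin_sub ip') mulrC; exact: erefl.
have QA a b c : Q b c + Q a (b + c) = Q a b + Q (a + b) c.
  by rewrite /Q -!opprD wittqA.
have Q0 a : Q 0 a = 0.
  rewrite /Q /wittq big_nat_cond big1 ?oppr0 // => i /andP[/andP[i0 ip] _].
  by rewrite expr0n subn_eq0 leqNgt ip /= mul0r mul0rn.
have QM a b c : Q (a * c) (b * c) = th c * Q a b.
  rewrite /Q /wittq mulrN mulr_sumr; congr (- _); apply: eq_big_nat => i /andP[i0 ip].
  rewrite the mulrnAr; congr (_ *+ _); rewrite !exprMn mulrACA -exprD subnK; last exact: ltnW.
  by rewrite mulrC.
exists (Twist QC QA Q0 QM); split; first exact: the.
set w := Twist _ _ _ _.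
(* The integer n has Witt coordinates (n, z) with ghost component n^p + p z = n. For n = p this
   gives z = 1 - p^(p-1), which is 1 in K. *)
have natE n : exists z : int, p%:R * z = n%:R - n%:R ^+ p /\ (n%:R : twring w) = (n%:R, z%:~R).
  elim: n => [|n [z [ez en]]].
    by exists 0; rewrite expr0n gtn_eqF ?prime_gt0 // subr0 mulr0.
  exists (z - wittq n%:R 1); split.
    by rewrite mulrBr wittqE ez expr1n -natr1; ring.
  rewrite -natr1 en twaddE /= natr1 addr0; congr pair.
  rewrite rmorphB /= /Q; congr (_ - _).
  have := rmorph_wittq (intmul (1 : K) : {rmorphism int -> K}) n%:R 1.
  by rewrite /= rmorph1 rmorph_nat => ->.
have [z [ez ->]] := natE p.
have -> : z = 1 - p%:R ^+ p.-1.
  apply: (@mulfI _ (p%:R : int)); first by rewrite Num.Theory.pnatr_eq0 -lt0n prime_gt0.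
  by rewrite ez mulrBr mulr1 -exprS prednK ?prime_gt0.
rewrite (pcharf0 cp) rmorphB rmorph1 rmorphXn /= rmorph_nat (pcharf0 cp).
by rewrite expr0n -subn1 subn_eq0 leqNgt prime_gt1 // subr0.
Qed.

End Witt.

(** * Injectivity on cotangent spaces *)

Section Preimages.
Variables (A B : comPzRingType) (f : {rmorphism A -> B}).

Lemma preim_subproof (I : ideal B) : ideal_axiom (f @^-1` I).
Proof.
split=> [|x y hx hy|a x hx] /=; first by rewrite rmorph0; apply: ideal0.
  by rewrite rmorphD; apply: idealD.
by rewrite rmorphM; apply: idealMl.
Qed.

Definition preim (I : ideal B) : ideal A := Ideal (preim_subproof I).

Lemma kerid_subproof : ideal_axiom [set x | f x = 0].
Proof.
split=> [|x y hx hy|a x hx] /=; first exact: rmorph0.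
  by rewrite rmorphD hx hy addr0.
by rewrite rmorphM hx mulr0.
Qed.

Definition kerid : ideal A := Ideal kerid_subproof.

End Preimages.

(** The quotient by N is replaced by an arbitrary square-zero surjection, so that truncations and
    twisted rings can be used directly. *)
Definition fsmooth (R A : comPzRingType) (m : ideal A) (f : {rmorphism R -> A}) :=
  forall (C D : comPzRingType) (pi : {rmorphism C -> D}) (g : {rmorphism R -> C})
    (u : {rmorphism A -> D}), sqz_surj pi -> (forall r, pi (g r) = u (f r)) ->
  (exists j, forall t, idealX m j t -> u t = 0) ->
  exists v : {rmorphism A -> C}, (forall r, v (f r) = g r) /\ (forall t, pi (v t) = u t).

Lemma formally_smoothW (R : comPzRingType) (A : localRingType) (f : {rmorphism R -> A}) :
  formally_smooth f -> fsmooth (@maxideal A) f.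
Proof.
move=> fs C D pi g u [piS pi0] gu uj.
pose N := kerid pi; have [s sK] := choice piS.
have Neq x y : pi x = pi y -> qproj N x = qproj N y.
  by move=> e; apply/qring_eqP; rewrite /N /= rmorphB e subrr.
have [|||u' u'E] := @rmorph_ex A (qring N) (fun a => qproj N (s (u a))).
- by rewrite -(rmorph1 (qproj N)); apply: Neq; rewrite sK !rmorph1.
- by move=> x y; rewrite -rmorphD; apply: Neq; rewrite rmorphD !sK rmorphD.
- by move=> x y; rewrite -rmorphM; apply: Neq; rewrite rmorphM !sK rmorphM.
have [|||v [vf vu]] := fs C g N _ u'.
- move=> x; rewrite -/(idealX N 2) => x2.
  apply: izeroP; move: x x2; apply: idealM_min => x y Nx /idealX_1 Ny.
  by rewrite pi0 //; apply: ideal0.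
- by move=> r; rewrite u'E; apply: Neq; rewrite sK -gu.
- have [j hj] := uj; exists j => t /hj ut; rewrite u'E ut -(rmorph0 (qproj N)).
  by apply: Neq; rewrite sK rmorph0.
exists v; split=> // t; have := vu t; rewrite u'E => /qring_eqP.
by rewrite /N /= rmorphB sK => /eqP; rewrite subr_eq0 => /eqP.
Qed.

Lemma qring_isfield (A : comPzRingType) (m : ideal A) : islocal m -> isfield (qring m).
Proof.
move=> lm; split.
  by rewrite -(rmorph1 (qproj m)) => /qproj_eq0; apply: islocal1.
elim/qprojW=> x nx; have [|y yx] := islocal_unit lm (x := x).
  by move=> mx; apply/nx/qproj_eq0.
by exists (qproj m y); rewrite -rmorphM yx rmorph1.
Qed.

Lemma idealM_map (R A : comPzRingType) (f : {rmorphism R -> A}) (I J : ideal R) (I' J' : ideal A) :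
  (forall x, I x -> I' (f x)) -> (forall x, J x -> J' (f x)) ->
  forall x, idealM I J x -> idealM I' J' (f x).
Proof.
move=> II JJ; apply: (@idealM_min _ I J (preim f (idealM I' J'))) => x y /II Ix /JJ Jy.
by rewrite /= rmorphM; apply: mem_idealM.
Qed.

(* x_1, ..., x_e is a basis of m / (m^2 + J). *)
Definition cobasis (A : comPzRingType) (m J : ideal A) e (x : 'I_e -> A) :=
  [/\ forall i, m (x i),
   forall y, m y -> exists c : 'I_e -> A, isum (idealM m m) J (y - \sum_i c i * x i) &
   forall c : 'I_e -> A, isum (idealM m m) J (\sum_i c i * x i) -> forall i, m (c i)].

Section CotangentInjective.
Variables (R A : comPzRingType) (mR : ideal R) (mA : ideal A) (f : {rmorphism R -> A}).
Hypothesis lR : islocal mR.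
Hypothesis lA : islocal mA.
Hypothesis fm : forall r, mR r -> mA (f r).
Variables (d : nat) (r : 'I_d -> R).
Hypothesis rb : cobasis mR (izero R) r.

Lemma cb_m i : mR (r i). Proof. by case: rb. Qed.

Lemma isum0 (I : ideal R) x : isum I (izero R) x <-> I x.
Proof.
split; last exact: isum_subl.
by move=> [y [z [Iy /izeroP-> ->]]]; rewrite addr0.
Qed.

Lemma cb_span y : mR y -> exists c : 'I_d -> R, idealM mR mR (y - \sum_i c i * r i).
Proof. by case: rb => _ h _ /h[c /isum0]; exists c. Qed.

Lemma cb_indep (c : 'I_d -> R) : idealM mR mR (\sum_i c i * r i) -> forall i, mR (c i).
Proof. by case: rb => _ _ h c2; apply/h/isum_subl. Qed.

Variable i : 'I_d.

Lemma omit_subproof : ideal_axiom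
  [set x | exists c : 'I_d -> R, c i = 0 /\ idealM mR mR (x - \sum_j c j * r j)].
Proof.
split=> [|x y [c [ci hc]] [c' [ci' hc']]|a x [c [ci hc]]].
- exists (fun=> 0); split=> //; rewrite big1 ?subrr; first exact: ideal0.
  by move=> j _; rewrite mul0r.
- exists (fun j => c j + c' j); rewrite ci ci' addr0; split=> //.
  rewrite (eq_bigr (fun j => c j * r j + c' j * r j)); last by move=> j _; rewrite mulrDl.
  by rewrite big_split opprD addrACA; apply: idealD.
- exists (fun j => a * c j); rewrite ci mulr0; split=> //.
  rewrite (eq_bigr (fun j => a * (c j * r j))); last by move=> j _; rewrite mulrA.
  by rewrite -mulr_sumr -mulrBr; apply: idealMl.
Qed.

(** Generated by mR^2 and the r_j with j != i: mR / omit is a line over the residue field, spanned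
    by r_i. *)
Definition omit : ideal R := Ideal omit_subproof.

Lemma omit_m2 : idealM mR mR `<=` omit.
Proof.
move=> x hx; exists (fun=> 0); split=> //; rewrite big1 ?subr0 //.
by move=> j _; rewrite mul0r.
Qed.

Lemma omit_sub : omit `<=` mR.
Proof.
move=> x [c [_ /idealMSr h]]; rewrite -(subrK (\sum_j c j * r j) x); apply: idealD => //.
by apply: ideal_sum => j _; apply/idealMl/cb_m.
Qed.

Lemma omit_other j : j != i -> omit (r j).
Proof.
move=> ji; exists (fun l => (l == j)%:R); rewrite eq_sym (negbTE ji); split=> //.
rewrite (_ : \sum_l _ = r j); first by rewrite subrr; apply: ideal0.
rewrite (bigD1 j) //= eqxx mul1r big1 ?addr0 // => l /negbTE->; by rewrite mul0r.
Qed.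

Lemma omit_coef c : omit (c * r i) -> mR c.
Proof.
move=> [c' [ci' h]]; pose b j := (if j == i then c else 0) - c' j.
have : mR (b i).
  apply: cb_indep; rewrite (_ : \sum_j _ = c * r i - \sum_j c' j * r j) //.
  rewrite (eq_bigr (fun j => (if j == i then c else 0) * r j - c' j * r j)); last first.
    by move=> j _; rewrite mulrBl.
  rewrite sumrB; congr (_ - _); rewrite (bigD1 i) //= eqxx big1 ?addr0 //.
  by move=> j /negbTE->; rewrite mul0r.
by rewrite /b eqxx ci' subr0.
Qed.

Lemma omit_mul c : mR c -> omit (c * r i).
Proof. by move=> mc; apply: omit_m2; apply: mem_idealM => //; apply: cb_m. Qed.

Lemma omit_span x : mR x -> exists c, omit (x - c * r i).
Proof.
move=> /cb_span[c hc]; exists (c i), (fun j => if j == i then 0 else c j); rewrite eqxx.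
split=> //; rewrite (_ : _ - _ = x - \sum_j c j * r j) //.
rewrite -addrA -opprD; congr (_ - _); rewrite [RHS](bigD1 i) //=; congr (_ + _).
rewrite (bigD1 i) //= eqxx mul0r add0r; apply: eq_bigr => j /negbTE->; by [].
Qed.

Lemma residue_sqz : exists pi : {rmorphism qring omit -> qring mR},
  (forall x, pi (qproj omit x) = qproj mR x) /\ sqz_surj pi.
Proof.
apply: qproj_sqz; first exact: omit_sub.
by move=> x y mx my; apply/omit_m2/mem_idealM.
Qed.

(** The residue field has a section sg into R / omit, where x is then sg x + lam x * r_i. This
    coefficient is a derivation into the residue field; it takes values in R but matters only modulo
    mR. *)
Lemma dual_coord q : has_char q (qring mR) -> has_char q (qring omit) ->
  exists lam : R -> R, [/\ forall x y, mR (lam (x + y) - (lam x + lam y)),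
    forall x y, mR (lam (x * y) - (x * lam y + y * lam x)) &
    forall x c, mR x -> omit (x - c * r i) -> mR (lam x - c)].
Proof.
move=> qk qE; have [qpi [qpiE qpis]] := residue_sqz.
have [sg sgE] := lift_field idfun (qring_isfield lR) qk qE qpis.
have /choice[lam lamE] x : exists c,
    qproj omit x = sg (qproj mR x) + qproj omit (c * r i).
  have := sgE (qproj mR x); move: (sg _); elim/qprojW=> y; rewrite qpiE => /qring_eqP /= myx.
  have [c hc] : exists c, omit ((x - y) - c * r i).
    by apply: omit_span; apply: idealBC.
  exists c; rewrite -rmorphD; apply/qring_eqP; move: hc; congr (omit _); ring.
have sgm x : exists y, sg (qproj mR x) = qproj omit y /\ mR (y - x).
  have := sgE (qproj mR x); move: (sg _); elim/qprojW=> y; rewrite qpiE => /qring_eqP /= myx.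
  by exists y.
have uniq b c : qproj omit (b * r i) = qproj omit (c * r i) -> mR (b - c).
  by move=> /qring_eqP; rewrite -mulrBl => /omit_coef.
exists lam; split=> [x y|x y|x c mx h]; apply: uniq.
- apply: (@addrI _ (sg (qproj mR (x + y)))).
  by rewrite -lamE !rmorphD /= (lamE x) (lamE y) mulrDl rmorphD addrACA.
- apply: (@addrI _ (sg (qproj mR (x * y)))); rewrite -lamE.
  have -> : sg (qproj mR (x * y)) = sg (qproj mR x) * sg (qproj mR y) by rewrite -!rmorphM.
  rewrite rmorphM /= (lamE x) (lamE y).
  have [x' [-> mx]] := sgm x; have [y' [-> my]] := sgm y.
  transitivity (qproj omit ((x' + lam x * r i) * (y' + lam y * r i))).
    by rewrite [RHS]rmorphM /= !rmorphD.
  transitivity (qproj omit (x' * y' + (x * lam y + y * lam x) * r i)); last first.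
    by rewrite [LHS]rmorphD /= [in LHS]rmorphM.
  apply/qring_eqP.
  rewrite (_ : _ - _ = (x' - x) * lam y * r i + (y' - y) * lam x * r i +
    (lam x * lam y * r i) * r i); last by ring.
  apply: idealD; first by apply: idealD; apply: omit_mul; apply: idealMr.
  by apply: omit_mul; apply: idealMl; apply: cb_m.
- apply: (@addrI _ (sg (qproj mR x))); rewrite -lamE.
  by rewrite (_ : qproj mR x = 0) ?rmorph0 ?add0r; [apply/qring_eqP|apply/qproj_eq0].
Qed.

(* The R-algebra on which the i-th dual coordinate of mR/mR^2 is visible over
   the residue field of A. *)
Lemma detect_coordinate (F : fieldType) (kap : {rmorphism A -> F}) :
  (forall a, kap a = 0 <-> mA a) ->
  exists (w : twist F) (g : {rmorphism R -> twring w}),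
  [/\ forall x, (g x).1 = kap (f x), forall j, j != i -> g (r j) = 0 & (g (r i)).2 != 0].
Proof.
move=> kapE; have [q qk] := field_char (qring_isfield lR).
have kf x : mR x -> kap (f x) = 0 by move=> mx; apply/kapE/fm.
have [qpi [qpiE qpis]] := residue_sqz.
have kfeq x y : mR (x - y) -> kap (f x) = kap (f y).
  by move=> /kf; rewrite !rmorphB => /eqP; rewrite subr_eq0 => /eqP.
have [qE|nqE] := pselect (has_char q (qring omit)).
  have [lam [lamD lamM lam0]] := dual_coord qk qE.
  have [w [wth wq]] := dual_twist F.
  have [|||g gE] := @rmorph_ex R (twring w) (fun x => (kap (f x), kap (f (lam x)))).
  - congr pair; first by rewrite !rmorph1.
    have := lamM 1 1; rewrite mulr1 !mul1r opprD addrA subrr add0r => /idealN.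
    by rewrite opprK; apply: kf.
  - move=> x y; rewrite twaddE /= wq addr0 !rmorphD; congr pair.
    by rewrite (kfeq _ _ (lamD x y)) !rmorphD.
  - move=> x y; rewrite twmulE /= !wth !rmorphM; congr pair.
    by rewrite (kfeq _ _ (lamM x y)) !rmorphD !rmorphM.
  exists w, g; split=> [x|j ji|]; rewrite gE //.
    congr pair; first exact/kf/cb_m.
    rewrite -[lam _]subr0; apply/kf/lam0; first exact: cb_m.
    by rewrite mul0r subr0; apply: omit_other.
  rewrite /= (kfeq _ 1) ?rmorph1 ?oner_eq0 //; apply: lam0; first exact: cb_m.
  by rewrite mul1r subrr; apply: ideal0.
(* From here on q is a prime that is nonzero in R / omit, hence a unit times r_i there: the maximal
   ideal of R / omit is generated by q, as [lift_charp] requires. *)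
have q0 : q <> 0%N by move=> q0; apply: nqE; apply: has_char_sqz qpis q0 qk.
move: qk nqE; rewrite /has_char; case: eqP => // _ [pr qk0] nqE.
have mq : mR q%:R by apply/qproj_eq0; rewrite rmorph_nat.
have [c hc] := omit_span mq.
have nmc : ~ mR c.
  move=> mc; apply: nqE; split=> //; rewrite -(rmorph_nat (qproj omit)); apply/qproj_eq0.
  by rewrite -(subrK (c * r i) q%:R); apply: idealD => //; apply: omit_mul.
have qc : qproj omit q%:R = qproj omit (c * r i) by apply/qring_eqP.
have qn : (q%:R : qring omit) = qproj omit (c * r i) by rewrite -qc rmorph_nat.
have [c' cc] := islocal_unit lR nmc.
have cqF : q \in [pchar F].
  by rewrite inE pr -(rmorph_nat kap) -(rmorph_nat f) kf ?eqxx.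
have [w [wth wp]] := witt_twist pr cqF.
have [wpi [wpiE wpis]] := twring_fst w.
have uh x : omit x -> (kap \o f) x = 0 by move=> /omit_sub; apply: kf.
have luE x : qlift uh (qproj omit x) = kap (f x) := qliftE uh x.
have [k [ki [kj [kij kji]]]] := field_pack (qring_isfield lR).
have [] := @lift_charp _ _ _ wpi (qlift uh) wpis k (ki \o qpi) q.
- have e0 : qproj mR q%:R = 0 by apply/qproj_eq0.
  by rewrite inE pr -(rmorph_nat (ki \o qproj mR)) /= e0 rmorph0 eqxx.
- by move=> y; rewrite -[y]kji; elim/qprojW: (kj y) => x; exists (qproj omit x); rewrite /= qpiE.
- elim/qprojW=> x /= /(congr1 kj); rewrite kij rmorph0 qpiE => /qproj_eq0 /omit_span[b hb].
  exists (qproj omit (b * c')); rewrite qn -rmorphM.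
  apply/qring_eqP; rewrite (_ : c * r i * _ = c' * c * (b * r i)); last by ring.
  by rewrite cc mul1r.
(* If q x = 0 in R / omit then x lies in mR, so z has first component 0 and is killed by q = (0,
   1). *)
- elim/qprojW=> x z; rewrite /fprod /= wpiE => zx0; have zx := etrans zx0 (luE x).
  rewrite qn -rmorphM => /qproj_eq0.
  rewrite mulrAC => /omit_coef; rewrite mulrC.
  move=> /(@primeM _ (PrimeIdeal (islocal_prime lR)) x c)[mx|/nmc//].
  by rewrite wp twmulE zx (kf _ mx) /= !rmorph0 !mul0r addr0.
move=> v vE; exists w, (v \o qproj omit).
have vx x : (v (qproj omit x)).1 = kap (f x) by rewrite -wpiE vE; apply: luE.
split=> [x|j ji|] //=.
  by rewrite (_ : qproj _ _ = 0) ?rmorph0 //; apply/qproj_eq0/omit_other.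
apply/eqP => e; have := congr1 v qc; rewrite rmorph_nat rmorph_nat wp rmorphM rmorphM.
rewrite [v (qproj omit (r i))]surjective_pairing e vx kf; last exact: cb_m.
by rewrite mulr0 => /(congr1 snd) /= /eqP; rewrite oner_eq0.
Qed.

Lemma cotangent_inj_at (a : 'I_d -> A) : fsmooth mA f ->
  idealM mA mA (\sum_j a j * f (r j)) -> mA (a i).
Proof.
move=> fs am; have [F [ki [kj [kij kji]]]] := field_pack (qring_isfield lA).
have kapE x : (ki \o qproj mA) x = 0 <-> mA x.
  split=> [/= /(congr1 kj)|/qproj_eq0 /= ->]; rewrite ?rmorph0 // kij.
  by move=> /qproj_eq0.
have [w [g [g1 gj gi]]] := detect_coordinate kapE; have [wpi [wpiE wpis]] := twring_fst w.
have [||v [vf vpi]] := fs _ _ wpi g (ki \o qproj mA) wpis.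
- by move=> x; rewrite wpiE g1.
- by exists 1%N => t /idealX_1/kapE.
have v1 x : (v x).1 = (ki \o qproj mA) x by rewrite -wpiE vpi.
have v2 : v (\sum_j a j * f (r j)) = 0.
  move: am; apply: (@idealM_min _ mA mA (kerid v)) => x y /kapE x0 /kapE y0 /=.
  by rewrite rmorphM; apply: wpis.2; rewrite vpi.
have := v2; rewrite (bigD1 i) //= rmorphD rmorph_sum [X in _ + X]big1 => [|j ji]; last first.
  by rewrite rmorphM vf gj // mulr0.
have gi1 : (g (r i)).1 = 0 by rewrite g1; apply/kapE/fm/cb_m.
rewrite addr0 rmorphM vf twmulE gi1 => /(congr1 snd) /=.
(* In the Witt case the residue of a_i appears here through its p-th power only; injectivity of
   [tw_th] on a field suffices. *)
rewrite rmorph0 mul0r addr0 v1 => /eqP; rewrite mulf_eq0 (negbTE gi) orbF.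
by rewrite fmorph_eq0 => /eqP/kapE.
Qed.

End CotangentInjective.

(** * Smoothness over the prime field *)

(* Satisfied by quotient maps, by localizations, and by their composites. *)
Definition near_surj (A B : comPzRingType) (f : {rmorphism A -> B}) :=
  forall y, exists x v w, w * v = 1 /\ f x = v * y.

Lemma near_surj_noetherian (A B : comPzRingType) (f : {rmorphism A -> B}) :
  near_surj f -> noetherian A -> noetherian B.
Proof.
move=> fS nA I; have [s [Is sI]] := nA (preim f I).
exists (map f s); split; last first.
  apply: gen_min => _ /mapP[x xs ->]; by apply: (sI x); apply: sub_gen.
move=> y; have [x [v [w [wv fx]]]] := fS y => Iy.
rewrite -[y]mul1r -wv -mulrA -fx; apply: idealMl.
have : preim f I x by rewrite /= fx; apply: idealMl.
move=> /Is; apply: (@gen_min _ _ (preim f (gen [set` map f s]))) => z zs.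
by apply: sub_gen; apply: map_f.
Qed.

Lemma qproj_near_surj (A : comPzRingType) (I : ideal A) : near_surj (qproj I).
Proof. by elim/qprojW=> x; exists x, 1, 1; rewrite !mul1r. Qed.

Lemma linj_near_surj (A : comPzRingType) (S : multSet A) :
  near_surj (linj : {rmorphism A -> loc S}).
Proof.
elim/lfracW=> a s; exists a, (linj (dval s)), (lfrac 1 s); split; first exact: linj_unit.
by rewrite mulrC lfracK.
Qed.

Lemma near_surj_comp (A B C : comPzRingType) (f : {rmorphism A -> B}) (g : {rmorphism B -> C}) :
  near_surj f -> near_surj g -> near_surj (g \o f).
Proof.
move=> fS gS z; have [y [v [w [wv gy]]]] := gS z; have [x [v' [w' [wv' fx]]]] := fS y.
exists x, (g v' * v), (w * g w'); split.
  rewrite (_ : _ * _ = (w * v) * (g w' * g v')); last by ring.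
  by rewrite wv mul1r -rmorphM wv' rmorph1.
by rewrite /= fx rmorphM gy mulrA.
Qed.

Lemma idealX_split (A : comPzRingType) (m : ideal A) a b :
  idealX m (a + b) `<=` idealM (idealX m a) (idealX m b).
Proof.
elim: a => [x hx|a IH].
  by rewrite -[x]mul1r; apply: mem_idealM => //; apply: idealXT.
apply: idealM_min => x y mx /IH; rewrite mulrC; move: y.
apply: (@idealM_min _ _ _ (icol (idealM (idealX m a.+1) (idealX m b)) x)) => y z hy hz /=.
by rewrite mulrC mulrA; exact: (mem_idealM (mem_idealM mx hy) hz).
Qed.

Lemma idealX_map (A B : comPzRingType) (f : {rmorphism A -> B}) (I : ideal A) (J : ideal B) n :
  (forall x, I x -> J (f x)) -> forall x, idealX I n x -> idealX J n (f x).
Proof.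
move=> IJ; elim: n => [|n IH] x; first by move=> _; apply: idealXT.
by apply: idealM_map.
Qed.

Section ImageInQuotient.
Variables (A : comPzRingType) (I : ideal A).

Lemma imgq_subproof (J : ideal A) : ideal_axiom [set y | exists2 x, J x & y = qproj I x].
Proof.
split=> [|_ _ [x Jx ->] [y Jy ->]|a _ [x Jx ->]].
- by exists 0; [apply: ideal0|rewrite rmorph0].
- by exists (x + y); [apply: idealD|rewrite rmorphD].
- by elim/qprojW: a => a; exists (a * x); [apply: idealMl|rewrite rmorphM].
Qed.

Definition imgq (J : ideal A) : ideal (qring I) := Ideal (imgq_subproof J).

Lemma imgqP (J : ideal A) x : I `<=` J -> imgq J (qproj I x) -> J x.
Proof.
move=> IJ [y Jy /qring_eqP /IJ Jxy]; by rewrite -(subrK y x); apply: idealD.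
Qed.

Lemma imgq_mem (J : ideal A) x : J x -> imgq J (qproj I x).
Proof. by exists x. Qed.

Variable m : ideal A.
Hypothesis Im : I `<=` m.
Hypothesis lm : islocal m.

Lemma imgq_islocal : islocal (imgq m).
Proof.
elim/qprojW=> x; split=> [/(imgqP Im) mx [+]|nu].
  elim/qprojW=> y; rewrite -rmorphM -(rmorph1 (qproj I)) => /qring_eqP /Im h.
  by apply: (islocal1 lm); rewrite -[1](subKr (y * x)); apply: idealB => //; apply: idealMl.
apply/imgq_mem/lm => -[y yx]; apply: nu; exists (qproj I y).
by rewrite -rmorphM yx rmorph1.
Qed.

Lemma imgq_cobasis (J : ideal A) e (x : 'I_e -> A) : J `<=>` I ->
  cobasis m J x -> cobasis (imgq m) (izero _) (fun i => qproj I (x i)).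
Proof.
move=> [JI IJ] [mx xspan xind].
have m2E y : idealM (imgq m) (imgq m) (qproj I y) <-> isum (idealM m m) J y.
  split=> [|[a [b [ha /JI hb ->]]]]; last first.
    rewrite rmorphD (_ : _ b = 0) ?addr0; last exact/qproj_eq0.
    by move: a ha; apply: idealM_map => z mz; apply: imgq_mem.
  have : idealM (imgq m) (imgq m) `<=` imgq (isum (idealM m m) J).
    apply: idealM_min => _ _ [a ma ->] [b mb ->]; exists (a * b); last by rewrite rmorphM.
    by apply/isum_subl/mem_idealM.
  by move=> h /h /imgqP; apply=> z /IJ; apply: isum_subr.
have sumE (c : 'I_e -> A) : \sum_i qproj I (c i) * qproj I (x i) = qproj I (\sum_i c i * x i).
  by rewrite rmorph_sum; apply: eq_bigr => i _; rewrite rmorphM.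
split=> [i|y|c].
- exact: imgq_mem.
- elim/qprojW: y => y /(imgqP Im) /xspan[c hc]; exists (fun i => qproj I (c i)).
  by rewrite sumE -rmorphB; apply: isum_subl; apply/m2E.
- move=> /isum0; pose d i := repr (c i).
  have cE i : c i = qproj I (d i) by rewrite /d /qproj reprK.
  rewrite (eq_bigr (fun i => qproj I (d i) * qproj I (x i))); last by move=> i _; rewrite -cE.
  by rewrite sumE => /m2E /xind h i; rewrite cE; apply/imgq_mem/h.
Qed.

End ImageInQuotient.

(** Formal smoothness over the prime field: ring maps between algebras over that field are
    automatically linear, so no structure map appears. *)
Definition abs_smooth q (A : comPzRingType) (m : ideal A) :=
  forall (C D : comPzRingType) (pi : {rmorphism C -> D}) (u : {rmorphism A -> D}),
  has_char q C -> sqz_surj pi -> (exists j, forall t, idealX m j t -> u t = 0) ->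
  exists v : {rmorphism A -> C}, forall t, pi (v t) = u t.

(** [lift_field] makes C an R-algebra through the residue field of R; the lift over R then kills the
    extension of mR. *)
Lemma fsmooth_abs_smooth (R A : comPzRingType) (mR : ideal R) (mA : ideal A)
    (f : {rmorphism R -> A}) q :
  islocal mR -> fsmooth mA f -> has_char q (qring mR) ->
  abs_smooth q (imgq (gen (f @` mR)) mA).
Proof.
move=> lR fs qk C D pi u qC pis [j uj]; set J := gen _.
have h r : mR r -> (qproj J \o f) r = 0.
  by move=> mr; apply/qproj_eq0/sub_gen; exists r.
have hE r : qlift h (qproj mR r) = qproj J (f r) := qliftE h r.
have [g gE] := lift_field (u \o qlift h) (qring_isfield lR) qk qC pis.
have [||v [vf vu]] := fs C D pi (g \o qproj mR) (u \o qproj J) pis.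
- by move=> r; rewrite [LHS]gE; exact: (congr1 u (hE r)).
- by exists j => t ht; apply: uj; apply: idealX_map ht => x mx; apply: imgq_mem.
have vJ x : J x -> v x = 0.
  apply: (@gen_min _ _ (kerid v)) => _ [r mr <-] /=; rewrite vf /=.
  by rewrite (_ : qproj mR r = 0) ?rmorph0 //; apply/qproj_eq0.
exists (qlift vJ); elim/qprojW=> x.
exact: (etrans (congr1 pi (qliftE vJ x)) (vu x)).
Qed.

(** * Hasse-Schmidt derivations, regular elements and quotients of smooth local rings *)

Section AbsolutelySmooth.
Variables (q : nat) (A : comPzRingType) (m : ideal A).
Hypothesis noethA : noetherian A.
Hypothesis lm : islocal m.
Hypothesis qA : has_char q A.
Hypothesis smA : abs_smooth q m.
Variables (e : nat) (x : 'I_e -> A).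
Hypothesis xb : cobasis m (izero A) x.
Variable i0 : 'I_e.
Let x0 := x i0.

Lemma dual_deriv : exists lam : A -> A, [/\ forall a b, m (lam (a + b) - (lam a + lam b)),
  forall a b, m (lam (a * b) - (a * lam b + b * lam a)) & m (lam x0 - 1)].
Proof.
have [|//|lam [lamD lamM lam0]] := @dual_coord A m lm e x xb i0 q.
- exact: has_char_rmorph (qproj m) qA.
- exact: has_char_rmorph (qproj _) qA.
exists lam; split=> //; apply: lam0; first exact: (cb_m xb).
by rewrite mul1r subrr; apply: ideal0.
Qed.

Section Taylor.
Variables (T : comNzRingType) (tau : {rmorphism A -> T}) (rho : {rmorphism T -> A}).
Hypothesis tauK : cancel tau rho.

Lemma coefs_subproof (K : nat -> ideal A) : (forall i l, (i <= l)%N -> K i `<=` K l) ->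
  ideal_axiom [set p : {poly T} | forall i, K i (rho p`_i)].
Proof.
move=> Kmon; split=> [i|p r hp hr i|p r hr i].
- by rewrite coef0 rmorph0; apply: ideal0.
- by rewrite coefD rmorphD; apply: idealD.
- rewrite coefM rmorph_sum; apply: ideal_sum => l _; rewrite rmorphM; apply: idealMl.
  by apply: (Kmon (i - l)%N); rewrite ?leq_subr.
Qed.

Definition trunc_coef j n i := if (i < n)%N then idealX m j else idealX m 0.
Definition first_coef j i := if i is 0 then idealX m j else
  if i is 1 then m else idealX m 0.

Lemma trunc_coef_mono j n i l : (i <= l)%N -> trunc_coef j n i `<=` trunc_coef j n l.
Proof.
rewrite /trunc_coef => il; case: (ltnP l n) => ln; first by rewrite (leq_ltn_trans il ln).
by move=> a _; apply: idealXT.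
Qed.

(** The quotient is (A/m^j)[t] / (t^n), T being a copy of A. *)
Definition trunc j n : ideal {poly T} := Ideal (coefs_subproof (@trunc_coef_mono j n)).

Lemma truncP j n p : trunc j n p <-> forall i, (i < n)%N -> idealX m j (rho p`_i).
Proof.
split=> [h i ilt|h i]; first by have := h i; rewrite /trunc_coef ilt.
by rewrite /trunc_coef; case: ltnP => [/h//|_]; apply: idealXT.
Qed.

Lemma first_coef_mono j i l : (0 < j)%N -> (i <= l)%N -> first_coef j i `<=` first_coef j l.
Proof.
move=> j0; case: i => [|[|i]]; case: l => [|[|l]] // _ a; rewrite /first_coef => h;
  try exact: h; try exact: idealXT.
exact/idealX_1/(idealX_le j0).
Qed.

(** The quotient is A/m^j + k t with k = A/m, where a derivation lam into k becomes the ring map a +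
    lam(a) t. For j > 0, m^j lies in m, as multiplication by t requires. *)
Definition first j (j0 : (0 < j)%N) : ideal {poly T} :=
  Ideal (coefs_subproof (fun i l => @first_coef_mono j i l j0)).

Lemma firstP j (j0 : (0 < j)%N) p :
  first j0 p <-> idealX m j (rho p`_0) /\ m (rho p`_1).
Proof.
split=> [h|[h0 h1] [|[|i]]] //=; first by split; [apply: (h 0%N)|apply: (h 1%N)].
exact: idealXT.
Qed.

Lemma sqz_kills (C D : comPzRingType) (pi : {rmorphism C -> D}) (u : {rmorphism A -> D})
    (v : {rmorphism A -> C}) j : sqz_surj pi -> (forall t, pi (v t) = u t) ->
  (forall t, idealX m j t -> u t = 0) -> forall t, idealX m (j + j) t -> v t = 0.
Proof.
move=> pis vu uj t /idealX_split; move: t.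
apply: (@idealM_min _ _ _ (kerid v)) => a b /uj ua /uj ub /=.
by rewrite rmorphM; apply: pis.2; rewrite vu.
Qed.

Lemma has_char_poly (I : ideal {poly T}) : has_char q (qring I).
Proof. exact: has_char_rmorph (qproj I \o polyC \o tau) qA. Qed.

(** E is a truncated Hasse-Schmidt derivation a + lam(a) t + ... modulo m^j. Smoothness first lifts
    the coefficient of t from A/m to A/m^j and then adds one power of t at a time; each lift is
    again continuous. *)
Lemma taylor_lift lam j n : (0 < j)%N ->
  (forall a b, m (lam (a + b) - (lam a + lam b))) ->
  (forall a b, m (lam (a * b) - (a * lam b + b * lam a))) ->
  exists E : {rmorphism A -> qring (trunc j n.+2)},
    (exists l, forall t, idealX m l t -> E t = 0) /\
    forall a p, E a = qproj _ p -> idealX m j (rho p`_0 - a) /\ m (rho p`_1 - lam a).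
Proof.
move=> j0 lamD lamM.
pose hp a : {poly T} := (tau a)%:P + (tau (lam a))%:P * 'X.
have hp0 a : rho (hp a)`_0 = a.
  by rewrite coefD coefC coefMX /= addr0 tauK.
have hp1 a : rho (hp a)`_1 = lam a.
  by rewrite coefD coefC coefMX /= coefC add0r tauK.
have [|||h hE] := @rmorph_ex A (qring (first j0)) (fun a => qproj _ (hp a)).
- rewrite -(rmorph1 (qproj (first j0))); apply/qring_eqP/firstP.
  rewrite !coefB !rmorphB hp0 hp1 !coef1 rmorph1 rmorph0 subrr subr0; split; first exact: ideal0.
  have := lamM 1 1; rewrite mulr1 !mul1r opprD addrA subrr add0r => /idealN.
  by rewrite opprK.
- move=> a b; rewrite -rmorphD; apply/qring_eqP/firstP.
  rewrite !coefB !rmorphB ![(hp a + hp b)`_ _]coefD !rmorphD !hp0 !hp1 subrr.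
  by split; first exact: ideal0.
- move=> a b; rewrite -rmorphM; apply/qring_eqP/firstP.
  rewrite !coefB !rmorphB !hp0 !hp1.
  rewrite !coefM !big_ord_recr !big_ord0 /= !rmorphD !rmorphM !rmorph0 !add0r !hp0 !hp1 subrr.
  by split; [apply: ideal0|move: (lamM a b); congr (m _); ring].
(* m^j disposes of the constant coefficient, and m^2 of lam, which is a derivation modulo m. *)
have hkill t : idealX m (j + 2) t -> h t = 0.
  move=> ht; rewrite hE; apply/qproj_eq0/firstP; rewrite hp0 hp1; split.
    by apply: idealX_le ht; apply: leq_addr.
  have Kid : ideal_axiom [set t | m t /\ m (lam t)].
    have lamB a b c : m (lam a - (b + c)) -> m b -> m c -> m (lam a).
      by move=> h1 mb mc; rewrite -(subrK (b + c) (lam a)); apply: idealD => //; apply: idealD.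
    split=> [|a b [ma la] [mb lb]|a b [mb lb]].
    - split; first exact: ideal0.
      have := lamD 0 0; rewrite addr0 opprD addrA subrr add0r => /idealN.
      by rewrite opprK.
    - by split; [apply: idealD|apply: lamB (lamD a b) _ _].
    - split; first exact: idealMl.
      by apply: lamB (lamM a b) _ _; [apply: idealMl|apply: idealMr].
  have : idealX m 2 t by apply: idealX_le ht; apply: leq_addl.
  move: t {ht}; suff H : idealX m 2 `<=` Ideal Kid by move=> t /H[].
  apply: idealM_min => a b ma /idealX_1 mb; split; first exact: idealMl.
  rewrite -(subrK (a * lam b + b * lam a) (lam (a * b))); apply: idealD => //.
  by apply: idealD; apply: idealMr.
elim: n => [|n [E [[l El] Ecoef]]].
  have [||pi [piE pis]] := @qproj_sqz {poly T} (trunc j 2) (first j0).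
  - move=> p /truncP hp2; apply/firstP; split; first exact: hp2.
    exact/idealX_1/(idealX_le j0)/hp2.
  - move=> p r /firstP[p0 p1] /firstP[r0 r1]; apply/truncP => -[|[|//]] _.
      by rewrite coefM big_ord1 rmorphM; apply: idealMl.
    rewrite coefM !big_ord_recr big_ord0 /= add0r rmorphD !rmorphM.
    by apply: idealD; [apply: idealMr|apply: idealMl].
  have [v vh] := smA (has_char_poly _) pis (ex_intro _ _ hkill).
  exists v; split; first by exists (j + 2 + (j + 2))%N; apply: sqz_kills pis vh hkill.
  move=> a p va; have := vh a; rewrite va piE hE => /qring_eqP/firstP.
  by rewrite !coefB !rmorphB hp0 hp1.
have [||pi [piE pis]] := @qproj_sqz {poly T} (trunc j n.+3) (trunc j n.+2).
- by move=> p /truncP h3; apply/truncP => i hi; apply: h3; apply: ltnW.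
- move=> p r /truncP hp2 /truncP hr2; apply/truncP => i hi.
  rewrite coefM rmorph_sum; apply: ideal_sum => [[a ai]] _ /=; rewrite rmorphM.
  have [an|an] := ltnP a n.+2; first exact/idealMr/hp2.
  by apply/idealMl/hr2; move: hi an ai; clear; lia.
have [v vh] := smA (has_char_poly _) pis (ex_intro _ _ El).
exists v; split; first by exists (l + l)%N; apply: sqz_kills pis vh El.
by move=> a p va; apply: Ecoef; rewrite -vh va piE.
Qed.

End Taylor.

Lemma poly_copy : exists (T : comNzRingType) (tau : {rmorphism A -> T}) (rho : {rmorphism T -> A}),
  cancel tau rho.
Proof.
have [|T [i [j [ij _]]]] := @nzring_pack A; last by exists T, i, j.
by move=> e1; apply: (islocal1 lm); rewrite e1; apply: ideal0.
Qed.

(** The coefficient of t in a lift modulo t^2 is a derivation into A/m^j, where [dual_deriv] only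
    reaches the residue field. *)
Lemma deriv_mod j : (0 < j)%N -> exists del : A -> A, [/\
  forall a b, idealX m j (del (a + b) - (del a + del b)),
  forall a b, idealX m j (del (a * b) - (a * del b + b * del a)) &
  m (del x0 - 1)].
Proof.
move=> j0; have [lam [lamD lamM lam0]] := dual_deriv; have [T [tau [rho tauK]]] := poly_copy.
have [E [_ Ec]] := taylor_lift tauK 0 j0 lamD lamM.
pose P a : {poly T} := repr (E a).
have EP a : E a = qproj _ (P a) by rewrite /P /qproj reprK.
exists (fun a => rho (P a)`_1); split=> [a b|a b|].
- have : trunc rho j 2 (P (a + b) - (P a + P b)).
    by apply/qring_eqP; rewrite rmorphD /= -!EP rmorphD.
  by move=> /truncP/(_ 1%N isT); rewrite coefB coefD rmorphB rmorphD.
- have : trunc rho j 2 (P (a * b) - P a * P b).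
    by apply/qring_eqP; rewrite rmorphM /= -!EP rmorphM.
  move=> /truncP/(_ 1%N isT).
  rewrite coefB coefM !big_ord_recr big_ord0 /= add0r rmorphB rmorphD !rmorphM => h.
  have [ha _] := Ec a _ (EP a); have [hb _] := Ec b _ (EP b).
  rewrite (_ : _ - _ = rho (P (a * b))`_1 -
    (rho (P a)`_0 * rho (P b)`_1 + rho (P a)`_1 * rho (P b)`_0) +
    ((rho (P a)`_0 - a) * rho (P b)`_1 + rho (P a)`_1 * (rho (P b)`_0 - b))); last by ring.
  by apply: idealD => //; apply: idealD; [apply: idealMr|apply: idealMl].
- have [_ h] := Ec x0 _ (EP x0).
  rewrite -(subrK (lam x0) (rho _)) -addrA; exact: idealD.
Qed.

(** The expansions of s and x0 have product 0, and that of x0 is q0 + q1 t + ... with q0 in m and q1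
    a unit. This forces s into m^j for every j, and Krull's intersection theorem applies. *)
Lemma smooth_nzd s : s * x0 = 0 -> s = 0.
Proof.
move=> sx; apply: (krull_intersection noethA lm) => j.
have [->|j0] := posnP j; first exact: idealXT.
have [lam [lamD lamM lam0]] := dual_deriv; have [T [tau [rho tauK]]] := poly_copy.
have [E [_ Ec]] := taylor_lift tauK j j0 lamD lamM.
pose P a : {poly T} := repr (E a).
have EP a : E a = qproj _ (P a) by rewrite /P /qproj reprK.
have PQ : trunc rho j j.+2 (P s * P x0).
  by apply/qproj_eq0; rewrite rmorphM /= -!EP -rmorphM sx rmorph0.
have [s0 _] := Ec s _ (EP s); have [q0 q1] := Ec x0 _ (EP x0).
have mq0 : m (rho (P x0)`_0).
  rewrite -(subrK x0 (rho _)); apply: idealD; last exact: (cb_m xb).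
  exact/idealX_1/(idealX_le j0).
have [w wq] : exists w, w * rho (P x0)`_1 = 1.
  apply: (islocal_unit lm) => mq1; apply: (islocal1 lm).
  have := idealB (idealB mq1 q1) lam0.
  by rewrite (_ : _ - _ - _ = 1) //; ring.
(* Solve coefficient l + 1 of the product for q1 times coefficient l of P s: earlier coefficients of
   P s are in m^(i+1) by the inner induction, and q0 times the next one is by the outer
   induction. *)
suff H i : (i <= j)%N -> forall l, (l + i <= j)%N -> idealX m i (rho (P s)`_l).
  by rewrite -(subKr (rho (P s)`_0) s); apply: idealB => //; apply: H.
elim: i => [_ l _|i IH ij]; first exact: idealXT.
elim/ltn_ind => l IHl li.
have h : idealX m i.+1 (rho (P s * P x0)`_l.+1).
  apply: (idealX_le ij); apply: (proj1 (truncP _ _ _ _) PQ).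
  by move: li; clear; lia.
have prodE : rho (P s * P x0)`_l.+1 = \sum_(a < l) rho ((P s)`_a * (P x0)`_(l.+1 - a)) +
    rho (P s)`_l * rho (P x0)`_1 + rho (P s)`_l.+1 * rho (P x0)`_0.
  by rewrite coefM !big_ord_recr /= subnn subSnn !rmorphD !rmorphM rmorph_sum.
rewrite prodE in h.
rewrite -[rho _]mulr1 -wq mulrCA; apply: idealMl.
have h1 : idealX m i.+1 (rho (P s)`_l.+1 * rho (P x0)`_0).
  rewrite mulrC; apply: mem_idealM => //; apply: IH; first exact: ltnW.
  by rewrite addSn -addnS.
have h2 : idealX m i.+1 (\sum_(a < l) rho ((P s)`_a * (P x0)`_(l.+1 - a))).
  apply: ideal_sum => a _; rewrite rmorphM; apply: idealMr; apply: IHl => //.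
  by apply: leq_trans li; rewrite leq_add2r ltnW.
have := idealB (idealB h h1) h2; congr (idealX m i.+1 _); ring.
Qed.

(** A lift v on A sends x0 to some n in the kernel. Subtracting n times the derivation del / del x0
    makes it vanish at x0; since n is killed by v(m^j), a derivation modulo m^j is enough. *)
Lemma smooth_quotient : abs_smooth q (imgq (gen [set x0]) m).
Proof.
move=> C D pi u qC pis [j0' uj']; set X0 := gen _.
pose j := j0'.+1.
have uj t : idealX m j t -> u (qproj X0 t) = 0.
  move=> /(idealX_le (leqnSn _)) ht; apply: uj'; apply: idealX_map ht => z mz.
  exact: imgq_mem.
have [del [delD delM del1]] := @deriv_mod j isT.
have [w wd] : exists w, w * del x0 = 1.
  apply: (islocal_unit lm) => md; apply: (islocal1 lm).
  by rewrite -[1](subKr (del x0)); apply: idealB.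
have [|v vu] := smA (pi := pi) (u := u \o qproj X0) qC pis.
  by exists j.
have n0 : pi (v x0) = 0.
  by rewrite vu /= (_ : qproj X0 x0 = 0) ?rmorph0 //; apply/qproj_eq0/sub_gen.
pose n := v x0.
have nn : n * n = 0 by apply: pis.2.
have kill t : idealX m j t -> v t * n = 0.
  by move=> /uj ut; apply: pis.2 => //; rewrite vu.
have keq a b : idealX m j (a - b) -> v (w * a) * n = v (w * b) * n.
  move=> /kill ne; apply/eqP; rewrite -subr_eq0 -mulrBl -rmorphB -mulrBr rmorphM -mulrA ne.
  by rewrite mulr0.
have [|||v' v'E] := @rmorph_ex A C (fun a => v a - v (w * del a) * n).
- rewrite rmorph1 (keq _ 0) ?mulr0 ?rmorph0 ?mul0r ?subr0 //.
  have := delM 1 1; rewrite mulr1 !mul1r opprD addrA subrr add0r => /idealN.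
  by rewrite opprK.
- by move=> a b; rewrite (keq _ _ (delD a b)) mulrDr !rmorphD; ring.
- move=> a b; rewrite (keq _ _ (delM a b)) mulrDr !(mulrCA w) rmorphD !(rmorphM v).
  transitivity (v a * v b - (v a * (v w * v (del b)) + v b * (v w * v (del a))) * n +
    (v w * v (del a)) * (v w * v (del b)) * (n * n)); last by ring.
  by rewrite nn mulr0 addr0.
have v'X t : X0 t -> v' t = 0.
  apply: (@gen_min _ _ (kerid v')) => _ -> /=.
  by rewrite v'E wd rmorph1 mul1r subrr.
exists (qlift v'X); elim/qprojW=> t.
apply: (etrans (congr1 pi (qliftE v'X t))).
by rewrite v'E rmorphB [pi (_ * n)]rmorphM [pi n]n0 mulr0 subr0 vu.
Qed.

End AbsolutelySmooth.

(** * Chains of primes in smooth local rings *)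

Lemma contract_strict (A B : comPzRingType) (f : {rmorphism A -> B}) (c c' : primeIdeal B) :
  near_surj f -> ~ c' `<=` c -> ~ contract f c' `<=` contract f c.
Proof.
move=> fS nc h; apply: nc => y c'y; have [x [v [w [wv fx]]]] := fS y.
rewrite -[y]mul1r -wv -mulrA -fx; apply: idealMl; apply: h.
by rewrite /= fx; apply: idealMl.
Qed.

Lemma pchain_contract (A B : comPzRingType) (f : {rmorphism A -> B}) (I J : set B) d :
  near_surj f -> pchain I J d -> pchain (f @^-1` I) (f @^-1` J) d.
Proof.
move=> fS [c [Ic cJ inc]]; exists (fun i => contract f (c i)); split.
- by move=> x /Ic.
- by move=> x /cJ.
- move=> i /inc[ci nci]; split; last exact: contract_strict.
  by move=> x; apply: ci.
Qed.

Lemma regular_chain q e (A : comPzRingType) (m : ideal A) (x : 'I_e -> A) :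
  noetherian A -> islocal m -> has_char q A -> abs_smooth q m ->
  cobasis m (izero A) x -> pchain [set 0] m e.
Proof.
elim: e A m x => [|e IH] A m x nA lm qA sm xb.
  apply: (@pchain0 _ _ _ (PrimeIdeal (islocal_prime lm))) => // _ ->; exact: ideal0.
set X0 : ideal A := gen [set x ord0].
have X0m : X0 `<=` m by apply: gen_min => _ ->; apply: (cb_m xb).
have X0x z : X0 z -> exists c, z = c * x ord0.
  have Kid : ideal_axiom [set z | exists c, z = c * x ord0].
    split=> [|_ _ [c ->] [c' ->]|a _ [c ->]].
    - by exists 0; rewrite mul0r.
    - by exists (c + c'); rewrite mulrDl.
    - by exists (a * c); rewrite mulrA.
  by apply: (@gen_min _ _ (Ideal Kid)) => _ -> /=; exists 1; rewrite mul1r.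
have xb0 : cobasis m X0 (fun i => x (lift ord0 i)).
  have [mx xspan xind] := xb; split=> [i|y /xspan[c /isum0 hc]|c].
  - exact: mx.
  - exists (fun i => c (lift ord0 i)); exists (y - \sum_i c i * x i), (c ord0 * x ord0); split=> //.
      by apply: idealMl; apply: sub_gen.
    by rewrite big_ord_recl opprD addrA addrAC subrK.
  - move=> [a [_ [ha /X0x[b ->] hc]]] i.
    have := xind (fun i => if unlift ord0 i is Some j then c j else - b).
    rewrite big_ord_recl unlift_none => h.
    have {h} := h _ (lift ord0 i); rewrite liftK; apply.
    apply: isum_subl; rewrite (eq_bigr (fun i => c i * x (lift ord0 i))).
      by rewrite hc mulNr addrC addrK.
    by move=> j _; rewrite liftK.
have [|||||c [c0 cm inc]] :=
  IH (qring X0) (imgq X0 m) (fun i => qproj X0 (x (lift ord0 i))).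
- exact: near_surj_noetherian (@qproj_near_surj _ X0) nA.
- exact: imgq_islocal.
- exact: has_char_rmorph (qproj X0) qA.
- exact: smooth_quotient xb ord0.
- exact: (imgq_cobasis X0m (conj (fun _ => id) (fun _ => id)) xb0).
pose c' i := contract (qproj X0) (c i).
have c'x : c' 0%N (x ord0).
  by apply: c0 => /=; apply/qproj_eq0/sub_gen.
(* A prime missing this set lies inside c' 0 and omits x0, so it extends the chain downwards. The
   set misses 0 because x0 is not a zero divisor. *)
have Sm : mult_axiom [set z | exists s n, ~ c' 0%N s /\ z = s * x ord0 ^+ n].
  split; first by exists 1, 0%N; rewrite mulr1; split=> //; apply: prime1.
  move=> _ _ [s [n [ns ->]]] [t [k [nt ->]]]; exists (s * t), (n + k)%N; split.
    by move=> /primeM[].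
  by rewrite exprD mulrACA.
have [z /izeroP-> [s [n [ns]]]|Q [_ QS]] := @prime_avoid A nA (izero A) (MultSet Sm).
  move=> /esym sx; suff s0 : s = 0 by apply: ns; rewrite s0; apply: ideal0.
  elim: n sx => [|n IHn]; first by rewrite mulr1.
  by rewrite exprSr mulrA => /(smooth_nzd nA lm qA sm xb)/IHn.
apply: (pchain_cons (P := Q)); first by move=> _ ->; apply: ideal0.
exists c'; split.
- move=> z Qz; apply: contrapT => nz; apply: (QS z) => //.
  by exists z, 0%N; rewrite mulr1.
- move=> /(_ _ c'x) Qx; apply: (QS _ Qx); exists 1, 1%N; rewrite mul1r expr1; split=> //.
  exact: prime1.
- by move=> z /cm /(imgqP X0m).
- move=> i /inc[ci nci]; split; first by move=> z; apply: ci.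
  exact: contract_strict (@qproj_near_surj _ X0) nci.
Qed.

Lemma pchain_pit_seq (A : comPzRingType) (noethA : noetherian A) (I : set A)
    (P : primeIdeal A) (s : seq A) d : [set` s] `<=` P ->
  pchain I P (d + size s) -> pchain (I `|` [set` s]) P d.
Proof.
elim: s I => [|x s IH] I sP ch.
  by rewrite addn0 in ch; apply: pchain_weak ch => // x [].
have Px : P x by apply: sP; rewrite /= mem_head.
have sP' : [set` s] `<=` P by move=> y ys; apply: sP; rewrite /= inE ys orbT.
move: ch; rewrite /= addnS => /(pchain_pit noethA Px) /(IH _ sP').
apply: pchain_weak => // y [Iy|]; first by left; left.
by rewrite /= inE => /orP[/eqP->|ys]; [left; right|right].
Qed.

Section LocalizationAtPrime.
Variables (A : comPzRingType) (p : primeIdeal A).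

Lemma locAt_islocal : islocal (@maxideal (locAt p)).
Proof. exact: maxidealP. Qed.

Lemma locext_subproof (I : ideal A) :
  ideal_axiom [set x : locAt p | exists a s, I a /\ x = lfrac a s].
Proof.
split.
- by exists 0, (den1 _); split=> //; apply: ideal0.
- move=> _ _ [a [s [Ia ->]]] [b [t [Ib ->]]].
  exists (a * dval t + b * dval s), (denM s t); rewrite lfracD; split=> //.
  by apply: idealD; apply: idealMr.
- move=> x _ [a [s [Ia ->]]]; elim/lfracW: x => b t.
  by exists (b * a), (denM t s); rewrite lfracM; split=> //; apply: idealMl.
Qed.

Definition locext (I : ideal A) : ideal (locAt p) := Ideal (locext_subproof I).

Lemma locext_isat (I : ideal A) a : locext I (linj a) -> isat p I a.
Proof.
move=> [b [s [Ib /lfrac_eqP[u e]]]]; exists (dval u * dval s); split.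
  by move=> /primeM[]; [apply: (denP u)|apply: (denP s)].
move: e; rewrite dvalE mulr1 => e; rewrite -mulrA [dval s * a]mulrC e; exact: idealMl.
Qed.

Lemma locext_mono (I J : ideal A) : I `<=` J -> locext I `<=` locext J.
Proof. by move=> IJ _ [a [s [/IJ Ja ->]]]; exists a, s. Qed.

Lemma max_locext : @maxideal (locAt p) `<=` locext p.
Proof. by elim/lfracW=> a s /mem_locAt_max pa; exists a, s. Qed.

Lemma locext_M (I J : ideal A) : idealM (locext I) (locext J) `<=` locext (idealM I J).
Proof.
apply: idealM_min => _ _ [a [s [Ia ->]]] [b [t [Jb ->]]].
by exists (a * b), (denM s t); rewrite lfracM; split=> //; apply: mem_idealM.
Qed.

Lemma numerators e (x : 'I_e -> locAt p) : (forall i, maxideal (x i)) ->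
  exists a : 'I_e -> A, forall i, p (a i) /\ forall c : ideal A, c (a i) -> locext c (x i).
Proof.
move=> mx; suff /choice[a ha] i : exists a, p a /\ forall c : ideal A, c a -> locext c (x i).
  by exists a.
by have [a [s [pa e']]] := max_locext (mx i); exists a; split=> // c ca; exists a, s.
Qed.

(** The x_i and J generate the maximal ideal by Nakayama's lemma. So a prime inside p that contains
    J and numerators of the x_i, after localization, is p itself. *)
Lemma cobasis_prime_eq (noethA : noetherian A) e (x : 'I_e -> locAt p) (J : ideal (locAt p))
    (c : primeIdeal A) : cobasis (@maxideal (locAt p)) J x -> c `<=` p ->
  (forall i, locext c (x i)) -> J `<=` locext c -> p `<=` c.
Proof.
move=> [_ xspan _] cp xc Jc; apply: (@nakayama A noethA p c p) => //.
- exact: prime_saturated.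
- exact: prime_saturated.
move=> y py; apply: locext_isat.
have my : @maxideal (locAt p) (linj y) by apply/mem_locAt_max.
have [d hd] := xspan _ my; rewrite -(subrK (\sum_i d i * x i) (linj y)).
apply: idealD; last first.
  by apply: ideal_sum => i _; apply: idealMl; apply: locext_mono (xc i); apply: isum_subl.
move: hd; apply: isum_min.
  move=> z hz; apply: (locext_mono (I := idealM p p)); first exact: isum_subr.
  by apply: locext_M; apply: idealM_mono hz; apply: max_locext.
by move=> z /Jc; apply: locext_mono; apply: isum_subl.
Qed.

End LocalizationAtPrime.

(** * Tensor products *)

Lemma loc_hom_ext (A C : comPzRingType) (S : multSet A) (g h : {rmorphism loc S -> C}) :
  (forall a, g (linj a) = h (linj a)) -> forall x, g x = h x.
Proof.
move=> gh; elim/lfracW=> a s.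
rewrite -[lfrac a s]mulr1 -(linj_unit s) mulrCA lfracK !rmorphM gh; congr (_ * _).
have e := linj_unit s; rewrite -[LHS]mulr1 -(rmorph1 h) -[in LHS]e rmorphM mulrCA -gh.
by rewrite -rmorphM e rmorph1 mulr1.
Qed.

Lemma loc_map_max (A B : comPzRingType) (f : {rmorphism A -> B}) (P : primeIdeal A)
    (Q : primeIdeal B) (PQ : forall a, P a <-> Q (f a)) x :
  maxideal x -> maxideal (loc_map PQ x).
Proof. by move=> mx; apply/qproj_eq0; exact: (residue_map_subproof PQ mx). Qed.

Lemma llift_ex (A C : comPzRingType) (S : multSet A) (f : {rmorphism A -> C}) :
  (forall s, S s -> exists c, c * f s = 1) ->
  exists V : {rmorphism loc S -> C}, forall a, V (linj a) = f a.
Proof. by move=> fS; exists (llift fS) => a; exact: llift_linj. Qed.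

Lemma tlift_ex (R A B C : comPzRingType) (phi : {rmorphism R -> A}) (psi : {rmorphism R -> B})
    (f : {rmorphism A -> C}) (g : {rmorphism B -> C}) : (forall r, f (phi r) = g (psi r)) ->
  exists h : {rmorphism tensor phi psi -> C},
    (forall a, h (tinl phi psi a) = f a) /\ (forall b, h (tinr phi psi b) = g b).
Proof.
by move=> fg; exists (tlift fg); split=> [a|b]; [exact: tlift_inl|exact: tlift_inr].
Qed.

Lemma tensor_hom_ext (R A B C : comPzRingType) (phi : {rmorphism R -> A})
    (psi : {rmorphism R -> B}) (h1 h2 : {rmorphism tensor phi psi -> C}) :
  (forall a, h1 (tinl phi psi a) = h2 (tinl phi psi a)) ->
  (forall b, h1 (tinr phi psi b) = h2 (tinr phi psi b)) -> forall x, h1 x = h2 x.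
Proof.
move=> hl hr; elim/tensor_ind=> [|a b x IH]; first by rewrite !rmorph0.
by rewrite tpureE !rmorphD !rmorphM hl hr IH.
Qed.

Section BaseChange.
Variables (R A B : comPzRingType).
Variables (phi : {rmorphism R -> A}) (psi : {rmorphism R -> B}).
Variable P : primeIdeal (tensor phi psi).
Let p := primeA P.
Let q := primeB P.
Let n := primeR P.
Variables (fRA : {rmorphism locAt n -> locAt p}) (fRB : {rmorphism locAt n -> locAt q}).
Variables (fAS : {rmorphism locAt p -> locAt P}) (fBS : {rmorphism locAt q -> locAt P}).
Hypothesis fRAl : forall r, fRA (linj r) = linj (phi r).
Hypothesis fRBl : forall r, fRB (linj r) = linj (psi r).
Hypothesis fASl : forall a, fAS (linj a) = linj (tinl phi psi a).
Hypothesis fBSl : forall b, fBS (linj b) = linj (tinr phi psi b).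
Hypothesis fASm : forall x, maxideal x -> maxideal (fAS x).

(** The lift on the localization of A and the given g glue on A (x) B; elements outside P become
    units, since they are units modulo a square-zero kernel. *)
Lemma fsmooth_base_change_loc : fsmooth (@maxideal (locAt p)) fRA ->
  fsmooth (@maxideal (locAt P)) fBS.
Proof.
move=> fs C D pi g u pis gu [j uj].
have compat r : fBS (fRB r) = fAS (fRA r).
  apply: (@loc_hom_ext _ _ _ (fBS \o fRB) (fAS \o fRA)) => {}r /=.
  by rewrite fRBl fRAl fASl fBSl tensorC.
have [||v [vf vu]] := fs C D pi (g \o fRB) (u \o fAS) pis.
- by move=> r /=; rewrite gu compat.
- by exists j => t ht /=; apply: uj; apply: idealX_map ht.
have vg r : (v \o linj) (phi r) = (g \o linj) (psi r).
  by rewrite /= -fRAl vf /= fRBl.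
have [h [hl hr]] := tlift_ex vg.
have hu x : pi (h x) = u (linj x).
  apply: (tensor_hom_ext (h1 := pi \o h) (h2 := u \o linj)) => [a|b] /=.
    by rewrite hl vu /= fASl.
  by rewrite hr gu fBSl.
have [V VE] : exists V : {rmorphism locAt P -> C}, forall a, V (linj a) = h a.
  apply: llift_ex => s nPs; pose ds := mkden (S := MultSet (compl_subproof P)) nPs.
  apply: (sqz_unit pis (d := u (lfrac 1 ds))).
  by rewrite hu -rmorphM (linj_unit ds) rmorph1.
exists V; split.
- apply: (@loc_hom_ext _ _ _ (V \o fBS) g) => b /=.
  by rewrite fBSl VE hr.
- by apply: (@loc_hom_ext _ _ _ (pi \o V) u) => x /=; rewrite VE hu.
Qed.

End BaseChange.

Lemma fsmooth_base_change (R A B : comPzRingType) (phi : {rmorphism R -> A})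
    (psi : {rmorphism R -> B}) (P : primeIdeal (tensor phi psi)) :
  fsmooth (@maxideal (locAt (primeA P))) (loc_map (primeRA P)) ->
  fsmooth (@maxideal (locAt P)) (loc_map (primeB_tinr P)).
Proof.
apply: (fsmooth_base_change_loc (fRB := loc_map (primeRB P))
  (fAS := loc_map (primeA_tinl P))).
- exact: loc_map_linj.
- exact: loc_map_linj.
- exact: loc_map_linj.
- exact: loc_map_linj.
- exact: loc_map_max.
Qed.


(** * Torsion in A/p (x) B/q by linear algebra over the residue field at n *)

Section GoingDown.
Variables (R A B : comPzRingType).
Variables (phi : {rmorphism R -> A}) (psi : {rmorphism R -> B}).
Variables (n : primeIdeal R) (p : primeIdeal A) (q : primeIdeal B).
Hypothesis np : forall r, n r <-> p (phi r).
Hypothesis nq : forall r, n r <-> q (psi r).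
Local Notation X := (tensor phi psi).

(** The quotient of X by this ideal is A/p (x) B/q. *)
Definition join_ideal : ideal X := gen (tinl phi psi @` p `|` tinr phi psi @` q).

Definition free_mod m (b : 'I_m -> B) :=
  forall r : 'I_m -> R, q (\sum_j psi (r j) * b j) -> forall j, n (r j).

(** Take a representation with the fewest terms, over all denominators r outside n: a relation among
    the b_j with t_l outside n would eliminate the l-th term after multiplication by t_l. *)
Lemma tensor_free_rep (x : X) : exists r m (a : 'I_m -> A) (b : 'I_m -> B),
  [/\ ~ n r, free_mod b & join_ideal (tinl phi psi (phi r) * x - \sum_j tpure phi psi (a j) (b j))].
Proof.
pose Q m := `[< exists r (a : 'I_m -> A) (b : 'I_m -> B), ~ n r /\
  join_ideal (tinl phi psi (phi r) * x - \sum_j tpure phi psi (a j) (b j)) >].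
have exQ : exists m, Q m.
  have [m [a [b e]]] : exists m (a : 'I_m -> A) (b : 'I_m -> B),
      x = \sum_j tpure phi psi (a j) (b j).
    elim/tensor_ind: x {Q} => [|a b x [m [a' [b' ->]]]].
      by exists 0%N, (fun=> 0), (fun=> 0); rewrite big_ord0.
    exists m.+1, (fun i => if unlift ord0 i is Some j then a' j else a),
      (fun i => if unlift ord0 i is Some j then b' j else b).
    rewrite big_ord_recl unlift_none; congr (_ + _); apply: eq_bigr => i _.
    by rewrite liftK.
  exists m; apply/asboolP; exists 1, a, b; split; first exact: prime1.
  by rewrite !rmorph1 mul1r e subrr; apply: ideal0.
case: (ex_minnP exQ) => m /asboolP[r [a [b [nr rx]]]] minm.
exists r, m, a, b; split=> // t qt l; apply: contrapT => ntl.
move: a b rx minm t qt l ntl; case: m => [|m] a b rx minm t qt l ntl; first by case: l ntl.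
suff /minm : Q m by rewrite ltnn.
apply/asboolP; exists (t l * r).
exists (fun j => phi (t l) * a (lift l j) - phi (t (lift l j)) * a l), (fun j => b (lift l j)).
split; first by move=> /primeM[].
pose z := \sum_j tpure phi psi (a j) (b j).
have tinlE c d e : tinl phi psi c * tpure phi psi d e = tpure phi psi (c * d) e.
  by rewrite tpureE mulrA -rmorphM -tpureE.
have hl : join_ideal (tpure phi psi (a l) (\sum_j psi (t j) * b j)).
  rewrite tpureE; apply: idealMl; apply: sub_gen; right; by exists (\sum_j psi (t j) * b j).
have hz : tinl phi psi (phi (t l)) * z - tpure phi psi (a l) (\sum_j psi (t j) * b j) =
    \sum_j tpure phi psi (phi (t l) * a (lift l j) - phi (t (lift l j)) * a l) (b (lift l j)).
  have -> : tpure phi psi (a l) (\sum_j psi (t j) * b j) =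
      \sum_j tpure phi psi (phi (t j) * a l) (b j).
    rewrite tpureE rmorph_sum mulr_sumr; apply: eq_bigr => j _.
    by rewrite -tpureE tpureZ.
  rewrite mulr_sumr -sumrB (bigD1_ord l) //= tinlE subrr add0r.
  apply: eq_bigr => j _; rewrite tinlE; apply/eqP; rewrite subr_eq -tpureDl subrK.
  by [].
have := idealD (idealMl (tinl phi psi (phi (t l))) rx) hl.
by congr (join_ideal _); rewrite -hz !rmorphM -/z; ring.
Qed.

(** The preimage in B of a vector subspace of the localization of B/q at n; the last clause replaces
    division by elements outside n. *)
Definition subspace (W : set B) := [/\ forall y z, W y -> W z -> W (y - z),
  forall r y, W y -> W (psi r * y), q `<=` W & forall r y, ~ n r -> W (psi r * y) -> W y].

Lemma subspaceD W y z : subspace W -> W y -> W z -> W (y + z).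
Proof.
move=> [WB _ qW _] Wy Wz; rewrite -[z]opprK; apply: (WB) => //.
by rewrite -sub0r; apply: (WB) => //; apply/qW/ideal0.
Qed.

(** A subspace maximal among those that contain the b_j with j != l but not b_l has b_l as a
    complement: adjoining any further y must bring in b_l. *)
Lemma hyperplane m (b : 'I_m -> B) l : free_mod b ->
  exists W, [/\ subspace W, forall j, j != l -> W (b j), ~ W (b l) &
    forall y, exists r c, ~ n r /\ W (psi r * y - psi c * b l)].
Proof.
move=> fb.
pose W0 : set B := [set y | exists r (c : 'I_m -> R),
  [/\ ~ n r, c l = 0 & q (psi r * y - \sum_j psi (c j) * b j)]].
pose good W := [/\ subspace W, forall j, j != l -> W (b j) & ~ W (b l)].
have good0 : good W0.
  split; first split.
  - move=> y z [r [c [nr cl hy]]] [s [d [ns dl hz]]].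
    exists (r * s), (fun j => s * c j - r * d j); split; first by move=> /primeM[].
      by rewrite cl dl !mulr0 subrr.
    have := idealB (idealMl (psi s) hy) (idealMl (psi r) hz); congr (q _).
    rewrite [X in _ = _ - X](eq_bigr (fun j =>
      psi s * (psi (c j) * b j) - psi r * (psi (d j) * b j))).
      by rewrite sumrB -!mulr_sumr !rmorphM; ring.
    by move=> j _; rewrite rmorphB !rmorphM; ring.
  - move=> t y [r [c [nr cl hy]]]; exists r, (fun j => t * c j); split=> //.
      by rewrite cl mulr0.
    rewrite (eq_bigr (fun j => psi t * (psi (c j) * b j))).
      by rewrite -mulr_sumr mulrCA -mulrBr; apply: idealMl.
    by move=> j _; rewrite rmorphM mulrA.
  - move=> y qy; exists 1, (fun=> 0); split=> //; first exact: prime1.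
    rewrite rmorph1 mul1r big1 ?subr0 // => j _; by rewrite rmorph0 mul0r.
  - move=> t y nt [r [c [nr cl hy]]]; exists (r * t), c; split=> //.
      by move=> /primeM[].
    by rewrite rmorphM -mulrA.
  - move=> j jl; exists 1, (fun i => (i == j)%:R); split; first exact: prime1.
      by rewrite eq_sym (negbTE jl).
    rewrite (_ : \sum_i _ = b j); first by rewrite rmorph1 mul1r subrr; apply: ideal0.
    rewrite (bigD1 j) //= eqxx rmorph1 mul1r big1 ?addr0 // => i /negbTE->.
    by rewrite rmorph0 mul0r.
  - move=> [r [c [nr cl h]]]; apply: nr.
    have := fb (fun j => if j == l then r else - c j) _ l; rewrite eqxx; apply.
    move: h; congr (q _); rewrite [in RHS](bigD1 l) //= eqxx; congr (_ + _).
    rewrite (bigD1 l) //= cl rmorph0 mul0r add0r -sumrN; apply: eq_bigr => j /negbTE->.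
    by rewrite rmorphN mulNr.
have [|W [[[WB Wr qW Ws] Wb nWb] _ maxW]] := Zorn_above (Q := good) (X0 := W0) good0.
  move=> F [Y0 FY0] FQ totF.
  split; first split.
  - move=> y z [Y FY Yy] [Z FZ Zz]; have [h|h] := totF _ _ FY FZ.
      by exists Z => //; have [[WB _ _ _] _ _] := FQ _ FZ; apply: (WB) => //; apply: h.
    by exists Y => //; have [[WB _ _ _] _ _] := FQ _ FY; apply: (WB) => //; apply: h.
  - by move=> r y [Y FY Yy]; exists Y => //; have [[_ h _ _] _ _] := FQ _ FY; apply: h.
  - by move=> y qy; exists Y0 => //; have [[_ _ h _] _ _] := FQ _ FY0; apply: h.
  - move=> r y nr [Y FY Yy]; exists Y => //.
    by have [[_ _ _ h] _ _] := FQ _ FY; apply: (h r).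
  - by move=> j jl; exists Y0 => //; have [_ h _] := FQ _ FY0; apply: h.
  - by move=> [Y FY]; have [_ _] := FQ _ FY.
have sW : subspace W by [].
exists W; split=> // y.
have [Wy|nWy] := pselect (W y).
  exists 1, 0; split; first exact: prime1.
  by rewrite rmorph1 mul1r rmorph0 mul0r subr0.
pose W' : set B := [set z | exists r c, ~ n r /\ W (psi r * z - psi c * y)].
have WW' : W `<=` W'.
  move=> z Wz; exists 1, 0; split; first exact: prime1.
  by rewrite rmorph1 mul1r rmorph0 mul0r subr0.
have W'y : W' y.
  exists 1, 1; split; first exact: prime1.
  by rewrite rmorph1 mul1r subrr; apply/qW/ideal0.
have [[r [c [nr h]]]|nW'b] := pselect (W' (b l)).
  have nc : ~ n c.
    move=> nc; apply: nWb; apply: (Ws r) => //.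
    rewrite -(subrK (psi c * y) (psi r * b l)); apply: subspaceD => //.
    by apply/qW/idealMr/nq.
  exists c, r; split=> //.
  by rewrite -opprB -sub0r; apply: (WB) => //; apply/qW/ideal0.
exfalso; apply: nWy; apply: (maxW W') => //; split=> //; last by move=> j jl; apply/WW'/Wb.
split.
- move=> z z' [r [c [nr hz]]] [r' [c' [nr' hz']]].
  exists (r * r'), (r' * c - r * c'); split; first by move=> /primeM[].
  have := WB _ _ (Wr r' _ hz) (Wr r _ hz'); congr (W _).
  by rewrite rmorphB !rmorphM; ring.
- move=> t z [r [c [nr hz]]]; exists r, (t * c); split=> //.
  have := Wr t _ hz; congr (W _); by rewrite rmorphM; ring.
- by move=> z qz; apply/WW'/qW.
- move=> t z nt [r [c [nr hz]]]; exists (r * t), c; split; first by move=> /primeM[].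
  by rewrite rmorphM -mulrA.
Qed.

(** The coordinate along b_l modulo the hyperplane, a fraction over R/n, is read in the residue
    field at p. *)
Lemma dual_functional m (b : 'I_m -> B) l : free_mod b ->
  exists lam : B -> residue (locAt p), [/\ {morph lam : y z / y + z},
    forall r y, lam (psi r * y) = rinj p (phi r) * lam y, forall y, q y -> lam y = 0,
    forall j, j != l -> lam (b j) = 0 & lam (b l) = 1].
Proof.
move=> fb; have [W [sW Wb nWb Wspan]] := hyperplane l fb.
have [WB Wr qW Ws] := sW.
pose K r := rinj p (phi r).
have KE r : n r <-> K r = 0 by rewrite np rinj_eq0.
have cross y r c r' c' : W (psi r * y - psi c * b l) -> W (psi r' * y - psi c' * b l) ->
    K r * K c' = K r' * K c.
  move=> h h'; apply/eqP; rewrite -subr_eq0; apply/eqP.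
  suff : n (r * c' - r' * c) by move/KE; rewrite /K !rmorphB !rmorphM.
  apply: contrapT => nn; apply: nWb; apply: (Ws _ _ nn).
  have := WB _ _ (Wr r' _ h) (Wr r _ h'); congr (W _).
  by rewrite rmorphB !rmorphM; ring.
have /choice[lam lamE] y : exists v, forall r c, ~ n r -> W (psi r * y - psi c * b l) ->
    v * K r = K c.
  have [r [c [nr h]]] := Wspan y.
  have [w wr] : exists w, w * K r = 1.
    by apply: rinj_unit => /np.
  exists (w * K c) => r' c' nr' h'.
  by rewrite -mulrA [K c * _]mulrC -(cross _ _ _ _ _ h h') mulrA wr mul1r.
have uniq v v' r : ~ n r -> v * K r = v' * K r -> v = v'.
  move=> nr e; have [w wr] : exists w, w * K r = 1 by apply: rinj_unit => /np.
  by rewrite -[v]mulr1 -[v']mulr1 -wr !(mulrCA _ w) e.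
exists lam; split=> [y z|t y|y qy|j jl|].
- have [r [c [nr h]]] := Wspan y; have [s [d [ns k]]] := Wspan z.
  have nrs : ~ n (r * s) by move=> /primeM[].
  apply: (uniq _ _ _ nrs); rewrite (lamE _ (r * s) (s * c + r * d)) //.
    rewrite /K rmorphM rmorphD !rmorphM rmorphD !rmorphM -/(K r) -/(K s) -/(K c) -/(K d).
    by rewrite -(lamE _ _ _ nr h) -(lamE _ _ _ ns k); ring.
  have := subspaceD sW (Wr s _ h) (Wr r _ k); congr (W _).
  by rewrite rmorphD !rmorphM; ring.
- have [r [c [nr h]]] := Wspan y; apply: (uniq _ _ _ nr).
  rewrite (lamE _ r (t * c)) // -/(K t) ?/K ?rmorphM -?/(K _).
    by rewrite -mulrA (lamE _ _ _ nr h).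
  by have := Wr t _ h; congr (W _); ring.
- have := lamE y 1 0; rewrite /K !rmorph1 !rmorph0 mulr1; apply; first exact: prime1.
  by rewrite mul1r mul0r subr0; apply: qW.
- have := lamE (b j) 1 0; rewrite /K !rmorph1 !rmorph0 mulr1; apply; first exact: prime1.
  by rewrite mul1r mul0r subr0; apply: Wb.
- have := lamE (b l) 1 1; rewrite /K !rmorph1 mulr1; apply; first exact: prime1.
  by rewrite mul1r subrr; apply/qW/ideal0.
Qed.

Section Contraction.
Variable lam : B -> residue (locAt p).
Hypothesis lamD : {morph lam : y z / y + z}.
Hypothesis lamZ : forall r y, lam (psi r * y) = rinj p (phi r) * lam y.

(** The contraction a (x) b -> a * lam b. It is additive but not multiplicative, so [tlift] cannot
    provide it. *)
Definition tcontract_seq (s : seq (A * B)) := \sum_(x <- s) rinj p x.1 * lam x.2.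

Definition tcontract (x : X) := tcontract_seq (repr x).

Lemma tcontract_rel s t : tens_rel phi psi s t -> tcontract_seq s = tcontract_seq t.
Proof.
rewrite /tcontract_seq; elim=> {s t} //.
- by move=> t s u _ -> _ ->.
- by move=> s t u _ h; rewrite !big_cat h.
- by move=> s t; rewrite !big_cat /= addrC.
- by move=> a a' b; rewrite !big_cons !big_nil rmorphD mulrDl !addr0.
- by move=> a b b'; rewrite !big_cons !big_nil lamD mulrDr !addr0.
- by move=> r a b; rewrite !big_cons lamZ rmorphM mulrA [_ * rinj p a]mulrC.
- by move=> b; rewrite big_cons big_nil rmorph0 mul0r addr0.
Qed.

Lemma tcontract_tsum s : tcontract (tsum phi psi s) = tcontract_seq s.
Proof. exact/tcontract_rel/tsum_repr. Qed.

Lemma tcontractD x y : tcontract (x + y) = tcontract x + tcontract y.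
Proof.
elim/tsumW: x => s; elim/tsumW: y => t.
by rewrite -[X in tcontract X]/(tadd _ _) taddE !tcontract_tsum /tcontract_seq big_cat.
Qed.

Lemma tcontract0 : tcontract 0 = 0.
Proof. by apply: (@addrI _ (tcontract 0)); rewrite -tcontractD !addr0. Qed.

Lemma tcontract_pure a b : tcontract (tpure phi psi a b) = rinj p a * lam b.
Proof. by rewrite tcontract_tsum /tcontract_seq big_seq1. Qed.

Lemma tcontract_join x : (forall y, q y -> lam y = 0) -> join_ideal x -> tcontract x = 0.
Proof.
move=> lamq.
(* The kernel of the contraction is not visibly an ideal; the largest ideal inside it is used
   instead. *)
have Kid : ideal_axiom [set x | forall y, tcontract (y * x) = 0].
  split=> [y|y z hy hz t|a y hy t]; first by rewrite mulr0 tcontract0.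
    by rewrite mulrDr tcontractD hy hz addr0.
  by rewrite mulrA.
move=> jx; suff : Ideal Kid x by move=> /(_ 1); rewrite mul1r.
move: x jx; apply: gen_min => _ [[a pa <-]|[b qb <-]] y /=.
  elim/tensor_ind: y => [|c d y IH]; first by rewrite mul0r tcontract0.
  rewrite mulrDl tcontractD IH addr0 /tinl -tpureM tcontract_pure mulr1.
  by rewrite rmorphM (_ : rinj p a = 0) ?mulr0 ?mul0r //; apply/rinj_eq0.
elim/tensor_ind: y => [|c d y IH]; first by rewrite mul0r tcontract0.
rewrite mulrDl tcontractD IH addr0 /tinr -tpureM tcontract_pure lamq ?mulr0 //.
exact: idealMl.
Qed.

Lemma tcontract_sum (I : finType) (F : I -> X) :
  tcontract (\sum_i F i) = \sum_i tcontract (F i).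
Proof. by apply: (big_morph tcontract tcontractD tcontract0). Qed.

End Contraction.

(* A/p (x)_R B/q is torsion-free over A/p up to denominators from R, because
   its localization is an extension of scalars along the field kappa(n). *)
Lemma join_torsion a x : ~ p a -> join_ideal (tinl phi psi a * x) ->
  exists r, ~ n r /\ join_ideal (tinl phi psi (phi r) * x).
Proof.
move=> npa jax; have [r [m [c [b [nr fb rx]]]]] := tensor_free_rep x.
exists r; split=> //; set z := \sum_j _ in rx.
suff jz : join_ideal z by rewrite -(subrK z (_ * x)); apply: idealD.
apply: ideal_sum => l _; rewrite tpureE; apply: idealMr; apply: sub_gen; left.
exists (c l) => //.
have [lam [lamD lamZ lamq lamj laml]] := dual_functional l fb.
have jaz : join_ideal (tinl phi psi a * z).
  have := idealB (idealMl (tinl phi psi (phi r)) jax) (idealMl (tinl phi psi a) rx).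
  by congr (join_ideal _); ring.
(* Contracting a z with the functional dual to b_l leaves the residue of a c_l, so c_l lies in p. *)
have := tcontract_join lamD lamZ lamq jaz.
rewrite /z mulr_sumr (tcontract_sum lamD lamZ) (bigD1 l) //= big1 => [|j jl]; last first.
  by rewrite /tinl -tpureM mul1r (tcontract_pure lamD lamZ) lamj // mulr0.
rewrite /tinl -tpureM mul1r (tcontract_pure lamD lamZ) laml mulr1 addr0.
by move=> /rinj_eq0 /primeM[].
Qed.

End GoingDown.

(** * Embedding dimension *)

Lemma cobasis_ex (A : comPzRingType) (m J : ideal A) : noetherian A -> islocal m ->
  exists e (x : 'I_e -> A), cobasis m J x.
Proof.
move=> nA lm.
pose Q e := `[< exists x : 'I_e -> A, (forall i, m (x i)) /\
  forall y, m y -> exists c : 'I_e -> A, isum (idealM m m) J (y - \sum_i c i * x i) >].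
have exQ : exists e, Q e.
  have [s [ms sm]] := nA m; exists (size s); apply/asboolP.
  exists (fun i => s`_i); split=> [i|y /ms/gen_seqP[c ->]].
    by apply/sm/sub_gen/mem_nth.
  by exists c; rewrite subrr; apply: ideal0.
case: (ex_minnP exQ) => e /asboolP[x [mx xspan]] mine; exists e, x; split=> // c hc l.
apply: contrapT => nml.
move: c x mx xspan l nml hc mine; case: e => [|e] c x mx xspan l nml hc mine.
  by case: l nml.
suff /mine : Q e by rewrite ltnn.
have [w wc] := islocal_unit lm nml.
apply/asboolP; exists (fun i => x (lift l i)); split=> // y my.
have [d hd] := xspan y my.
exists (fun i => d (lift l i) - d l * w * c (lift l i)).
have := idealD hd (idealMl (d l * w) hc); congr (isum _ _ _).
rewrite [\sum_(i < e.+1) d i * x i](bigD1_ord l) //.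
rewrite [\sum_(i < e.+1) c i * x i](bigD1_ord l) //= mulrDr.
rewrite (_ : d l * w * (c l * x l) = d l * x l * (w * c l)); last by ring.
rewrite wc mulr1 mulr_sumr.
rewrite [in RHS](eq_bigr (fun i => d (lift l i) * x (lift l i) -
  d l * w * (c (lift l i) * x (lift l i)))); last by move=> i _; ring.
by rewrite sumrB; ring.
Qed.

Lemma cobasis_cat (R A : comPzRingType) (mR : ideal R) (mA : ideal A)
    (f : {rmorphism R -> A}) d e (r : 'I_d -> R) (x : 'I_e -> A) :
  islocal mR -> islocal mA -> (forall y, mR y -> mA (f y)) -> fsmooth mA f ->
  cobasis mR (izero R) r -> cobasis mA (gen (f @` mR)) x ->
  cobasis mA (izero A)
    (fun i : 'I_(d + e) => match split i with inl j => f (r j) | inr k => x k end).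
Proof.
move=> lR lA fm fs rb xb; have [mx xspan xind] := xb; set z := fun i => _.
have zl j : z (lshift e j) = f (r j) by rewrite /z -[lshift e j]/(unsplit (inl j)) unsplitK.
have zr j : z (rshift d j) = x j by rewrite /z -[rshift d j]/(unsplit (inr j)) unsplitK.
have zsum (c : 'I_(d + e) -> A) : \sum_i c i * z i =
    \sum_j c (lshift e j) * f (r j) + \sum_k c (rshift d k) * x k.
  by rewrite big_split_ord /=; congr (_ + _); apply: eq_bigr => j _; rewrite ?zl ?zr.
have Jspan y : gen (f @` mR) y -> exists c : 'I_d -> A,
    idealM mA mA (y - \sum_j c j * f (r j)).
  have Kid : ideal_axiom [set y | exists c : 'I_d -> A, idealM mA mA (y - \sum_j c j * f (r j))].
    split=> [|u u' [c hc] [c' hc']|a u [c hc]].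
    - exists (fun=> 0); rewrite big1 ?subrr; first exact: ideal0.
      by move=> j _; rewrite mul0r.
    - exists (fun j => c j + c' j).
      rewrite (eq_bigr (fun j => c j * f (r j) + c' j * f (r j))); last by move=> j _; ring.
      by rewrite big_split opprD addrACA; apply: idealD.
    - exists (fun j => a * c j).
      rewrite (eq_bigr (fun j => a * (c j * f (r j)))); last by move=> j _; ring.
      by rewrite -mulr_sumr -mulrBr; apply: idealMl.
  apply: (@gen_min _ _ (Ideal Kid)) => _ [s ms <-] /=.
  have [c hc] := cb_span rb ms; exists (fun j => f (c j)).
  have := idealM_map (f := f) (I' := mA) (J' := mA) fm fm hc.
  rewrite rmorphB rmorph_sum (eq_bigr (fun j => f (c j) * f (r j))) // => j _.
  by rewrite rmorphM.
split=> [i|y my|c /isum0 hc i].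
- by rewrite /z; case: (split i) => j //; apply/fm/(cb_m rb).
- have [c [a [b [a2 /Jspan[c' hb] e1]]]] := xspan y my.
  exists (fun i => match split i with inl j => c' j | inr k => c k end).
  apply: isum_subl; rewrite zsum.
  rewrite (eq_bigr (fun j => c' j * f (r j))); last first.
    by move=> j _; rewrite -[lshift e j]/(unsplit (inl j)) unsplitK.
  rewrite [X in _ - (_ + X)](eq_bigr (fun k => c k * x k)); last first.
    by move=> k _; rewrite -[rshift d k]/(unsplit (inr k)) unsplitK.
  rewrite [X in _ - X]addrC opprD addrA e1 -addrA; exact: idealD.
- rewrite zsum in hc.
  have cr k : mA (c (rshift d k)).
    apply: (xind (fun k => c (rshift d k))).
    exists (\sum_j c (lshift e j) * f (r j) + \sum_k c (rshift d k) * x k).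
    exists (- \sum_j c (lshift e j) * f (r j)); split=> //; last by rewrite addrAC subrr add0r.
    apply: idealN; apply: ideal_sum => j _; apply/idealMl/sub_gen.
    by exists (r j) => //; apply: (cb_m rb).
  (* The sum over the x_k now lies in mA^2, hence so does the sum over the f (r j). *)
  have cl j : mA (c (lshift e j)).
    apply: (@cotangent_inj_at _ _ _ _ f lR lA fm _ r rb j (fun j => c (lshift e j)) fs).
    rewrite -(addrK (\sum_k c (rshift d k) * x k) (\sum_j _)); apply: idealB => //.
    by apply: ideal_sum => k _; apply: mem_idealM.
  by case: (splitP i) => j ij; [rewrite (_ : i = lshift e j)|rewrite (_ : i = rshift d j)];
    rewrite // ; apply: val_inj.
Qed.

(** [vspace_dim] chooses a value by [xget], so uniqueness is the point: two coordinate isomorphisms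
    yield matrices with product 1, which bounds one size by the other. *)
Lemma vspace_dimE (K : comPzRingType) (V : lmodType K) n (f : {linear 'rV[K]_n -> V}) :
  isfield K -> bijective f -> vspace_dim V = (n%:Z%:E)%E.
Proof.
move=> [K1 _] bf; have [T [i [j [ij ji]]]] := nzring_pack K1.
have dim_le n1 n2 (f1 : {linear 'rV[K]_n1 -> V}) (f2 : {linear 'rV[K]_n2 -> V}) :
    bijective f1 -> bijective f2 -> (n1 <= n2)%N.
  move=> [g1 f1K g1K] [g2 f2K g2K].
  pose M := \matrix_(a < n1, b < n2) i (g2 (f1 (delta_mx 0 a)) 0 b).
  pose N := \matrix_(b < n2, a < n1) i (g1 (f2 (delta_mx 0 b)) 0 a).
  apply: (@mulmx1_min T n1 n2 M N); apply/matrixP => a c; rewrite !mxE.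
  have -> : \sum_b M a b * N b c =
      i ((\sum_b g2 (f1 (delta_mx 0 a)) 0 b *: g1 (f2 (delta_mx 0 b))) 0 c).
    rewrite summxE rmorph_sum; apply: eq_bigr => b _.
    by rewrite !mxE rmorphM.
  rewrite (_ : \sum_b _ = delta_mx 0 a); last first.
    apply: (can_inj f1K); rewrite linear_sum.
    rewrite (eq_bigr (fun b => f2 (g2 (f1 (delta_mx 0 a)) 0 b *: delta_mx 0 b))); last first.
      by move=> b _; rewrite linearZ g1K linearZ.
    by rewrite -linear_sum -row_sum_delta g2K.
  by rewrite mxE eqxx [c == a]eq_sym; case: (a == c); rewrite ?rmorph1 ?rmorph0.
rewrite /vspace_dim; apply: xget_unique; first by exists n => //; exists f.
move=> _ [k [f' bf'] <-]; congr (_%:Z%:E)%E.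
by apply/eqP; rewrite eqn_leq (dim_le _ _ _ _ bf bf') (dim_le _ _ _ _ bf' bf).
Qed.

Lemma embdimE (S : localRingType) e (x : 'I_e -> S) :
  cobasis (@maxideal S) (izero S) x -> embdim S = (e%:Z%:E)%E.
Proof.
move=> xb; have lS : islocal (@maxideal S) by exact: maxidealP.
pose b i : cotangent S := cclass (cb_m xb i).
pose f (v : 'rV[residue S]_e) : cotangent S := \sum_i v 0 i *: b i.
have flin : linear f.
  move=> a u v; rewrite /f scaler_sumr -big_split; apply: eq_bigr => i _.
  by rewrite !mxE scalerDl scalerA.
pose fl : {linear 'rV[residue S]_e -> cotangent S} :=
  HB.pack f (GRing.isLinear.Build _ _ _ _ f flin).
have sumI (c : 'I_e -> S) : maxideal (\sum_i c i * x i).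
  by apply: ideal_sum => i _; apply/idealMl/(cb_m xb).
have fE (c : 'I_e -> S) : f (\row_i qproj _ (c i)) = cclass (sumI c).
  rewrite /f.
  have gE (s : seq 'I_e) : exists h : maxideal (\sum_(i <- s) c i * x i),
      \sum_(i <- s) (\row_i qproj (@maxideal S) (c i)) 0 i *: b i = cclass h.
    elim: s => [|i s [h e1]].
      have h : maxideal (\sum_(i <- [::]) c i * x i) by rewrite big_nil; apply: ideal0.
      exists h; rewrite big_nil -[LHS]/(cclass (ideal0 (@maxideal S))).
      by apply: cclass_eq; rewrite big_nil.
    have h' : maxideal (\sum_(j <- i :: s) c j * x j).
      by rewrite big_cons; apply: idealD => //; apply/idealMl/(cb_m xb).
    exists h'; rewrite big_cons e1 mxE -[_ *: _]/(cscale _ _) cscaleE -[LHS]/(cadd _ _) caddE.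
    by apply: cclass_eq; rewrite big_cons.
  by have [h ->] := gE (index_enum _); apply: cclass_eq.
apply: (@vspace_dimE _ _ e fl (qring_isfield lS)).
have reprv (v : 'rV[residue S]_e) : exists c : 'I_e -> S, v = \row_i qproj _ (c i).
  exists (fun i => repr (v 0 i)); apply/rowP => i; rewrite mxE /qproj reprK //.
have finj : injective f.
  move=> u v uv; apply/eqP; rewrite -subr_eq0; apply/eqP.
  have : f (u - v) = 0 by rewrite -[f]/(fl : _ -> _) linearB /= uv subrr.
  have [c ->] := reprv (u - v); rewrite fE -[RHS]/(cclass (ideal0 (@maxideal S))).
  move=> /cclass_eqP; rewrite subr0 => /(cb_indep xb) h.
  by apply/rowP => i; rewrite !mxE; apply/qproj_eq0.
have fsurj w : exists v, f v = w.
  elim/cclassW: w => y my; have [c hc] := cb_span xb my.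
  by exists (\row_i qproj _ (c i)); rewrite fE; apply/cclass_eqP/idealBC.
have [g fg] := choice fsurj.
by exists g => // v; apply: finj; rewrite fg.
Qed.

(** * Primes of the fibre *)

Lemma pchain_join (A : comPzRingType) (I I' : set A) (P : primeIdeal A) d t :
  (forall Q : primeIdeal A, I `<=` Q -> Q `<=` P -> pchain I' Q d) ->
  pchain I P t -> pchain I' P (d + t).
Proof.
elim: t P => [|t IH] P low ch.
  have [Q [QP IQ _]] := pchain_last ch.
  by rewrite addn0; apply: pchain_weak (low Q IQ QP).
have [P1 [Q [QP P1Q nQP1 ch1]]] := pchain_split ch.
rewrite addnS; apply: (pchain_weak (I := I') (J := Q)) => //.
apply: (pchain_rcons _ P1Q nQP1); apply: IH => // Q' IQ' Q'P1.
by apply: low => // x /Q'P1/P1Q/QP.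
Qed.

Section Tensor.
Variables (R A B : comPzRingType).
Variables (phi : {rmorphism R -> A}) (psi : {rmorphism R -> B}).
Local Notation X := (tensor phi psi).
Hypothesis noethX : noetherian X.
Variable P : primeIdeal X.

Let p := primeA P.
Let q := primeB P.
Let n := primeR P.

Definition extB : set X := tinr phi psi @` q.
Definition extAB : set X := tinl phi psi @` p `|` tinr phi psi @` q.

(** Each c_i lies between n A and p, hence over n, so that [join_torsion] applies to A/c_i (x) B/q.
    The chain is built downwards from Q, with a prime over each c_i. *)
Lemma going_down d (Q : primeIdeal X) : pchain (phi @` n) p d -> Q `<=` P ->
  extAB `<=` Q -> pchain extB Q d.
Proof.
move=> [c [nc cp inc]] QP pqQ.
have cpi i : (i <= d)%N -> c i `<=` p.
  by move=> id x /(chain_mono inc id (leqnn _))/cp.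
have ncr i : (i <= d)%N -> forall r, n r <-> c i (phi r).
  move=> id r; split=> [nr|/(cpi i id) //].
  by apply: (chain_mono inc (leq0n i) id); apply: nc; exists r.
suff H k : (k <= d)%N -> forall Q : primeIdeal X, Q `<=` P ->
    tinl phi psi @` (c k) `<=` Q -> extB `<=` Q -> pchain extB Q k.
  apply: H => // [_ [a ca <-]|x hx]; apply: pqQ; last by right.
  by left; exists a => //; apply: cp.
elim: k => [|k IH] kd {QP pqQ}Q QP cQ qQ; first exact: (pchain0 (P := Q)).
have [ckk nck] := inc k kd.
have [a [ca nca]] : exists a, c k.+1 a /\ ~ c k a.
  by apply: contrapT => h; apply: nck => a ca; apply: contrapT => na; apply: h; exists a.
have Qa : Q (tinl phi psi a) by apply: cQ; exists a.
have Sm : mult_axiom [set z | exists s l, ~ Q s /\ z = s * tinl phi psi a ^+ l].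
  split; first by exists 1, 0%N; rewrite mulr1; split=> //; apply: prime1.
  move=> _ _ [s [l [ns ->]]] [s' [l' [ns' ->]]]; exists (s * s'), (l + l')%N; split.
    by move=> /primeM[].
  by rewrite exprD mulrACA.
pose J := join_ideal phi psi (c k) q.
have JQ : J `<=` Q.
  apply: gen_min => z [[b cb <-]|hb]; last exact: qQ.
  by apply: cQ; exists b => //; apply: ckk.
(* If s a^l were in J, then so would r s for some r outside n, by [join_torsion]; but J lies in Q,
   which contains neither s nor the image of r. *)
have [z Jz [s [l [ns ez]]]|Q' [JQ' Q'S]] := @prime_avoid X noethX J (MultSet Sm).
  have nal : ~ c k (a ^+ l).
    by elim: (l) => [|l' IHl]; [apply: prime1|rewrite exprS => /primeM[]].
  have [|r [nr Jrs]] := join_torsion (ncr k (ltnW kd)) (primeRB P) nal (x := s).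
    by rewrite rmorphXn mulrC -ez.
  have /primeM[/QP//|//] := JQ _ Jrs.
have Q'Q : Q' `<=` Q.
  move=> z Q'z; apply: contrapT => nz; apply: (Q'S z) => //.
  by exists z, 0%N; rewrite mulr1.
apply: (pchain_rcons (P := Q')) => //.
  apply: IH => [|x /Q'Q/QP//|x cx|x qx]; first exact: ltnW.
    by apply/JQ'/sub_gen; left.
  by apply/JQ'/sub_gen; right.
move=> /(_ _ Qa) Q'a; apply: (Q'S _ Q'a); exists 1, 1%N; rewrite mul1r expr1; split=> //.
exact: prime1.
Qed.

Local Notation F := (fibre P).
Local Notation f := (linj \o fibre_map P : {rmorphism X -> locAt (fibre_prime P)}).

Lemma fibre_map_near_surj : near_surj (fibre_map P).
Proof.
move=> e; have [x [y [c [cy ey]]]] := fibre_frac e.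
by exists x, (fibre_map P y), c; rewrite -ey [_ * e]mulrC.
Qed.

Lemma loc_fibre_near_surj : near_surj f.
Proof. exact: near_surj_comp fibre_map_near_surj (@linj_near_surj _ _). Qed.

Lemma loc_fibre_max x : maxideal (f x) <-> P x.
Proof.
rewrite -(rinj_eq0 P) -fibre_to_residueE -fibre_idealP.
exact: mem_locAt_max.
Qed.

Lemma loc_fibre_ext : extAB `<=` [set x | f x = 0].
Proof.
move=> _ [[a pa <-]|[b qb <-]]; rewrite /= (_ : fibre_map P _ = 0) ?rmorph0 //.
  apply: (etrans (fibre_map_inl P a)).
  have e : rinj p a = 0 by apply/rinj_eq0.
  by change (tinl (residue_map (primeRA P)) (residue_map (primeRB P)) (rinj p a) = 0);
    rewrite e rmorph0.
apply: (etrans (fibre_map_inr P b)).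
have e : rinj q b = 0 by apply/rinj_eq0.
by change (tinr (residue_map (primeRA P)) (residue_map (primeRB P)) (rinj q b) = 0);
  rewrite e rmorph0.
Qed.

Lemma local_prime_sub (S : localRingType) (c : primeIdeal S) : c `<=` @maxideal S.
Proof.
move=> x cx; apply/maxidealP => -[y yx]; apply: (@prime1 _ c).
by rewrite -yx; apply: idealMl.
Qed.

Lemma fibre_chain_contract d :
  (exists c : nat -> primeIdeal (locAt (fibre_prime P)),
    forall i, (i < d)%N -> (c i : set _) `<` c i.+1) ->
  pchain extAB P d.
Proof.
move=> [c inc].
have ch : pchain [set 0] (@maxideal (locAt (fibre_prime P))) d.
  exists c; split=> [_ ->||i /inc[ci nci]]; [exact: ideal0|exact: local_prime_sub|].
  by split.
have := pchain_contract loc_fibre_near_surj ch.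
apply: pchain_weak; first exact: loc_fibre_ext.
by move=> x /loc_fibre_max.
Qed.

Section Extend.
Variable c : primeIdeal X.
Hypothesis cP : c `<=` P.
Hypothesis extc : extAB `<=` c.

Lemma extend_A a : p a <-> c (tinl phi psi a).
Proof. by split=> [pa|/cP //]; apply: extc; left; exists a. Qed.

Lemma extend_B b : q b <-> c (tinr phi psi b).
Proof. by split=> [qb|/cP //]; apply: extc; right; exists b. Qed.

Lemma fibre_to_residue_at : exists g : {rmorphism F -> residue (locAt c)},
  forall x, g (fibre_map P x) = rinj c x.
Proof.
have gr r : residue_map extend_A (residue_map (primeRA P) r) =
    residue_map extend_B (residue_map (primeRB P) r).
  apply: (@residue_hom_ext _ _ _ (residue_map extend_A \o residue_map (primeRA P))
    (residue_map extend_B \o residue_map (primeRB P))) => {}r.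
  change (residue_map extend_A (residue_map (primeRA P) (rinj n r)) =
    residue_map extend_B (residue_map (primeRB P) (rinj n r))).
  by rewrite !residue_map_rinj; congr (rinj c _); exact: tensorC.
have [g [gl gr']] := tlift_ex gr.
have gA a : g (fibre_map P (tinl phi psi a)) = rinj c (tinl phi psi a).
  exact: etrans (congr1 g (fibre_map_inl P a)) (etrans (gl _) (residue_map_rinj extend_A a)).
have gB b : g (fibre_map P (tinr phi psi b)) = rinj c (tinr phi psi b).
  exact: etrans (congr1 g (fibre_map_inr P b)) (etrans (gr' _) (residue_map_rinj extend_B b)).
by exists g; exact: (tensor_hom_ext (h1 := g \o fibre_map P) (h2 := rinj c) gA gB).
Qed.

(** The extension of c is obtained as the kernel of a map to the residue field at c, which makes its
    primality and its contraction to X immediate. *)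
Lemma extend_prime : exists c' : primeIdeal (locAt (fibre_prime P)),
  forall x, c' (f x) <-> c x.
Proof.
have [g gE] := fibre_to_residue_at.
have [|V VE] := @llift_ex F (residue (locAt c)) (MultSet (compl_subproof (fibre_prime P))) g.
  move=> s ns; have [x [y [d [dy sy]]]] := fibre_frac s.
  have nPx : ~ P x.
    move=> Px; apply: ns; rewrite -[s]mulr1 -dy mulrCA sy; apply: idealMl.
    by apply: sub_gen; exists x.
  have [w wx] : exists w, w * rinj c x = 1 by apply: rinj_unit => /cP.
  exists (w * g (fibre_map P y)); rewrite -mulrA -rmorphM [_ * s]mulrC sy gE.
  exact: wx.
have kp : prime_axiom (kerid V).
  split=> [|x y]; first by rewrite /= rmorph1; exact: residue_neq0.
  by move=> xy0; apply: residue_eq0M; rewrite -(rmorphM V).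
exists (PrimeIdeal kp) => x.
by rewrite -(rinj_eq0 c) -gE; rewrite /= VE.
Qed.

End Extend.

Lemma fibre_chain_extend d : pchain extAB P d ->
  exists c : nat -> primeIdeal (locAt (fibre_prime P)),
    forall i, (i < d)%N -> (c i : set _) `<` c i.+1.
Proof.
move=> [c [Ic cP inc]].
have Ici i : (i <= d)%N -> extAB `<=` c i.
  by move=> id x /Ic; apply: (chain_mono inc).
have cPi i : (i <= d)%N -> c i `<=` P.
  by move=> id x /(chain_mono inc id (leqnn _))/cP.
have /choice[c' c'E] i : exists c' : primeIdeal (locAt (fibre_prime P)),
    (i <= d)%N -> forall x, c' (f x) <-> c i x.
  have [id|id] := boolP (i <= d)%N; last first.
    by exists (PrimeIdeal (islocal_prime (@locAt_islocal _ (fibre_prime P)))).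
  by have [c' h] := extend_prime (cPi i id) (Ici i id); exists c'.
have sub i j : (i <= d)%N -> (j <= d)%N -> (c' i `<=` c' j) <-> (c i `<=` c j).
  move=> id jd; split=> [h x /(c'E i id)/h/(c'E j jd)//|h z c'z].
  have [x [v [w [wv fx]]]] := loc_fibre_near_surj z.
  rewrite -[z]mul1r -wv -mulrA -fx; apply/idealMl/(c'E j jd)/h/(c'E i id).
  by rewrite fx; apply: idealMl.
exists c' => i id; have [ci nci] := inc i id.
split; first by apply/(sub i i.+1 (ltnW id) id).
by move=> h; apply: nci; apply/(sub i.+1 i id (ltnW id)).
Qed.

End Tensor.

(** * The dimension formula *)

Lemma krull_dimE (S : comPzRingType) t :
  (forall d, (exists c : nat -> primeIdeal S,
     forall i, (i < d)%N -> (c i : set S) `<` c i.+1) -> (d <= t)%N) ->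
  (exists c : nat -> primeIdeal S, forall i, (i < t)%N -> (c i : set S) `<` c i.+1) ->
  krull_dim S = (t%:Z%:E)%E.
Proof.
move=> ub ch; rewrite /krull_dim /supremum; case: ifPn => [/eqP e|_].
  have : (set0 : set (\bar int)) (t%:Z%:E)%E by rewrite -e; exists t.
  by [].
apply: xget_subset1; last exact: is_subset1_supremums.
split=> [_ [d hd <-]|y]; last by apply; exists t.
by rewrite lee_fin lez_nat; apply: ub.
Qed.

Lemma smooth_fibre_chain (R A : comPzRingType) (mR : ideal R) (mA : ideal A)
    (f : {rmorphism R -> A}) e (x : 'I_e -> A) :
  noetherian A -> islocal mR -> islocal mA -> (forall y, mR y -> mA (f y)) ->
  fsmooth mA f -> cobasis mA (gen (f @` mR)) x -> pchain (f @` mR) mA e.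
Proof.
move=> nA lR lA fm fs xb; set J := gen _ in xb.
have [q qk] := field_char (qring_isfield lR).
have Jm : J `<=` mA by apply: gen_min => _ [r mr <-]; apply: fm.
have h r : mR r -> (qproj J \o f) r = 0.
  by move=> mr; apply/qproj_eq0/sub_gen; exists r.
have ch := regular_chain (near_surj_noetherian (@qproj_near_surj _ J) nA)
  (imgq_islocal Jm lA) (has_char_rmorph (qlift h) qk) (fsmooth_abs_smooth lR fs qk)
  (imgq_cobasis Jm (conj (fun _ => id) (fun _ => id)) xb).
have := pchain_contract (@qproj_near_surj _ J) ch; apply: pchain_weak.
  by move=> _ [r mr <-]; apply/qproj_eq0/sub_gen; exists r.
by move=> y /(imgqP Jm).
Qed.

Lemma loc_fibre_chain (R A : comPzRingType) (f : {rmorphism R -> A})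
    (P : primeIdeal R) (Q : primeIdeal A) (PQ : forall a, P a <-> Q (f a))
    e (x : 'I_e -> locAt Q) :
  noetherian A -> fsmooth (@maxideal (locAt Q)) (loc_map PQ) ->
  cobasis (@maxideal (locAt Q)) (gen (loc_map PQ @` @maxideal (locAt P))) x ->
  pchain (f @` P) Q e.
Proof.
move=> nA fs xb.
have nS : noetherian (locAt Q) := near_surj_noetherian (@linj_near_surj _ _) nA.
have ch := smooth_fibre_chain nS (@locAt_islocal _ P) (@locAt_islocal _ Q)
  (@loc_map_max _ _ _ _ _ PQ) fs xb.
have := pchain_contract (@linj_near_surj _ _) ch; apply: pchain_weak.
  move=> _ [r Pr <-]; exists (linj r); last exact: loc_map_linj.
  exact/mem_locAt_max.
by move=> y /mem_locAt_max.
Qed.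

Lemma loc_map_locext (R A : comPzRingType) (f : {rmorphism R -> A})
    (P : primeIdeal R) (Q : primeIdeal A) (PQ : forall a, P a <-> Q (f a)) (c : ideal A) :
  (forall r, P r -> c (f r)) ->
  gen (loc_map PQ @` @maxideal (locAt P)) `<=` locext Q c.
Proof.
move=> Pc; apply: gen_min => _ [z mz <-].
elim/lfracW: z mz => r s /mem_locAt_max Pr.
have -> : lfrac r s = lfrac 1 s * linj r.
  by rewrite -(lfracK r s) mulrCA linj_unit mulr1.
rewrite rmorphM loc_map_linj; apply: idealMl.
by exists (f r), (den1 _); split=> //; apply: Pc.
Qed.

Lemma embdim_add (R A : comPzRingType) (f : {rmorphism R -> A})
    (P : primeIdeal R) (Q : primeIdeal A) (PQ : forall a, P a <-> Q (f a)) d e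
    (r : 'I_d -> locAt P) (x : 'I_e -> locAt Q) :
  fsmooth (@maxideal (locAt Q)) (loc_map PQ) ->
  cobasis (@maxideal (locAt P)) (izero _) r ->
  cobasis (@maxideal (locAt Q)) (gen (loc_map PQ @` @maxideal (locAt P))) x ->
  embdim (locAt Q) = ((d + e)%N%:Z%:E)%E.
Proof.
move=> fs rb xb; apply: embdimE.
exact: cobasis_cat (@locAt_islocal _ P) (@locAt_islocal _ Q)
  (@loc_map_max _ _ _ _ _ PQ) fs rb xb.
Qed.

Section FibreDimension.
Variables (R A B : comPzRingType).
Variables (phi : {rmorphism R -> A}) (psi : {rmorphism R -> B}).
Local Notation X := (tensor phi psi).
Hypotheses (noethA : noetherian A) (noethX : noetherian X).
Variable P : primeIdeal X.
Let p := primeA P.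
Let q := primeB P.
Let n := primeR P.
Hypothesis smA : fsmooth (@maxideal (locAt p)) (loc_map (primeRA P)).
Hypothesis smB : fsmooth (@maxideal (locAt P)) (loc_map (primeB_tinr P)).
Variables (a0 s0 : nat) (x : 'I_a0 -> locAt p) (y : 'I_s0 -> locAt P).
Hypothesis xb : cobasis (@maxideal (locAt p))
  (gen (loc_map (primeRA P) @` @maxideal (locAt n))) x.
Hypothesis yb : cobasis (@maxideal (locAt P))
  (gen (loc_map (primeB_tinr P) @` @maxideal (locAt q))) y.

(** Imposing s0 numerators of the y_i costs at most s0 steps. If a step remained, its lower prime
    would contain them and q, hence P, by [cobasis_prime_eq]. *)
Lemma height_bound l : pchain (extB P) P l -> (l <= s0)%N.
Proof.
move=> ch; rewrite leqNgt; apply/negP => sl.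
have [my _ _] := yb; have [b hb] := numerators my.
pose s := [seq b i | i <- enum 'I_s0].
have sE : size s = s0 by rewrite size_map size_enum_ord.
have sP : [set` s] `<=` P by move=> _ /mapP[i _ ->]; case: (hb i).
(* Written so that the length left after removing s0 is visibly a successor. *)
have lE : l = ((l - s0.+1).+1 + size s)%N by rewrite sE; move: sl; clear; lia.
rewrite lE in ch; have [c [Ic cP inc]] := pchain_pit_seq noethX sP ch.
have c0P : c 0%N `<=` P by move=> z /(chain_mono inc (leq0n _) (leqnn _))/cP.
have Pc : P `<=` c 0%N.
  apply: (cobasis_prime_eq noethX yb c0P) => [i|].
    have [_ h] := hb i; apply: h; apply: Ic; right; apply: map_f.
    by rewrite mem_enum.
  by apply: loc_map_locext => z qz; apply: Ic; left; exists z.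
apply: (inc 0%N isT).2 => z hz; apply: Pc; apply: cP.
exact: (chain_mono inc (ltn0Sn _) (leqnn _)).
Qed.

Lemma fibre_chain_bound t : pchain (extAB P) P t -> (a0 + t <= s0)%N.
Proof.
move=> ch; apply: height_bound; apply: pchain_join ch => Q IQ QP.
apply: (going_down noethX) => //; exact: loc_fibre_chain smA xb.
Qed.

(** Smoothness over B gives a chain of length s0 over q. Imposing a0 numerators of the x_i makes the
    bottom prime contract to a prime of A that contains p. *)
Lemma fibre_chain_max : pchain (extAB P) P (s0 - a0).
Proof.
(* The trivial chain P of the fibre gives this bound, so the subtraction s0 - a0 is not
   truncated. *)
have as0 : (a0 <= s0)%N.
  have := @fibre_chain_bound 0; rewrite addn0; apply.
  by apply: (pchain0 (P := P)) => // z; case=> -[w hw <-].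
have chP : pchain (extB P) P s0 := loc_fibre_chain noethX smB yb.
have [mx _ _] := xb; have [a ha] := numerators mx.
pose s := [seq tinl phi psi (a i) | i <- enum 'I_a0].
have sE : size s = a0 by rewrite size_map size_enum_ord.
have sP : [set` s] `<=` P by move=> _ /mapP[i _ ->]; case: (ha i).
rewrite -(subnK as0) -sE in chP.
have := pchain_pit_seq noethX sP chP; rewrite sE.
move=> [c [Ic cP inc]]; exists c; split=> //.
have c0P : c 0%N `<=` P by move=> z /(chain_mono inc (leq0n _) (leqnn _))/cP.
move=> u [[z pz <-]|hu]; last by apply: Ic; left.
suff : p `<=` contract (tinl phi psi) (c 0%N) by apply.
apply: (cobasis_prime_eq noethA xb) => [w /c0P //|i|].
  have [_ h] := ha i; apply: h; apply: Ic; right; apply: map_f.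
  by rewrite mem_enum.
apply: loc_map_locext => r nr; apply: Ic; left.
by exists (psi r); [apply/primeRB|exact/esym/tensorC].
Qed.

Lemma fibre_krull_dim : krull_dim (locAt (fibre_prime P)) = ((s0 - a0)%N%:Z%:E)%E.
Proof.
apply: krull_dimE => [d /fibre_chain_contract/fibre_chain_bound h|].
  by move: h; clear; lia.
exact/fibre_chain_extend/fibre_chain_max.
Qed.

End FibreDimension.

Local Open Scope ereal_scope.

Theorem corollary7p5 (R A B : comPzRingType)
  (phi : {rmorphism R -> A}) (psi : {rmorphism R -> B})
  (noethR : noetherian R) (noethA : noetherian A) (noethB : noetherian B)
  (noethAB : noetherian (tensor phi psi))
  (P : primeIdeal (tensor phi psi))
  (smooth : formally_smooth (loc_map (primeRA P))) :
  embdim (locAt P) =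
    embdim (locAt (primeA P)) + embdim (locAt (primeB P))
    - embdim (locAt (primeR P)) + krull_dim (locAt (fibre_prime P)).
Proof.
have smA := formally_smoothW smooth; have smB := fsmooth_base_change smA.
have loc_noeth (T : comPzRingType) (Q : primeIdeal T) (nT : noetherian T) :
  noetherian (locAt Q) := near_surj_noetherian (@linj_near_surj _ _) nT.
have [eR [r rb]] := cobasis_ex (izero _) (loc_noeth _ (primeR P) noethR) (@locAt_islocal _ _).
have [eB [b bb]] := cobasis_ex (izero _) (loc_noeth _ (primeB P) noethB) (@locAt_islocal _ _).
have [a0 [x xb]] := cobasis_ex
  (gen (loc_map (primeRA P) @` @maxideal (locAt (primeR P))))%classic
  (loc_noeth _ (primeA P) noethA) (@locAt_islocal _ _).
have [s0 [y yb]] := cobasis_ex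
  (gen (loc_map (primeB_tinr P) @` @maxideal (locAt (primeB P))))%classic
  (loc_noeth _ P noethAB) (@locAt_islocal _ _).
(* The formula becomes eB + s0 = (eR + a0) + eB - eR + (s0 - a0). *)
rewrite (embdim_add smB bb yb) (embdim_add smA rb xb) (embdimE bb) (embdimE rb).
rewrite (fibre_krull_dim noethA noethAB smA smB xb yb).
have as0 : (a0 <= s0)%N.
  have := fibre_chain_bound noethA noethAB smA xb yb (t := 0); rewrite addn0; apply.
  by apply: (pchain0 (P := P)) => // z; case=> -[w hw <-].
by rewrite -!EFinD; congr (_%:E); rewrite -(subzn as0) !PoszD; ring.
Qed.
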